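(* The set of good characters in $K^P$ forms a $K$-subalgebra of $K^P$.
   Context: $K$ is an algebraically closed field of characteristic zero, $\mathbb{N}=\{0,1,2,\dots\}$, and a type $((p_i,q_i))_{i=1}^r\in(\mathbb{N}^2)^r$ is fixed. Diagrams. A diagram with $q$ inputs and $p$ outputs consists of a finite set of boxes, each labelled by one of the symbols $x_1,\dots,x_r$, where a box labelled $x_i$ has $q_i$ ordered input slots and $p_i$ ordered output slots; a bijection (the strings) from the disjoint union of $\{$global inputs $1,\dots,q\}$ and the output slots of all boxes onto the disjoint union of $\{$global outputs $1,\dots,p\}$ and the input slots of all boxes; and a finite number of closed loops. Diagrams are equivalent if isomorphic. $Con^{p,q}$ is the $K$-vector space with basis the equivalence classes, thought of as formal morphisms $W^{\otimes q}\to W^{\otimes p}$; composition is gluing, tensor product is juxtaposition. $\mathfrak{U}:=Con^{0,0}$ is a commutative algebra under juxtaposition, and is the polynomial algebra on the set $P$ of (equivalence classes of) closed connected diagrams, i.e. nonempty connected diagrams with no global inputs or outputs, the single loop included. A character is a $K$-algebra homomorphism $\mathfrak{U}\to K$; by restriction, characters are identified with functions $P\to K$, i.e. with elements of $K^P$, which is a $K$-algebra under pointwise addition, multiplication and scalar multiplication. Closing up strings gives $\operatorname{Tr}:Con^{p,p}\to\mathfrak{U}$, and $\operatorname{pair}^{p,q}(T_1\otimes T_2)=\operatorname{Tr}(T_1\circ T_2)$ defines $Con^{p,q}\otimes Con^{q,p}\to\mathfrak{U}$. $\mathcal{C}_0$ has objects $W^{a,b}$ ($a,b\in\mathbb{N}$),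 thought of as $W^{\otimes a}\otimes(W^* )^{\otimes b}$, and $\operatorname{Hom}_{\mathcal{C}_0}(W^{a,b},W^{c,d})=Con^{c+b,d+a}$ (interpreted through duality); composition, tensor product $W^{a,b}\otimes W^{c,d}=W^{a+c,b+d}$, symmetry and duality $(W^{a,b})^*=W^{b,a}$ are given by the corresponding gluing of strings. $\mathcal{C}_{univ}$ is its additive envelope; it is rigid symmetric monoidal with $\operatorname{End}(\mathbf{1})=\mathfrak{U}$, so categorical traces lie in $\mathfrak{U}$. For a character $\chi$ put $\operatorname{rad}_\chi^{p,q}=\{f\in Con^{p,q}:\chi(\operatorname{pair}^{p,q}(f\otimes g))=0\ \forall g\in Con^{q,p}\}$ and $\mathcal{N}_\chi(W^{a,b},W^{c,d})=\operatorname{rad}_\chi^{c+b,d+a}$, extended componentwise to direct sums; morphisms in $\mathcal{N}_\chi$ are called $\chi$-negligible. A character $\chi$ is good if (1) for all $p,q\in\mathbb{N}$ the subspace $\operatorname{rad}_\chi^{p,q}\subseteq Con^{p,q}$ has finite codimension, and (2) if $B\in\mathcal{C}_{univ}$ and $T:B\to B$ is such that $T^r$ is $\chi$-negligible for some $r>0$, then $\chi(\operatorname{Tr}(T))=0$. (Equivalently, $\chi$ is the character of invariants of an algebraic structure of type $((p_i,q_i))$ in some $K$-linear rigid abelian symmetric monoidal category with finite dimensional hom-spaces and $\operatorname{End}(\mathbf{1})=K$.) *)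

(* Defs.v *)
From HB Require Import structures.
From mathcomp Require Import all_boot all_order all_algebra.
From mathcomp Require Import finmap.
From mathcomp.multinomials Require Import monalg.

Set Implicit Arguments.
Unset Strict Implicit.
Unset Printing Implicit Defensive.

Import GRing.Theory.
Local Open Scope ring_scope.
Local Open Scope quotient_scope.

Section FiniteBijections.
Variables A B : finType.
Implicit Types f : A -> B.

Definition bijectiveb f := injectiveb f && [forall y, y \in codom f].

Lemma bijectivebP f : reflect (bijective f) (bijectiveb f).
Proof.
apply: (iffP andP) => [[/injectiveP injf /forallP surjf]|[g fK gK]].
  by exists (fun y => iinv (surjf y)) => [x|y]; [apply: injf|]; rewrite f_iinv.
split; first by apply/injectiveP; apply: can_inj fK.
by apply/forallP => y; rewrite -(gK y) codom_f.
Qed.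

Lemma card_inj_bij f : injective f -> #|A| = #|B| -> bijective f.
Proof. by move=> injf cAB; apply: inj_card_bij => //; rewrite cAB. Qed.

End FiniteBijections.

(* For s : J + X -> J + Y injective, every j : J being at once an endpoint    *)
(* and a starting point, follow s until Y is reached.  At most #|J| further   *)
(* steps are needed, and the j : J from which Y is never reached are          *)
(* partitioned into cycles.                                                   *)
Section Follow.
Variables J X Y : finType.
Variable s : J + X -> J + Y.

Fixpoint follow (k : nat) (z : J + Y) : J + Y :=
  match z, k with
  | inl j, k'.+1 => follow k' (s (inl j))
  | _, _ => z
  end.

Definition trapped (j : J) : bool :=
  if follow #|J| (inl j) is inl _ then true else false.

Definition next_or_stay (j : J) : J :=
  if s (inl j) is inl j' then j' else j.

Definition num_cycles : nat :=
  #|[set [set j' in orbit next_or_stay j] | j in [set j | trapped j]]|.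

Hypothesis bij_s : bijective s.

(* [trail k x z]: z is the k-th endpoint met on the way from x *)
Fixpoint trail (k : nat) (x : J + X) (z : J + Y) : Prop :=
  if k is k'.+1 then exists2 j, trail k' x (inl j) & s (inl j) = z
  else s x = z.

Lemma trail_inj k l x x' z :
  trail k (inr x) z -> trail l (inr x') z -> k = l /\ x = x'.
Proof.
have inj_s := bij_inj bij_s.
elim: k l z => [|k IHk] [|l] z /=.
- by move=> <- /inj_s [].
- by move=> <- [j _ /inj_s].
- by move=> [j _ <-] /inj_s.
- by case=> j tj <- [j' tj' /inj_s [ej]]; subst j'; case: (IHk _ _ tj tj') => ->.
Qed.

Lemma trail_follow m k x z : trail k x z -> exists l, trail l x (follow m z).
Proof.
elim: m k z => [|m IHm] k [j|y] tz /=; try by exists k.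
by apply: (IHm k.+1); exists j.
Qed.

Lemma trail_long m k x z j : trail k x z -> follow m z = inl j ->
  forall i, (i <= m)%N -> exists j', trail (k + i)%N x (inl j').
Proof.
elim: m k z => [|m IHm] k [j0|y] //= tz fz [|i] // lim; rewrite ?addn0 ?addnS.
- by exists j0.
- by exists j0.
- by rewrite -addSn; apply: (IHm k.+1 (s (inl j0))) => //; exists j0.
Qed.

Lemma exit_proof x : exists y, follow #|J| (s (inr x)) == inr y.
Proof.
case fz: (follow _ _) => [j|y]; last by exists y.
have /fin_all_exists [F FP] : forall i : 'I_#|J|.+1,
    exists j', trail i (inr x) (inl j').
  by case=> i /= lti; apply: (@trail_long #|J| 0 _ (s (inr x)) j).
have /leq_card : injective F.
  move=> i i' eF; apply: val_inj; have := FP i'; rewrite -eF.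
  by move=> /trail_inj /(_ (FP i)) [].
by rewrite card_ord ltnn.
Qed.

Definition exit (x : X) : Y := xchoose (exit_proof x).

Lemma exit_bij : bijective exit.
Proof.
have exit_trail x : exists k, trail k (inr x) (inr (exit x)).
  rewrite -(eqP (xchooseP (exit_proof x))).
  exact: (@trail_follow _ 0).
apply: card_inj_bij => [x x' eqe|].
  have [k tk] := exit_trail x; have [l tl] := exit_trail x'.
  by rewrite -eqe in tl; have [] := trail_inj tk tl.
by apply/eqP; rewrite -(eqn_add2l #|J|) -!card_sum (bij_eq_card bij_s).
Qed.

End Follow.

Definition sum_map (A B A' B' : Type) (f : A -> A') (g : B -> B') (z : A + B) :
    A' + B' :=
  match z with inl x => inl (f x) | inr y => inr (g y) end.

Lemma sum_map_bij A B A' B' (f : A -> A') (g : B -> B') :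
  bijective f -> bijective g -> bijective (sum_map f g).
Proof.
case=> f' fK f'K [g' gK g'K]; exists (sum_map f' g').
  by case=> z /=; rewrite ?fK ?gK.
by case=> z /=; rewrite ?f'K ?g'K.
Qed.

Definition sum_lab r n1 n2 (lab1 : {ffun 'I_n1 -> 'I_r})
    (lab2 : {ffun 'I_n2 -> 'I_r}) (u : 'I_n1 + 'I_n2) : 'I_r :=
  match u with inl b => lab1 b | inr b => lab2 b end.

Definition cat_lab r n1 n2 (lab1 : {ffun 'I_n1 -> 'I_r})
    (lab2 : {ffun 'I_n2 -> 'I_r}) : {ffun 'I_(n1 + n2) -> 'I_r} :=
  [ffun b => sum_lab lab1 lab2 (split b)].

(* The input (or output) slots of the boxes 'I_n, where a box labelled i has  *)
(* w i of them.                                                               *)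
Section Slots.
Variables (r : nat) (w : 'I_r -> nat).

Definition slot n (lab : {ffun 'I_n -> 'I_r}) := {b : 'I_n & 'I_(w (lab b))}.
HB.instance Definition _ n lab := Finite.on (@slot n lab).

Lemma slot_eq n (lab : {ffun 'I_n -> 'I_r}) (x x' : slot lab) :
  tag x = tag x' -> tagged x = tagged x' :> nat -> x = x'.
Proof.
case: x x' => [b j] [b' j'] /= eb; subst b' => ej.
by congr existT; apply: val_inj.
Qed.

Definition same_point m n1 n2 (lab1 : {ffun 'I_n1 -> 'I_r})
    (lab2 : {ffun 'I_n2 -> 'I_r}) (f : 'I_n1 -> 'I_n2)
    (z : 'I_m + slot lab1) (z' : 'I_m + slot lab2) : bool :=
  match z, z' with
  | inl i, inl i' => i == i'
  | inr x, inr x' =>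
      (f (tag x) == tag x') && (tagged x == tagged x' :> nat)
  | _, _ => false
  end.

Lemma same_point_id m n (lab : {ffun 'I_n -> 'I_r})
    (z z' : 'I_m + slot lab) : same_point id z z' = (z == z').
Proof.
case: z z' => [i|x] [i'|x'] //=; apply/andP/eqP => [[/eqP e1 /eqP e2]|[->] //].
by congr inr; apply: slot_eq.
Qed.

Lemma same_point_can m n1 n2 (lab1 : {ffun 'I_n1 -> 'I_r})
    (lab2 : {ffun 'I_n2 -> 'I_r}) f g
    (z : 'I_m + slot lab1) (z' : 'I_m + slot lab2) :
  cancel f g -> cancel g f -> same_point g z' z = same_point f z z'.
Proof.
move=> fK gK; case: z z' => [i|x] [i'|x'] //=.
by rewrite (can2_eq gK fK) [_ == f _]eq_sym [X in _ && X = _]eq_sym.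
Qed.

Lemma same_point_comp m n1 n2 n3 (lab1 : {ffun 'I_n1 -> 'I_r})
    (lab2 : {ffun 'I_n2 -> 'I_r}) (lab3 : {ffun 'I_n3 -> 'I_r}) f g
    (z : 'I_m + slot lab1) (z' : 'I_m + slot lab2) (z'' : 'I_m + slot lab3) :
  same_point f z z' -> same_point g z' z'' -> same_point (g \o f) z z''.
Proof.
case: z z' z'' => [i|x] [i'|x'] [i''|x''] //=; first by move=> /eqP->.
by move=> /andP[/eqP-> /eqP->].
Qed.

Lemma same_point_ex m n1 n2 (lab1 : {ffun 'I_n1 -> 'I_r})
    (lab2 : {ffun 'I_n2 -> 'I_r}) (f : 'I_n1 -> 'I_n2) (z : 'I_m + slot lab1) :
  (forall b, lab2 (f b) = lab1 b) ->
  exists z' : 'I_m + slot lab2, same_point f z z'.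
Proof.
move=> flab; case: z => [i|[b j]]; first by exists (inl i) => /=.
have e : w (lab1 b) = w (lab2 (f b)) by rewrite flab.
by exists (inr (existT _ (f b) (cast_ord e j))); rewrite /= !eqxx.
Qed.

Section Split.
Variables (n1 n2 : nat) (lab1 : {ffun 'I_n1 -> 'I_r}).
Variable lab2 : {ffun 'I_n2 -> 'I_r}.
Let lab12 := cat_lab lab1 lab2.

Fact cat_lab_split b : w (lab12 b) = w (sum_lab lab1 lab2 (split b)).
Proof. by rewrite ffunE. Qed.

Fact cat_lab_lshift b : w (lab1 b) = w (lab12 (lshift n2 b)).
Proof. by rewrite ffunE (unsplitK (inl b)). Qed.

Fact cat_lab_rshift b : w (lab2 b) = w (lab12 (rshift n1 b)).
Proof. by rewrite ffunE (unsplitK (inr b)). Qed.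

Definition split_slot (x : slot lab12) : slot lab1 + slot lab2 :=
  match split (tag x) as u
    return 'I_(w (sum_lab lab1 lab2 u)) -> slot lab1 + slot lab2 with
  | inl b => fun j => inl (existT _ b j)
  | inr b => fun j => inr (existT _ b j)
  end (cast_ord (cat_lab_split (tag x)) (tagged x)).

Definition unsplit_slot (u : slot lab1 + slot lab2) : slot lab12 :=
  match u with
  | inl x => existT _ (lshift n2 (tag x))
               (cast_ord (cat_lab_lshift (tag x)) (tagged x))
  | inr x => existT _ (rshift n1 (tag x))
               (cast_ord (cat_lab_rshift (tag x)) (tagged x))
  end.

Lemma split_slotK : cancel split_slot unsplit_slot.
Proof.
case=> b j; rewrite /split_slot /=; move: (cat_lab_split b).
case: (split b) (splitK b) => b' /= eb e; by apply: slot_eq.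
Qed.

Lemma unsplit_slot_inj : injective unsplit_slot.
Proof.
move=> [x|x] [x'|x'] e; have et : _ = _ :> nat := congr1 (fun y : slot lab12 => tag y : nat) e;
  have ej : _ = _ :> nat := congr1 (fun y : slot lab12 => tagged y : nat) e;
  rewrite /= in et ej.
- by congr inl; apply: slot_eq => //; apply: val_inj.
- by have := ltn_ord (tag x); rewrite et ltnNge leq_addr.
- by have := ltn_ord (tag x'); rewrite -et ltnNge leq_addr.
- by congr inr; apply: slot_eq => //; apply: val_inj; apply: addnI et.
Qed.

Lemma unsplit_slotK : cancel unsplit_slot split_slot.
Proof. exact: inj_can_sym split_slotK unsplit_slot_inj. Qed.

Variables m1 m2 : nat.

Definition split_point (z : 'I_(m1 + m2) + slot lab12) :
    ('I_m1 + slot lab1) + ('I_m2 + slot lab2) :=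
  match z with
  | inl i => sum_map inl inl (split i)
  | inr x => sum_map inr inr (split_slot x)
  end.

Definition unsplit_point (u : ('I_m1 + slot lab1) + ('I_m2 + slot lab2)) :
    'I_(m1 + m2) + slot lab12 :=
  match u with
  | inl (inl i) => inl (lshift m2 i)
  | inl (inr x) => inr (unsplit_slot (inl x))
  | inr (inl i) => inl (rshift m1 i)
  | inr (inr x) => inr (unsplit_slot (inr x))
  end.

Lemma split_pointK : cancel split_point unsplit_point.
Proof.
case=> [i|x] /=; first by case: (split i) (splitK i) => i' /= ->.
by case: (split_slot x) (split_slotK x) => x' <-.
Qed.

Lemma unsplit_pointK : cancel unsplit_point split_point.
Proof.
case=> [[i|x]|[i|x]]; rewrite /split_point /unsplit_point ?unsplit_slotK //.
  by rewrite (unsplitK (inl i)).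
by rewrite (unsplitK (inr i)).
Qed.

End Split.
End Slots.

(* A box labelled i has (ty i).2 input slots and (ty i).1 output slots.       *)
Section Diagrams.
Variables (r : nat) (ty : 'I_r -> nat * nat).

Local Notation oslot := (slot (fun i => (ty i).1)).
Local Notation islot := (slot (fun i => (ty i).2)).

(* dgstr sends global inputs and output slots of boxes to global outputs and  *)
(* input slots of boxes.                                                      *)
Record diagram (p q : nat) := Diagram {
  dgsize : nat;
  dglab : {ffun 'I_dgsize -> 'I_r};
  dgstr : {ffun 'I_q + oslot dglab -> 'I_p + islot dglab};
  dgbij : bijectiveb dgstr;
  dgloops : nat }.

Section DiagramChoice.
Variables p q : nat.

Definition strings n (lab : {ffun 'I_n -> 'I_r}) :=
  {ffun 'I_q + oslot lab -> 'I_p + islot lab}.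

Definition diagram_code :=
  ({n : nat & {lab : {ffun 'I_n -> 'I_r} & strings lab}} * nat)%type.

Definition diagram_encode (D : diagram p q) : diagram_code :=
  (existT (fun n => {lab : {ffun 'I_n -> 'I_r} & strings lab}) (dgsize D)
     (existT (@strings (dgsize D)) (dglab D) (dgstr D)), dgloops D).

Definition diagram_decode (c : diagram_code) : option (diagram p q) :=
  let: (existT n (existT lab s), l) := c in
  if @idP (bijectiveb s) is ReflectT bs then Some (Diagram bs l) else None.

Lemma diagram_encodeK : pcancel diagram_encode diagram_decode.
Proof.
case=> n lab s bs l; rewrite /diagram_decode /=.
by case: {-}_ / idP => // bs'; rewrite (bool_irrelevance bs' bs).
Qed.

HB.instance Definition _ := Choice.copy (diagram p q) (pcan_type diagram_encodeK).
End DiagramChoice.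

Section Isomorphism.
Variables p q : nat.

Definition diagram_iso (D D' : diagram p q) : bool :=
  (dgloops D == dgloops D') &&
  [exists f : {ffun 'I_(dgsize D) -> 'I_(dgsize D')},
    [&& bijectiveb f,
        [forall b, dglab D' (f b) == dglab D b] &
        [forall z, forall z', same_point f z z' ==>
           same_point f (dgstr D z) (dgstr D' z')]]].

Lemma diagram_isoP (D D' : diagram p q) :
  reflect (dgloops D = dgloops D' /\
    exists f : 'I_(dgsize D) -> 'I_(dgsize D'),
    [/\ bijective f, forall b, dglab D' (f b) = dglab D b &
        forall z z', same_point f z z' ->
          same_point f (dgstr D z) (dgstr D' z')])
  (diagram_iso D D').
Proof.
have same_ffun m w n1 n2 (lab1 : {ffun 'I_n1 -> 'I_r})
    (lab2 : {ffun 'I_n2 -> 'I_r}) (f : 'I_n1 -> 'I_n2)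
    (z : 'I_m + slot w lab1) (z' : 'I_m + slot w lab2) :
    same_point (finfun f) z z' = same_point f z z'.
  by case: z z' => [i|x] [i'|x'] //=; rewrite ffunE.
apply: (iffP andP) => [[/eqP-> /existsP[f]]|[-> [f [fbij flab fstr]]]].
  case/and3P=> /bijectivebP fbij /forallP flab /forallP fstr.
  split=> //; exists f; split=> // [b|z z' zz']; first exact/eqP.
  by move/forallP: (fstr z) => /(_ z') /implyP; apply.
split=> //; apply/existsP; exists (finfun f); apply/and3P; split.
- by apply/bijectivebP; apply: (eq_bij fbij) => b; rewrite ffunE.
- by apply/forallP => b; rewrite ffunE flab.
- apply/forallP => z; apply/forallP => z'; apply/implyP.
  by rewrite !same_ffun; apply: fstr.
Qed.

Lemma diagram_iso_refl : reflexive diagram_iso.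
Proof.
move=> D; apply/diagram_isoP; split=> //; exists id; split=> //.
  exact: (Bijective (g := id)).
by move=> z z'; rewrite !same_point_id => /eqP->.
Qed.

Lemma diagram_iso_imp D D' : diagram_iso D D' -> diagram_iso D' D.
Proof.
case/diagram_isoP=> el [f [[g fK gK] flab fstr]].
apply/diagram_isoP; split=> //; exists g; split; first by exists f.
  by move=> b; rewrite -flab gK.
by move=> z z'; rewrite !(same_point_can _ _ fK gK); apply: fstr.
Qed.

Lemma diagram_iso_sym : symmetric diagram_iso.
Proof. by move=> D D'; apply/idP/idP; apply: diagram_iso_imp. Qed.

Lemma diagram_iso_trans : transitive diagram_iso.
Proof.
move=> D' D D'' /diagram_isoP[el [f [fbij flab fstr]]].
move=> /diagram_isoP[el' [g [gbij glab gstr]]].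
apply/diagram_isoP; split; first exact: etrans el'.
exists (g \o f); split.
- exact: bij_comp.
- by move=> b /=; rewrite glab flab.
move=> z z'' zz''; have [z' zz'] := same_point_ex z flab.
apply: (same_point_comp (fstr _ _ zz')); apply: gstr.
case: z z' z'' zz' zz'' => [i|x] [i'|x'] [i''|x''] //=; first by move=> /eqP->.
by move=> /andP[/eqP-> /eqP->].
Qed.

Canonical diagram_iso_equiv :=
  EquivRel diagram_iso diagram_iso_refl diagram_iso_sym diagram_iso_trans.

Definition dclass := {eq_quot diagram_iso}.
HB.instance Definition _ := Choice.on dclass.
HB.instance Definition _ := EqQuotient.on dclass.

End Isomorphism.

Definition no_ord (T : Type) (i : 'I_0) : T :=
  False_rect T (notF (ltn_ord i)).

Section Juxtaposition.
Variables (p1 q1 p2 q2 : nat) (D1 : diagram p1 q1) (D2 : diagram p2 q2).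

Definition juxt_str :=
  [ffun z => unsplit_point (sum_map (dgstr D1) (dgstr D2) (split_point z))].

Fact juxt_bij : bijectiveb juxt_str.
Proof.
apply/bijectivebP; apply: (@eq_bij _ _ (unsplit_point (m2:=_) \o
   (sum_map (dgstr D1) (dgstr D2) \o split_point (m2:=_)))) => [|z]; last first.
  by rewrite ffunE.
apply: bij_comp; last apply: bij_comp.
- exact: Bijective (@unsplit_pointK _ _ _ _ _ _ _ _) (@split_pointK _ _ _ _ _ _ _ _).
- by apply: sum_map_bij; apply/bijectivebP/dgbij.
- exact: Bijective (@split_pointK _ _ _ _ _ _ _ _) (@unsplit_pointK _ _ _ _ _ _ _ _).
Qed.

Definition juxt : diagram (p1 + p2) (q1 + q2) :=
  Diagram juxt_bij (dgloops D1 + dgloops D2).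

End Juxtaposition.

Lemma juxt_iso p1 q1 p2 q2 (D1 D1' : diagram p1 q1) (D2 D2' : diagram p2 q2) :
  diagram_iso D1 D1' -> diagram_iso D2 D2' ->
  diagram_iso (juxt D1 D2) (juxt D1' D2').
Proof.
case/diagram_isoP=> el1 [f1 [fbij1 flab1 fstr1]].
case/diagram_isoP=> el2 [f2 [fbij2 flab2 fstr2]].
apply/diagram_isoP; split => /=; first by congr (_ + _)%N.
pose f := @unsplit _ _ \o sum_map f1 f2 \o @split (dgsize D1) (dgsize D2).
have sameE w m1 m2 u u' :
    same_point f (@unsplit_point _ w _ _ (dglab D1) (dglab D2) m1 m2 u)
      (@unsplit_point _ w _ _ (dglab D1') (dglab D2') m1 m2 u') =
    match u, u' with
    | inl x, inl x' => same_point f1 x x'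
    | inr x, inr x' => same_point f2 x x'
    | _, _ => false
    end.
  rewrite /f; case: u u' => [[i|x]|[i|x]] [[i'|x']|[i'|x']] //=;
    rewrite ?eq_lshift ?eq_rshift ?eq_lrshift ?eq_rlshift //=;
    by rewrite ?(unsplitK (inl _)) ?(unsplitK (inr _)) /=
      ?eq_lshift ?eq_rshift ?eq_lrshift ?eq_rlshift.
exists f; split.
- apply: bij_comp; last exact: Bijective (@splitK _ _) (@unsplitK _ _).
  apply: bij_comp; first exact: Bijective (@unsplitK _ _) (@splitK _ _).
  exact: sum_map_bij.
- move=> b; rewrite !ffunE /f /= unsplitK.
  by case: (split b) => b' /=.
- move=> z z'; rewrite !ffunE.
  rewrite -{1}(split_pointK z) -{1}(split_pointK z') !sameE.
  by case: (split_point z) (split_point z') => u [] u' //=; auto.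
Qed.

(* The diagram without boxes and loops whose strings are given by f. *)
Section Wires.
Variables (p q : nat) (f : 'I_q -> 'I_p) (f_bij : bijective f).

Definition no_lab : {ffun 'I_0 -> 'I_r} :=
  [ffun b => no_ord _ b].

Definition wires_str : {ffun 'I_q + oslot no_lab -> 'I_p + islot no_lab} :=
  [ffun z => match z with
             | inl i => inl (f i)
             | inr x => no_ord _ (tag x)
             end].

Fact wires_bij : bijectiveb wires_str.
Proof.
case: f_bij => g fK gK; apply/bijectivebP.
exists (fun z => match z with
                 | inl i => inl (g i)
                 | inr x => no_ord _ (tag x)
                 end) => [] [i|[[]]] //=; by rewrite ffunE ?fK ?gK.
Qed.

Definition wires : diagram p q := Diagram wires_bij 0.

End Wires.

(* The strings ending at the global outputs in J (as told by eo) are joined   *)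
(* to the strings starting at the global inputs in J (as told by ei); the     *)
(* remaining global outputs and inputs are renumbered.                        *)
Section Glue.
Variables (J : finType) (p q p' q' : nat).
Variables (eo : 'I_p -> J + 'I_p') (ei : J + 'I_q' -> 'I_q).
Hypotheses (eo_bij : bijective eo) (ei_bij : bijective ei).
Variable D : diagram p q.

Definition glue_step (z : J + ('I_q' + oslot (dglab D))) :
    J + ('I_p' + islot (dglab D)) :=
  match dgstr D (match z with
                 | inl j => inl (ei (inl j))
                 | inr (inl i) => inl (ei (inr i))
                 | inr (inr x) => inr x
                 end) with
  | inl o => match eo o with inl j => inl j | inr o' => inr (inl o') end
  | inr x => inr (inr x)
  end.

Fact glue_step_bij : bijective glue_step.
Proof.
have [[go eoK goK] [gi eiK giK]] := (eo_bij, ei_bij).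
have /bijectivebP [t sK tK] := dgbij D.
exists (fun z => match t (match z with
                 | inl j => inl (go (inl j))
                 | inr (inl i) => inl (go (inr i))
                 | inr (inr x) => inr x
                 end) with
  | inl o => match gi o with inl j => inl j | inr o' => inr (inl o') end
  | inr x => inr (inr x)
  end) => z; rewrite /glue_step.
  case es: (dgstr D _) => [o|x] /=; last first.
    by rewrite -es sK; case: z es => [j|[i|x']] //; rewrite eiK.
  case eoo: (eo o) => [j|o'] /=; rewrite -eoo eoK -es sK;
  by case: z es => [j'|[i|x']] //; rewrite eiK.
case es: (t _) => [o|x] /=; last first.
  by rewrite -es tK; case: z es => [j|[i|x']] //; rewrite goK.
case eoo: (gi o) => [j|o'] /=; rewrite -eoo giK -es tK;
by case: z es => [j'|[i|x']] //; rewrite goK.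
Qed.

Definition glue_str := [ffun x => exit glue_step_bij x].

Fact glue_bij : bijectiveb glue_str.
Proof.
apply/bijectivebP; apply: (eq_bij (exit_bij glue_step_bij)) => x.
by rewrite ffunE.
Qed.

Definition glue : diagram p' q' :=
  Diagram glue_bij (dgloops D + num_cycles glue_step).

End Glue.

Section GlueCongruence.
Variables (J : finType) (p q p' q' : nat).
Variables (eo : 'I_p -> J + 'I_p') (ei : J + 'I_q' -> 'I_q).
Hypotheses (eo_bij : bijective eo) (ei_bij : bijective ei).

Lemma glue_iso (D D' : diagram p q) :
  diagram_iso D D' -> diagram_iso (glue eo_bij ei_bij D) (glue eo_bij ei_bij D').
Proof.
case/diagram_isoP=> el [f [fbij flab fstr]].
pose same m w (z : J + ('I_m + slot w (dglab D)))
    (z' : J + ('I_m + slot w (dglab D'))) : bool :=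
  match z, z' with
  | inl j, inl j' => j == j'
  | inr x, inr x' => same_point f x x'
  | _, _ => false
  end.
have same_step z z' : same _ _ z z' ->
    same _ _ (glue_step eo ei z) (glue_step eo ei z').
  rewrite /glue_step => szz'; set z1 := (X in dgstr D X); set z1' := (X in dgstr D' X).
  have : same_point f (dgstr D z1) (dgstr D' z1').
    apply: fstr; rewrite /z1 /z1'.
    by case: z z' szz' {z1 z1'} => [j|[i|x]] [j'|[i'|x']] //= /eqP->.
  case: (dgstr D z1) (dgstr D' z1') => [o|x] [o'|x'] //= /eqP->.
  by case: (eo o') => //= i; rewrite eqxx.
have same_follow k z z' : same _ _ z z' ->
    same _ _ (follow (glue_step eo ei (D:=D)) k z)
             (follow (glue_step eo ei (D:=D')) k z').
  elim: k z z' => [|k IHk] [j|x] [j'|x'] //= szz'.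
  exact/IHk/same_step.
apply/diagram_isoP; split => /=.
  congr (_ + _)%N => //; rewrite /num_cycles.
  have trapE : trapped (glue_step eo ei (D:=D)) =1 trapped (glue_step eo ei (D:=D')).
    move=> j; have := same_follow #|J| (inl j) (inl j) (eqxx j).
    by rewrite /trapped; do 2 case: (follow _ _ _).
  have nextE : next_or_stay (glue_step eo ei (D:=D)) =1
               next_or_stay (glue_step eo ei (D:=D')).
    move=> j; have := same_step (inl j) (inl j) (eqxx j).
    by rewrite /next_or_stay; do 2 case: (glue_step _ _ _) => //; move=> ? ? /eqP.
  have orbE j : [set j' in orbit (next_or_stay (glue_step eo ei (D:=D))) j] =
                [set j' in orbit (next_or_stay (glue_step eo ei (D:=D'))) j].
    by apply/setP => k; rewrite !inE -!fconnect_orbit (eq_fconnect nextE).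
  rewrite (eq_imset _ orbE); congr #|pred_of_set (_ @: pred_of_set _)|.
  by apply/setP => j; rewrite !inE trapE.
exists f; split=> // z z' szz'; rewrite !ffunE.
have := same_follow #|J| _ _ (same_step (inr z) (inr z') szz').
rewrite /=.
by rewrite (eqP (xchooseP (exit_proof (glue_step_bij eo_bij ei_bij D) z))) (eqP (xchooseP (exit_proof (glue_step_bij eo_bij ei_bij D') z'))).
Qed.
End GlueCongruence.

(* Composition of D1 : W^q -> W^p and D2 : W^s -> W^q. *)
Section Composition.
Variables p q s : nat.

Definition comp_out (o : 'I_(p + q)) : 'I_q + 'I_p :=
  match split o with inl i => inr i | inr j => inl j end.

Fact comp_out_bij : bijective comp_out.
Proof.
exists (fun u => unsplit match u with inl j => inr j | inr i => inl i end).
  by move=> o; rewrite /comp_out; case: (split o) (splitK o).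
by rewrite /comp_out => -[j|i]; rewrite unsplitK.
Qed.

Fact comp_in_bij : bijective (@unsplit q s).
Proof. exact: Bijective (@unsplitK q s) (@splitK q s). Qed.

Definition dcomp (D1 : diagram p q) (D2 : diagram q s) : diagram p s :=
  glue comp_out_bij comp_in_bij (juxt D1 D2).

End Composition.

Section Trace.
Variable p : nat.

Definition trace_out (o : 'I_p) : 'I_p + 'I_0 := inl o.
Definition trace_in (u : 'I_p + 'I_0) : 'I_p :=
  match u with inl i => i | inr z => no_ord _ z end.

Fact trace_out_bij : bijective trace_out.
Proof. by exists trace_in => // -[|[]]. Qed.

Fact trace_in_bij : bijective trace_in.
Proof. by exists trace_out => // -[|[]]. Qed.

Definition dtrace (D : diagram p p) : diagram 0 0 :=
  glue trace_out_bij trace_in_bij D.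

End Trace.

(* The object W^{a,b} of C_0 is the pair (a, b), and a morphism from          *)
(* W^{a,b} to W^{c,d} is given by diagrams with c + b outputs and d + a       *)
(* inputs: the last b outputs and the first d inputs stand for the dual       *)
(* tensor factors of the source and of the target, respectively.              *)
Definition hom0 (T : nat -> nat -> Type) (X Y : nat * nat) : Type :=
  T (Y.1 + X.2)%N (Y.2 + X.1)%N.

Section CategoryC0.

Definition id0_wire (a b : nat) (i : 'I_(b + a)) : 'I_(a + b) :=
  unsplit match split i with inl j => inr j | inr k => inl k end.

Fact id0_bij a b : bijective (@id0_wire a b).
Proof.
by exists (@id0_wire b a) => i; rewrite /id0_wire; case: (split i) (splitK i) => j /= <-;
  rewrite ?(unsplitK (inl _)) ?(unsplitK (inr _)).
Qed.

Definition did0 (X : nat * nat) : hom0 diagram X X := wires (@id0_bij X.1 X.2).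

Section Comp0.
(* E : W^{c,d} -> W^{e,f} after D : W^{a,b} -> W^{c,d} *)
Variables a b c d e f : nat.

Definition comp0_out (o : 'I_((e + d) + (c + b))) : ('I_c + 'I_d) + 'I_(e + b) :=
  match split o with
  | inl o1 => match split o1 with
              | inl i => inr (lshift b i)
              | inr j => inl (inr j)
              end
  | inr o2 => match split o2 with
              | inl j => inl (inl j)
              | inr i => inr (rshift e i)
              end
  end.

Definition comp0_in (u : ('I_c + 'I_d) + 'I_(f + a)) : 'I_((f + c) + (d + a)) :=
  match u with
  | inl (inl j) => lshift _ (rshift f j)
  | inl (inr j) => rshift _ (lshift a j)
  | inr i => match split i with
             | inl i1 => lshift _ (lshift c i1)
             | inr i2 => rshift _ (rshift d i2)
             end
  end.

Fact comp0_out_bij : bijective comp0_out.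
Proof.
exists (fun u => match u with
  | inl (inl j) => rshift _ (lshift b j)
  | inl (inr j) => lshift _ (rshift e j)
  | inr i => match split i with
             | inl i1 => lshift _ (lshift d i1)
             | inr i2 => rshift _ (rshift c i2)
             end
  end) => u; rewrite /comp0_out.
  case: (split u) (splitK u) => u' /= <-; case: (split u') (splitK u') => i /= <- //.
    by rewrite (unsplitK (inl i)).
  by rewrite (unsplitK (inr i)).
case: u => [[j|j]|i].
- by rewrite (unsplitK (inr _)) (unsplitK (inl _)).
- by rewrite (unsplitK (inl _)) (unsplitK (inr _)).
case: (split i) (splitK i) => i' /= <-.
  by rewrite !(unsplitK (inl _)).
by rewrite !(unsplitK (inr _)).
Qed.

Fact comp0_in_bij : bijective comp0_in.
Proof.
exists (fun o => match split o with
  | inl o1 => match split o1 with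
              | inl i => inr (lshift a i)
              | inr j => inl (inl j)
              end
  | inr o2 => match split o2 with
              | inl j => inl (inr j)
              | inr i => inr (rshift f i)
              end
  end) => u; rewrite /comp0_in.
  case: u => [[j|j]|i].
  - by rewrite (unsplitK (inl _)) (unsplitK (inr _)).
  - by rewrite (unsplitK (inr _)) (unsplitK (inl _)).
  case: (split i) (splitK i) => i' /= <-.
    by rewrite !(unsplitK (inl _)).
  by rewrite !(unsplitK (inr _)).
case: (split u) (splitK u) => u' /= <-; case: (split u') (splitK u') => i /= <- //.
  by rewrite (unsplitK (inl i)).
by rewrite (unsplitK (inr i)).
Qed.

End Comp0.

Definition dcomp0 (X Y Z : nat * nat) (E : hom0 diagram Y Z)
    (D : hom0 diagram X Y) : hom0 diagram X Z :=
  glue (@comp0_out_bij X.2 Y.1 Y.2 Z.1) (@comp0_in_bij X.1 Y.1 Y.2 Z.2)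
    (juxt E D).

Section Trace0.
Variables a b : nat.

Definition trace0_out (o : 'I_(a + b)) : ('I_a + 'I_b) + 'I_0 := inl (split o).

Definition trace0_in (u : ('I_a + 'I_b) + 'I_0) : 'I_(b + a) :=
  match u with
  | inl (inl i) => rshift b i
  | inl (inr j) => lshift a j
  | inr z => no_ord _ z
  end.

Fact trace0_out_bij : bijective trace0_out.
Proof.
exists (fun u => match u with inl v => unsplit v | inr z => no_ord _ z end).
  by move=> o; rewrite /trace0_out splitK.
by case=> [v|[]] //; rewrite /trace0_out unsplitK.
Qed.

Fact trace0_in_bij : bijective trace0_in.
Proof.
exists (fun i => match split i with inl j => inl (inr j) | inr k => inl (inl k) end).
  by case=> [[i|j]|[]] //=; rewrite ?(unsplitK (inl _)) ?(unsplitK (inr _)).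
by move=> i; case: (split i) (splitK i).
Qed.

End Trace0.

Definition dtrace0 (X : nat * nat) (D : hom0 diagram X X) : diagram 0 0 :=
  glue (@trace0_out_bij X.1 X.2) (@trace0_in_bij X.1 X.2) D.

End CategoryC0.

(* A closed diagram without boxes is a disjoint union of loops. *)
Definition adjacent (D : diagram 0 0) (b b' : 'I_(dgsize D)) : bool :=
  [exists x : oslot (dglab D), exists y : islot (dglab D),
    [&& tag x == b, tag y == b' & dgstr D (inr x) == inr y]].

Definition connected (D : diagram 0 0) : bool :=
  if dgsize D == 0%N then dgloops D == 1%N
  else (dgloops D == 0%N) &&
    [forall b, forall b',
      connect (fun c c' => @adjacent D c c' || adjacent c' c) b b'].

Lemma adjacent_iso (D D' : diagram 0 0) (f : 'I_(dgsize D) -> 'I_(dgsize D'))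
    (b c : 'I_(dgsize D)) :
  (forall e, dglab D' (f e) = dglab D e) ->
  (forall z z', same_point f z z' -> same_point f (dgstr D z) (dgstr D' z')) ->
  adjacent b c -> adjacent (f b) (f c).
Proof.
move=> flab fstr /existsP[x /existsP[y /and3P[/eqP xb /eqP yc /eqP sxy]]].
have [[i'|x'] xx'] := same_point_ex (inr x : 'I_0 + _) flab; first by [].
have := fstr _ _ xx'; rewrite sxy; case sx': (dgstr D' _) => [//|y'] yy'.
apply/existsP; exists x'; apply/existsP; exists y'.
move: xx' yy' => /= /andP[/eqP ex _] /andP[/eqP ey _].
by rewrite -ex -ey xb yc sx' !eqxx.
Qed.

Lemma connected_iso (D D' : diagram 0 0) :
  diagram_iso D D' -> connected D = connected D'.
Proof.
have imp (E E' : diagram 0 0) : diagram_iso E E' -> connected E -> connected E'.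
  case/diagram_isoP=> el [f [fbij flab fstr]]; rewrite /connected -el.
  have -> : (dgsize E' == 0%N) = (dgsize E == 0%N).
    by have := bij_eq_card fbij; rewrite !card_ord => ->.
  case: (dgsize E == 0%N) => // /andP[-> /forallP conE] /=.
  case: fbij (fbij) => g fK gK _; apply/forallP => b; apply/forallP => b'.
  have /forallP /(_ (g b')) := conE (g b); rewrite -{2}(gK b) -{2}(gK b').
  case/connectP=> s; elim: s (g b) => [|c s IHs] d /=.
    by move=> _ ->; apply: connect0.
  case/andP=> adj ps ls; apply: connect_trans (IHs _ ps ls); apply: connect1.
  by case/orP: adj => adj; apply/orP; [left|right]; apply: adjacent_iso adj.
by move=> isoD; apply/idP/idP; apply: imp; rewrite // diagram_iso_sym.
Qed.

Definition closed_connected := {D : dclass 0 0 | connected (repr D)}.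

Definition juxt_class p q p' q' (D : dclass p q) (D' : dclass p' q') :
  dclass (p + p') (q + q') := \pi_(dclass _ _) (juxt (repr D) (repr D')).

Definition comp_class p q s (D : dclass p q) (D' : dclass q s) : dclass p s :=
  \pi_(dclass _ _) (dcomp (repr D) (repr D')).

Definition trace_class p (D : dclass p p) : dclass 0 0 :=
  \pi_(dclass _ _) (dtrace (repr D)).

Definition comp0_class X Y Z (E : hom0 dclass Y Z) (D : hom0 dclass X Y) :
  hom0 dclass X Z := \pi_(dclass _ _) (dcomp0 (repr E) (repr D)).

Definition trace0_class X (D : hom0 dclass X X) : dclass 0 0 :=
  \pi_(dclass _ _) (dtrace0 (repr D)).

Definition id0_class X : hom0 dclass X X := \pi_(dclass _ _) (did0 X).

(* These operations do not depend on the choice of representatives. *)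

Lemma diagram_iso_repr p q (D : diagram p q) :
  diagram_iso (repr (\pi_(dclass p q) D)) D.
Proof. by rewrite -[diagram_iso _ _]eqmodE reprK. Qed.

Lemma pi_juxt p q p' q' (D : diagram p q) (D' : diagram p' q') :
  juxt_class (\pi_(dclass _ _) D) (\pi_(dclass _ _) D') =
  \pi_(dclass _ _) (juxt D D').
Proof. by apply/eqP; rewrite eqmodE; apply: juxt_iso; apply: diagram_iso_repr. Qed.

Lemma pi_comp p q s (D : diagram p q) (D' : diagram q s) :
  comp_class (\pi_(dclass _ _) D) (\pi_(dclass _ _) D') =
  \pi_(dclass _ _) (dcomp D D').
Proof.
by apply/eqP; rewrite eqmodE; apply: glue_iso; apply: juxt_iso; apply: diagram_iso_repr.
Qed.

Lemma pi_trace p (D : diagram p p) :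
  trace_class (\pi_(dclass _ _) D) = \pi_(dclass _ _) (dtrace D).
Proof. by apply/eqP; rewrite eqmodE; apply: glue_iso; apply: diagram_iso_repr. Qed.

Lemma pi_comp0 X Y Z (E : hom0 diagram Y Z) (D : hom0 diagram X Y) :
  @comp0_class X Y Z (\pi_(dclass _ _) E) (\pi_(dclass _ _) D) =
  \pi_(dclass _ _) (dcomp0 E D).
Proof.
by apply/eqP; rewrite eqmodE; apply: glue_iso; apply: juxt_iso; apply: diagram_iso_repr.
Qed.

Lemma pi_trace0 X (D : hom0 diagram X X) :
  @trace0_class X (\pi_(dclass _ _) D) = \pi_(dclass _ _) (dtrace0 D).
Proof. by apply/eqP; rewrite eqmodE; apply: glue_iso; apply: diagram_iso_repr. Qed.

End Diagrams.

Section FreeModules.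
Variables (K : fieldType) (A B C : choiceType).

Definition lin_ext (op : A -> B) (x : {malg K[A]}) : {malg K[B]} :=
  \sum_(a <- msupp x) << x@_a *g op a >>.

Definition bilin_ext (op : A -> B -> C) (x : {malg K[A]}) (y : {malg K[B]}) :
    {malg K[C]} :=
  \sum_(a <- msupp x) \sum_(b <- msupp y) << x@_a * y@_b *g op a b >>.

End FreeModules.

Section Con.
Variables (K : fieldType) (r : nat) (ty : 'I_r -> nat * nat).

(* Con p q is spanned by the diagrams with q inputs and p outputs; linear     *)
(* operations on it extend the operations on diagrams.                        *)
Definition Con (p q : nat) := {malg K[dclass ty p q]}.
HB.instance Definition _ p q := GRing.Lmodule.on (Con p q).

Definition con_comp p q s : Con p q -> Con q s -> Con p s :=
  bilin_ext (@comp_class _ ty p q s).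

Definition con_trace p : Con p p -> Con 0 0 := lin_ext (@trace_class _ ty p).

Definition pairing p q (x : Con p q) (y : Con q p) : Con 0 0 :=
  con_trace (con_comp x y).

(* The algebra structure of U = Con 0 0. *)
Definition Umul : Con 0 0 -> Con 0 0 -> Con 0 0 :=
  bilin_ext (@juxt_class _ ty 0 0 0 0).

Definition Uone : Con 0 0 := << id0_class ty (0, 0)%N >>.

Definition is_character (chi : {scalar Con 0 0}) : Prop :=
  chi Uone = 1 /\ forall x y, chi (Umul x y) = chi x * chi y.

Definition rad (chi : {scalar Con 0 0}) p q (x : Con p q) : Prop :=
  forall y : Con q p, chi (pairing x y) = 0.

Definition hom_comp0 X Y Z : hom0 Con Y Z -> hom0 Con X Y -> hom0 Con X Z :=
  bilin_ext (@comp0_class _ ty X Y Z).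

Definition hom_trace0 X : hom0 Con X X -> Con 0 0 :=
  lin_ext (@trace0_class _ ty X).

(* The additive envelope of C_0: formal finite direct sums of objects of C_0, *)
(* with matrices as morphisms.                                                *)
Record uobj := UObj { usize : nat; usummand :> 'I_usize -> nat * nat }.

Definition uhom (B C : uobj) : Type :=
  forall (i : 'I_(usize C)) (j : 'I_(usize B)), hom0 Con (B j) (C i).

Definition uid (B : uobj) : uhom B B := fun i j =>
  match j =P i with
  | ReflectT e => ecast k (hom0 Con (B j) (B k)) e << id0_class ty (B j) >>
  | ReflectF _ => 0
  end.

Definition ucomp (B C D : uobj) (G : uhom C D) (F : uhom B C) : uhom B D :=
  fun i j => \sum_(k < usize C) hom_comp0 (G i k) (F k j).

Fixpoint upow (B : uobj) (T : uhom B B) (k : nat) : uhom B B :=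
  if k is k'.+1 then ucomp T (upow T k') else @uid B.

Definition utrace (B : uobj) (T : uhom B B) : Con 0 0 :=
  \sum_(i < usize B) hom_trace0 (T i i).

Definition negligible (chi : {scalar Con 0 0}) (B C : uobj) (T : uhom B C) :
  Prop := forall i j, rad chi (T i j).

(* The first clause says that the quotient of Con p q by rad is spanned by    *)
(* finitely many classes.                                                     *)
Definition good (chi : {scalar Con 0 0}) : Prop :=
  (forall p q, exists (n : nat) (e : 'I_n -> Con p q),
     forall x, exists c : 'I_n -> K, rad chi (x - \sum_i c i *: e i)) /\
  (forall (B : uobj) (T : uhom B B) (k : nat), (0 < k)%N ->
     negligible chi (upow T k) -> chi (utrace T) = 0).

(* Characters are identified with their restrictions to closed_connected. *)
Definition good_character (f : closed_connected ty -> K) : Prop :=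
  exists chi : {scalar Con 0 0},
    [/\ is_character chi, good chi & forall D, chi << sval D >> = f D].

End Con.

Definition is_subalgebra (T : Type) (K : fieldType) (S : (T -> K) -> Prop) :=
  [/\ S (fun=> 1),
      forall f g, S f -> S g -> S (fun x => f x + g x),
      forall f g, S f -> S g -> S (fun x => f x * g x) &
      forall c f, S f -> S (fun x => c * f x)].

(* Main.v *)
(* Let g be a function on closed diagrams.  Say that g is twisted on a finite family of objects if
   the arrows x between them act multiplicatively by matrices R x commuting with a matrix W such
   that g (closure of x) = tr (R x W).  A character is good if and only if it is twisted on every
   finite family.  If it is twisted, traces of nilpotent arrows vanish by Fitting's lemma.
   Conversely, a maximal nonzero minor of the trace form gives R, whose Casimir element Z is
   central, and tr (R x) = g (closure of x Z).  If Z were singular, a nonzero idempotent E that is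
   a polynomial in Z with E Z nilpotent would have trace 0, impossible in characteristic 0; so
   W = Z^-1 works.
   Products of characters are handled by tensor products of matrices.  For the sum of g1 and g2,
   let R x be the sum of R1 x' (tensor) R2 x'' over all ways of splitting x, and its ports, into
   two parts x' and x''; on connected closed diagrams only the trivial splittings remain.
   The constant 1 is twisted, hence so is every positive integer.  For the other constants c, given
   a finite family, the rank of the trace form is bounded independently of c and the determinant
   of the Casimir element is a nonzero polynomial in c, so that almost all c are twisted on that
   family; an arbitrary c is the sum of a positive integer n and such a constant c - n. *)

From HB Require Import structures.
From mathcomp Require Import all_boot all_order all_algebra ring.
From mathcomp Require Import finmap.
From mathcomp.multinomials Require Import monalg.
From mathcomp.real_closed Require Import mxtens.
Require Import Defs.
From Stdlib Require Import FunctionalExtensionality Classical ClassicalEpsilon.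

Set Implicit Arguments.
Unset Strict Implicit.
Unset Printing Implicit Defensive.

Import GRing.Theory.
Local Open Scope quotient_scope.

(** * Cycles created by a gluing *)

(** The twist [W] cannot be avoided: the trace of an identity is a value of the character, an
    arbitrary element of [K], whereas an idempotent matrix has a natural number as its trace. Finite
    families suffice because each clause of goodness concerns finitely many objects at a time. The
    formula for the sum comes from direct sums of structures: a tensor power of a direct sum of two
    spaces breaks up into summands, one for each way to distribute the tensor factors, so that a
    family for the sum leads to larger families for the two terms. This is why twistedness is asked
    of all families at once. Scalar multiplication is the obstacle, since it does not come from an
    operation on structures. It is reduced to products with constants; the constant [c] takes the
    value [c] to the number of components at a closed diagram, which for a natural number counts the
    maps from the components to a set with [c] elements. The exceptional constants of the polynomial
    argument depend on the family. Shifting by an integer avoids them because the larger family that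
    the sum requires is the same for all integers. *)

Section Cycles.
Variables (J X Y : finType) (s : J + X -> J + Y).
Hypothesis bij_s : bijective s.
Let inj_s := bij_inj bij_s.
Let nxt := next_or_stay s.

(** Followed backwards from [z], both trails are forced by injectivity, and the points between
    [inr x] and [z] lie in [J]; the trail from [j] therefore stops first, at a point on the trail
    from [x]. *)
Lemma trail_back k l x j z :
  trail s k (inr x) z -> trail s l (inl j) z -> exists m, trail s m (inr x) (inl j).
Proof.
elim: l k z => [|l IHl] [|k] z /=.
- by move=> <- /inj_s.
- by case=> j1 t1 <- /inj_s[->]; exists k.
- by move=> <- [j1 _ /inj_s].
- by move=> [j1 t1 <-] [j2 t2 /inj_s[e]]; subst j2; apply: IHl t1 t2.
Qed.

Lemma exit_trail x : exists k, trail s k (inr x) (inr (exit bij_s x)).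
Proof.
rewrite -(eqP (xchooseP (exit_proof bij_s x))).
exact: (@trail_follow _ _ _ _ _ 0).
Qed.

Lemma exit_unique k x y : trail s k (inr x) (inr y) -> y = exit bij_s x.
Proof.
have [g _ gK] := exit_bij bij_s; rewrite -{1 2}(gK y) => tk.
by have [l /(trail_inj bij_s tk)[_ ->]] := exit_trail (g y).
Qed.

(** If [j] leads to [y], then [y] is the exit of some [x], and [trail_back] applies. Conversely, a
    trapped point would prolong the trail from [x] by more distinct points than [J] has. *)
Lemma trappedPn j : reflect (exists x k, trail s k (inr x) (inl j)) (~~ trapped s j).
Proof.
apply: (iffP idP) => [|[x [k tk]]]; rewrite /trapped.
  case fz: (follow _ _ _) => [//|y] _.
  have [x ex] : exists x, exit bij_s x = y.
    by have [g _ gK] := exit_bij bij_s; exists (g y).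
  have [k] := exit_trail x; rewrite ex => tk; exists x.
  case cJ: #|J| => [|n]; first by have := fintype0 j cJ.
  have [l] : exists l, trail s l (inl j) (inr y).
    rewrite -fz cJ /=; exact: (@trail_follow _ _ _ s n 0).
  exact: trail_back tk.
case fz: (follow _ _ _) => [j'|//].
have /fin_all_exists [F FP] : forall i : 'I_#|J|.+1,
    exists j', trail s (k + i)%N (inr x) (inl j').
  by case=> i /= lti; apply: trail_long tk fz _ _.
have /leq_card : injective F.
  move=> i i' eF; apply: val_inj; have := FP i'; rewrite -eF.
  by move=> /(trail_inj bij_s) /(_ (FP i)) [] /addnI.
by rewrite card_ord ltnn.
Qed.

Lemma trapped_step j j' : s (inl j) = inl j' -> trapped s j = trapped s j'.
Proof.
move=> sj; apply: negb_inj; apply/trappedPn/trappedPn => [[x [k tk]]|[x [[|k] /=]]].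
- by exists x, k.+1; exists j.
- by rewrite -sj => /inj_s.
- by move=> [j1 t1]; rewrite -sj => /inj_s[<-]; exists x, k.
Qed.

Lemma trapped_next j : trapped s j -> s (inl j) = inl (nxt j).
Proof.
rewrite /trapped /nxt /next_or_stay.
by case: #|J| (fintype0 j) => [/(_ erefl)//|n _] /=; case: (s (inl j)) => //; case: n.
Qed.

Lemma nxt_trapped : {in trapped s, forall j, nxt j \in trapped s}.
Proof. by move=> j tj; rewrite -topredE /= -(trapped_step (trapped_next tj)). Qed.

Lemma nxt_inj : {in trapped s &, injective nxt}.
Proof.
move=> j j' tj tj' e; have := trapped_next tj; rewrite e -(trapped_next tj').
by move=> /inj_s[].
Qed.

Definition cycle_of j := [set j' in orbit nxt j].

Lemma cycle_of_next j : trapped s j -> cycle_of (nxt j) = cycle_of j.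
Proof.
move=> tj; apply/setP => k; rewrite !inE -!fconnect_orbit.
have tn := nxt_trapped tj.
apply/idP/idP => c; first exact: connect_trans (fconnect1 _ _) c.
apply: connect_trans c; rewrite (fconnect_sym_in nxt_trapped nxt_inj) //.
exact: fconnect1.
Qed.

(* [c] names, for each point of [J], either the cycle it lies on or the string
   it lies on, the latter by its starting point. *)
Lemma cycle_structure : exists c : J -> 'I_(num_cycles s) + X,
  (forall i, exists j, c j = inl i) /\
  forall (C : Type) (k : J -> C) (u : X -> C) (v : Y -> C),
    (forall z, match s z with inl j => k j | inr y => v y end =
               match z with inl j => k j | inr x => u x end) <->
    (forall x, v (exit bij_s x) = u x) /\
    exists l : 'I_(num_cycles s) -> C,
      forall j, k j = match c j with inl i => l i | inr x => u x end.
Proof.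
pose CY := [set cycle_of j | j in [set j | trapped s j]].
have cyCY j : trapped s j -> cycle_of j \in CY by move=> tj; apply: imset_f; rewrite inE.
have /fin_all_exists [c cP] : forall j, exists e : 'I_(num_cycles s) + X,
    match e with inl i => trapped s j /\ enum_val i = cycle_of j :> {set J}
    | inr x => exists k, trail s k (inr x) (inl j) end.
  move=> j; have [tj|/trappedPn[x [k tk]]] := boolP (trapped s j); last by exists (inr x), k.
  by exists (inl (enum_rank_in (cyCY j tj) (cycle_of j))); rewrite enum_rankK_in ?cyCY.
have cinr j x k : trail s k (inr x) (inl j) -> c j = inr x.
  move=> tk; case: (c j) (cP j) => [i [tj _]|x' [k' tk']].
    by have /negP[] : ~~ trapped s j by apply/trappedPn; exists x, k.
  by have [_ [->]] := trail_inj bij_s tk tk'.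
have cinl j i : trapped s j -> enum_val i = cycle_of j -> c j = inl i.
  move=> tj ei; case: (c j) (cP j) => [i' [_]|x' [k' tk']].
    by rewrite -ei => /enum_val_inj->.
  by have /negP[] : ~~ trapped s j by apply/trappedPn; exists x', k'.
exists c; split.
  move=> i; have /imsetP[j] := enum_valP i; rewrite inE => tj ei.
  by exists j; apply: cinl.
move=> C k u v; split=> [kP|[uv [l kP]] z].
  have kt n x z : trail s n (inr x) z ->
      match z with inl j => k j | inr y => v y end = u x.
    elim: n z => [|n IHn] z /=; first by move=> <-; rewrite kP.
    by case=> j tj <-; rewrite kP (IHn _ tj).
  split=> [x|]; first by have [n /kt] := exit_trail x.
  have ko j j' : trapped s j -> j' \in orbit nxt j -> k j' = k j.
    move=> tj; rewrite -fconnect_orbit => /iter_findex <-.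
    elim: (findex _ _ _) => //= n <-.
    have tj1 : trapped s (iter n nxt j) by elim: n => //= n; apply: nxt_trapped.
    by have := kP (inl (iter n nxt j)); rewrite (trapped_next tj1).
  (* All points of a cycle have the same colour, so any of them provides the colour [l i]. *)
  have /fin_all_exists [l lP] : forall i : 'I_(num_cycles s), exists a : C,
        forall j, c j = inl i -> k j = a.
    move=> i; have /imsetP[j] := enum_valP i; rewrite inE => tj ei.
      exists (k j) => j' cj'; have := cP j'; rewrite cj' => -[tj' ej'].
      apply: ko => //.
      have : j' \in cycle_of j' by rewrite inE -fconnect_orbit connect0.
      by rewrite -ej' ei inE.
    exists l => j; case cj: (c j) => [i|x]; first exact: lP.
    by have := cP j; rewrite cj => -[n /kt].
(* Conversely, colours read off from [c] agree across each step, since [s] leaves neither the cycle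
   nor the string. *)
case: z => [j|x].
  case sj: (s (inl j)) => [j'|y]; rewrite !kP.
    suff -> : c j' = c j by [].
    case cj: (c j) (cP j) => [i|x] => [[tj ei]|[n tn]].
      apply: cinl; first by rewrite -(trapped_step sj).
      rewrite ei -cycle_of_next //; congr cycle_of.
      by have := trapped_next tj; rewrite sj => -[].
    by apply: (cinr _ _ n.+1); exists j.
  case cj: (c j) (cP j) => [i|x] => [[tj ei]|[n tn]].
    by have := trapped_next tj; rewrite sj.
  by rewrite -uv; congr v; apply: (@exit_unique n.+1); exists j.
case sx: (s (inr x)) => [j|y]; first by rewrite kP (cinr j x 0%N).
by rewrite -uv; congr v; apply: (@exit_unique 0).
Qed.
End Cycles.

(** * Presentations of diagrams *)

Definition copair (A B C : Type) (x : A -> C) (s : B -> C) (z : A + B) : C :=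
  match z with inl a => x a | inr b => s b end.

(** [x] and [s] colour the starting points of the strings, [y] and [s'] their endpoints;
    compatibility makes this a colouring of the strings themselves. *)
Definition compat (A B A' B' C : Type) (t : A + B -> A' + B')
    (x : A -> C) (s : B -> C) (y : A' -> C) (s' : B' -> C) : Prop :=
  forall z, copair y s' (t z) = copair x s z.

Lemma sum_map_id (A B : Type) (z : A + B) : sum_map id id z = z.
Proof. by case: z. Qed.

Lemma copair_map (A B B' C : Type) (x : A -> C) (s : B' -> C) (g : B -> B') z :
  copair x (s \o g) z = copair x s (sum_map id g z).
Proof. by case: z. Qed.

Section Boxes.
Variables (r : nat) (ty : 'I_r -> nat * nat).
Local Notation oslot := (slot (fun i => (ty i).1)).
Local Notation islot := (slot (fun i => (ty i).2)).

(** Slots become pairs of a box and a number, without the dependent ordinals of [slot], so that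
    comparing slots of different boxes needs no transport. *)
Definition numbering (N S : finType) (w : N -> nat) (f : S -> N * nat) : Prop :=
  injective f /\ forall b k, (k < w b)%N <-> exists x, f x = (b, k).

(* Boxes and slots range over arbitrary finite types, so that gluings need no renumbering. *)
Record boxes := Boxes {
  bnode : finType; bout : finType; bin : finType;
  blab : bnode -> 'I_r;
  boutp : bout -> bnode * nat;
  binp : bin -> bnode * nat;
  boutP : numbering (fun b => (ty (blab b)).1) boutp;
  binP : numbering (fun b => (ty (blab b)).2) binp }.

Lemma slot_numbering w n (lab : {ffun 'I_n -> 'I_r}) :
  numbering (fun b => w (lab b)) (fun x : slot w lab => (tag x, tagged x : nat)).
Proof.
split=> [x x' [e1 e2]|b k]; first exact: slot_eq.
split=> [lt|[[b' j] /= [<- <-]]]; last exact: ltn_ord.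
by exists (existT _ b (Ordinal lt)).
Qed.

Definition dboxes p q (D : diagram ty p q) : boxes :=
  Boxes (slot_numbering (fun i => (ty i).1) (dglab D))
        (slot_numbering (fun i => (ty i).2) (dglab D)).

Record box_iso (b b' : boxes) := BoxIso {
  ison :> bnode b -> bnode b'; isoo : bout b -> bout b'; isoi : bin b -> bin b';
  isonP : bijective ison; isooP : bijective isoo; isoiP : bijective isoi;
  isol : forall x, blab (ison x) = blab x;
  isoop : forall x, boutp (isoo x) = (ison (boutp x).1, (boutp x).2);
  isoip : forall x, binp (isoi x) = (ison (binp x).1, (binp x).2) }.

Definition box_id (b : boxes) : box_iso b b.
Proof.
exists id id id; try exact: (Bijective (g := id)) => //.
- by [].
- by move=> x; case: (boutp x).
- by move=> x; case: (binp x).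
Defined.

Definition box_comp (b1 b2 b3 : boxes) (f : box_iso b1 b2) (g : box_iso b2 b3) :
  box_iso b1 b3.
Proof.
exists (g \o f) (isoo g \o isoo f) (isoi g \o isoi f).
- exact: bij_comp (isonP g) (isonP f).
- exact: bij_comp (isooP g) (isooP f).
- exact: bij_comp (isoiP g) (isoiP f).
- by move=> x; rewrite /= !isol.
- by move=> x; rewrite /= !isoop.
- by move=> x; rewrite /= !isoip.
Defined.

Definition str b p q := 'I_q + bout b -> 'I_p + bin b.

Definition pres p q (d : dclass ty p q) (b : boxes) (t : str b p q) (l : nat) :=
  exists (D : diagram ty p q) (f : box_iso (dboxes D) b),
  [/\ d = \pi_(dclass ty p q) D, dgloops D = l &
      forall z, t (sum_map id (isoo f) z) = sum_map id (isoi f) (dgstr D z)].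

Lemma pres_self p q (D : diagram ty p q) :
  pres (\pi_(dclass ty p q) D) (dgstr D : str (dboxes D) p q) (dgloops D).
Proof. by exists D, (box_id _); split=> // z; rewrite !sum_map_id. Qed.

Lemma pres_iso p q (d : dclass ty p q) b b' (t : str b p q) (t' : str b' p q) l
    (f : box_iso b b') :
  (forall z, t' (sum_map id (isoo f) z) = sum_map id (isoi f) (t z)) ->
  pres d t l -> pres d t' l.
Proof.
move=> tt' [D [g [-> el gt]]]; exists D, (box_comp g f); split=> // z.
have -> : sum_map id (isoo (box_comp g f)) z = sum_map id (isoo f) (sum_map id (isoo g) z).
  by case: z.
by rewrite tt' gt; case: (dgstr D z).
Qed.

Lemma pres_bij p q (d : dclass ty p q) b (t : str b p q) l :
  pres d t l -> bijective t.
Proof.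
case=> D [f [_ _ ft]]; have /bijectivebP bD := dgbij D.
have idb (A : Type) : bijective (@id A) by exists id.
have [g fK gK] := sum_map_bij (idb 'I_q) (isooP f).
have H : bijective (sum_map id (isoi f) \o dgstr D \o g).
  apply: bij_comp; last by exists (sum_map id (isoo f)).
  by apply: bij_comp => //; apply: sum_map_bij (isoiP f).
by apply: (eq_bij H) => z /=; rewrite -ft gK.
Qed.

Lemma pres_inj p q (d d' : dclass ty p q) b (t : str b p q) l :
  pres d t l -> pres d' t l -> d = d'.
Proof.
move=> [D [f [-> eD ft]]] [D' [f' [-> eD' ft']]].
apply/eqP; rewrite eqmodE; apply/diagram_isoP; split; first by rewrite eD eD'.
have [g fK gK] := isonP f'; exists (g \o f); split.
- by apply: bij_comp (isonP f); exists f'.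
- by move=> x; have /= <- := isol f' (g (f x)); have /= <- := isol f x; rewrite gK.
move=> z z' zz'.
have zt : sum_map id (isoo f) z = sum_map id (isoo f') z'.
  case: z z' zz' => [i|x] [i'|x'] //=; first by move=> /eqP->.
  move=> /andP[/eqP ex /eqP ej]; congr inr; apply: (boutP b).1.
  by rewrite !isoop /=; congr (_, _) => //; rewrite -ex /= gK.
have := ft z; rewrite zt ft'.
case: (dgstr D z) (dgstr D' z') => [o|x] [o'|x'] //=; first by case=> ->.
case=> e; have := isoip f x; rewrite -e (isoip f') /= => -[<- ->].
by rewrite fK !eqxx.
Qed.

Lemma pres_eq p q (d d' : dclass ty p q) b b' (t : str b p q) (t' : str b' p q) l
    (f : box_iso b b') :
  (forall z, t' (sum_map id (isoo f) z) = sum_map id (isoi f) (t z)) ->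
  pres d t l -> pres d' t' l -> d = d'.
Proof. by move=> tt' /(pres_iso tt'); apply: pres_inj. Qed.

(** Renumbers boxes by ordinals, as [diagram] requires; this is the way back from presentations on
    arbitrary finite types. *)
Lemma slots_bij (N S : finType) (w : 'I_r -> nat) (lab : N -> 'I_r)
    (f : S -> N * nat) : numbering (fun b => w (lab b)) f ->
  let lab' := [ffun i : 'I_#|N| => lab (enum_val i)] in
  exists2 g : slot w lab' -> S, bijective g &
    forall x, f (g x) = (enum_val (tag x), tagged x : nat).
Proof.
move=> [injf fP] lab'.
have /fin_all_exists [g gP] : forall x : slot w lab', exists y,
    f y = (enum_val (tag x), tagged x : nat).
  by move=> [i j]; apply/fP; rewrite /= -[lab _](ffunE (fun i => lab (enum_val i))).
exists g => //.
have /fin_all_exists [h hP] : forall y, exists x : slot w lab', g x = y.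
  move=> y; case fy: (f y) => [b k].
  have lt : (k < w (lab b))%N by apply/fP; exists y.
  have e : b = enum_val (enum_rank b) by rewrite enum_rankK.
  have lt' : (k < w (lab' (enum_rank b)))%N by rewrite ffunE -e.
  exists (existT (fun i => 'I_(w (lab' i))) (enum_rank b) (Ordinal lt')).
  by apply: injf; rewrite gP fy /= -e.
have injg : injective g.
  move=> x x' e; have := gP x; rewrite e gP => -[/enum_val_inj e1 e2].
  by apply: slot_eq.
by exists h => // x; apply: injg; rewrite hP.
Qed.

Lemma pres_ex p q b (t : str b p q) l : bijective t ->
  exists d : dclass ty p q, pres d t l.
Proof.
move=> bt; set lab' := [ffun i : 'I_#|bnode b| => blab (enum_val i)].
have [g gbij gP] := slots_bij (w := fun i => (ty i).1) (boutP b).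
have [h hbij hP] := slots_bij (w := fun i => (ty i).2) (binP b).
have idb (A : Type) : bijective (@id A) by exists id.
have [hi hK hiK] := sum_map_bij (idb 'I_p) hbij.
pose s : strings ty p q lab' := [ffun z => hi (t (sum_map id g z))].
have bs : bijectiveb s.
  apply/bijectivebP; apply: (@eq_bij _ _ (hi \o (t \o sum_map id g))) => [|z].
    apply: bij_comp; first by exists (sum_map id h).
    by apply: bij_comp => //; apply: sum_map_bij gbij.
  by rewrite ffunE.
pose D := Diagram bs l; exists (\pi_(dclass ty p q) D).
have en : bijective (fun i : 'I_#|bnode b| => enum_val i).
  by exists enum_rank => x; rewrite ?enum_valK ?enum_rankK.
have fl (x : 'I_#|bnode b|) : blab (enum_val x) = lab' x by rewrite ffunE.
exists D, (@BoxIso (dboxes D) b _ g h en gbij hbij fl gP hP).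
by split=> // z; rewrite /= ffunE hiK.
Qed.

End Boxes.

Section Ops.
Variables (r : nat) (ty : 'I_r -> nat * nat).
Local Notation boxes := (boxes ty).
Local Notation oslot := (slot (fun i => (ty i).1)).
Local Notation islot := (slot (fun i => (ty i).2)).

Lemma sum_numbering (N N' S S' : finType) (w : N -> nat) (w' : N' -> nat)
    (f : S -> N * nat) (f' : S' -> N' * nat) :
  numbering w f -> numbering w' f' ->
  numbering (fun z : N + N' => match z with inl b => w b | inr b => w' b end)
    (fun z : S + S' => match z with inl x => (inl (f x).1, (f x).2)
                       | inr x => (inr (f' x).1, (f' x).2) end).
Proof.
move=> [injf fP] [injf' fP']; split.
  move=> [x|x] [x'|x'] //= [e1 e2]; [congr inl; apply: injf|congr inr; apply: injf'];
  by rewrite [LHS]surjective_pairing e1 e2 -surjective_pairing.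
move=> [b|b] k; split.
- by move/fP=> [x e]; exists (inl x); rewrite e.
- case=> -[x|x] // [<- <-]; apply/fP; exists x; exact: surjective_pairing.
- by move/fP'=> [x e]; exists (inr x); rewrite e.
- case=> -[x|x] // [<- <-]; apply/fP'; exists x; exact: surjective_pairing.
Qed.

Lemma numbering_ext (N S : finType) (w w' : N -> nat) (f : S -> N * nat) :
  w =1 w' -> numbering w f -> numbering w' f.
Proof. by move=> e [injf fP]; split=> // b k; rewrite -e. Qed.

Definition lab_add (b b' : boxes) (z : bnode b + bnode b') :=
  match z with inl x => blab x | inr x => blab x end.

Lemma lab_addE (w : 'I_r -> nat) (b b' : boxes) :
  (fun z : bnode b + bnode b' => match z with inl x => w (blab x)
   | inr x => w (blab x) end) =1 (fun z => w (lab_add z)).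
Proof. by case. Qed.

Definition badd (b b' : boxes) : boxes :=
  Boxes (numbering_ext (@lab_addE (fun i => (ty i).1) b b')
           (sum_numbering (boutP b) (boutP b')))
        (numbering_ext (@lab_addE (fun i => (ty i).2) b b')
           (sum_numbering (binP b) (binP b'))).

Definition tjuxt (b b' : boxes) p q p' q' (t : str b p q) (t' : str b' p' q') :
  str (badd b b') (p + p') (q + q') := fun z =>
  let w : ('I_q + bout b) + ('I_q' + bout b') :=
    match z with
    | inl i => sum_map inl inl (split i)
    | inr x => sum_map inr inr x
    end in
  match w with
  | inl w1 => match t w1 with inl o => inl (lshift p' o) | inr x => inr (inl x) end
  | inr w2 => match t' w2 with inl o => inl (rshift p o) | inr x => inr (inr x) end
  end.

Lemma pres_juxt p q p' q' (d : dclass ty p q) (d' : dclass ty p' q') b b'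
    (t : str b p q) (t' : str b' p' q') l l' :
  pres d t l -> pres d' t' l' ->
  pres (juxt_class d d') (tjuxt t t') (l + l').
Proof.
move=> [D [f [-> <- ft]]] [D' [f' [-> <- ft']]]; rewrite pi_juxt.
have idb (A : Type) : bijective (@id A) by exists id.
pose fn := sum_map f f' \o @split (dgsize D) (dgsize D').
pose fo (x : oslot (dglab (juxt D D'))) : bout (badd b b') := sum_map (isoo f) (isoo f')
  (split_slot x).
pose fi (x : islot (dglab (juxt D D'))) : bin (badd b b') := sum_map (isoi f) (isoi f')
  (split_slot x).
have fnP : bijective fn.
  apply: bij_comp; first exact: sum_map_bij (isonP f) (isonP f').
  exact: Bijective (@splitK _ _) (@unsplitK _ _).
have foP : bijective fo.
  apply: (@bij_comp _ _ _ (sum_map (isoo f) (isoo f')));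
    first exact: sum_map_bij (isooP f) (isooP f').
  exact: Bijective (@split_slotK _ _ _ _ _ _) (@unsplit_slotK _ _ _ _ _ _).
have fiP : bijective fi.
  apply: (@bij_comp _ _ _ (sum_map (isoi f) (isoi f')));
    first exact: sum_map_bij (isoiP f) (isoiP f').
  exact: Bijective (@split_slotK _ _ _ _ _ _) (@unsplit_slotK _ _ _ _ _ _).
have fl : forall x, blab (fn x : bnode (badd b b')) = blab (x : bnode (dboxes (juxt D D'))).
  move=> x; rewrite /= /fn /= ffunE.
  by case: (split x) => y /=; [exact: (isol f)|exact: (isol f')].
have slotE w n (lab : {ffun 'I_n -> 'I_r}) n' (lab' : {ffun 'I_n' -> 'I_r})
    (x : slot w (cat_lab lab lab')) :
   exists u, [/\ x = unsplit_slot u, split_slot x = u,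
     split (tag x) = sum_map (@tag _ _) (@tag _ _) u &
     tagged x = match u with inl y => tagged y : nat | inr y => tagged y : nat end :> nat].
  exists (split_slot x); split=> //; first by rewrite split_slotK.
  - by rewrite -{1}(split_slotK x); case: (split_slot x) => y /=;
    rewrite (unsplitK (inl _), unsplitK (inr _)).
  - by case: (split_slot x) (split_slotK x) => y <-.
have fop : forall x, boutp (fo x) = (fn (boutp (x : bout (dboxes (juxt D D')))).1,
       (boutp (x : bout (dboxes (juxt D D')))).2).
  move=> x; rewrite /fo /fn /=; have [u [_ -> -> ->]] := slotE _ _ _ _ _ x.
  by case: u => y /=; rewrite isoop.
have fip : forall x, binp (fi x) = (fn (binp (x : bin (dboxes (juxt D D')))).1,
       (binp (x : bin (dboxes (juxt D D')))).2).
  move=> x; rewrite /fi /fn /=; have [u [_ -> -> ->]] := slotE _ _ _ _ _ x.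
  by case: u => y /=; rewrite isoip.
exists (juxt D D'), (@BoxIso _ _ (dboxes (juxt D D')) (badd b b') fn fo fi fnP foP fiP fl fop fip).
split=> // z; rewrite /= ffunE /tjuxt.
have -> : (match sum_map id fo z with
    | inl i => sum_map inl inl (split i)
    | inr x => sum_map inr inr x
    end) = sum_map (sum_map id (isoo f)) (sum_map id (isoo f')) (split_point z).
  by case: z => [i|x] /=; [case: (split i)|rewrite /fo; case: (split_slot x)].
case: (split_point z) => w /=.
  by rewrite ft; case: (dgstr D w) => [o|x] //=; rewrite /fi (unsplit_slotK (inl x)).
by rewrite ft'; case: (dgstr D' w) => [o|x] //=; rewrite /fi (unsplit_slotK (inr x)).
Qed.

Lemma tjuxt_compat (b b' : boxes) p q p' q' (t : str b p q) (t' : str b' p' q')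
    (C : Type) x s s' y u u' :
  compat (tjuxt t t') x (copair s s' : _ -> C) y (copair u u') <->
  compat t (x \o @lshift q q') s (y \o @lshift p p') u /\
  compat t' (x \o @rshift q q') s' (y \o @rshift p p') u'.
Proof.
split=> [H|[H H'] [i|[z|z]]].
- split=> [] [i|z].
  + have := H (inl (lshift q' i)); rewrite /tjuxt /= (unsplitK (inl i)) /=.
    by case: (t _).
  + have := H (inr (inl z)); rewrite /tjuxt /=; by case: (t _).
  + have := H (inl (rshift q i)); rewrite /tjuxt /= (unsplitK (inr i)) /=.
    by case: (t' _).
  + have := H (inr (inr z)); rewrite /tjuxt /=; by case: (t' _).
- rewrite /tjuxt /=; case: (split i) (splitK i) => j /= <-.
    by have := H (inl j); case: (t _).
  by have := H' (inl j); case: (t' _).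
- by have := H (inr z); rewrite /tjuxt /=; case: (t _).
- by have := H' (inr z); rewrite /tjuxt /=; case: (t' _).
Qed.

(** Gluing keeps the boxes, so the new strings live on the same [b]. By [cycle_structure], the
    colourings of [D] that agree along [J] are the colourings of the result together with a free
    colour [h] for each of the [k] new loops. *)
Lemma pres_glue (J : finType) p q p' q' (eo : 'I_p -> J + 'I_p')
    (ei : J + 'I_q' -> 'I_q) (bo : bijective eo) (bi : bijective ei)
    (D : diagram ty p q) b (t : str b p q) l :
  pres (\pi_(dclass ty p q) D) t l ->
  exists (t' : str b p' q') (k : nat) (c : J -> 'I_k + ('I_q' + bout b)),
  [/\ pres (\pi_(dclass ty p' q') (glue bo bi D)) t' (l + k),
      forall i, exists j, c j = inl i &
      forall (C : Type) (w : J -> C) x' y' s u x y,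
        (forall z, x (ei z) = copair w x' z) -> (forall o, y o = copair w y' (eo o)) ->
        (compat t x s y u <-> compat t' x' s y' u /\
          exists h, forall j, w j = copair h (copair x' s) (c j))].
Proof.
move=> [D1 [f [eD <- ft]]].
have -> : \pi_(dclass ty p' q') (glue bo bi D) = \pi_(dclass ty p' q') (glue bo bi D1).
  by apply/eqP; rewrite eqmodE; apply: glue_iso; rewrite -[diagram_iso _ _]eqmodE eD.
have idb (A : Type) : bijective (@id A) by exists id.
have [c [c_onto cP]] := cycle_structure (glue_step_bij bo bi D1).
have [g gK Kg] := sum_map_bij (idb 'I_q') (isooP f).
pose t' : str b p' q' := fun z => sum_map id (isoi f) (glue_str bo bi D1 (g z)).
exists t', (num_cycles (glue_step eo ei (D:=D1))),
  (fun j => sum_map id (sum_map id (isoo f)) (c j)).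
split.
- have fn : forall x, blab (f x) = blab (x : bnode (dboxes (glue bo bi D1))) := isol f.
  exists (glue bo bi D1), (@BoxIso _ _ (dboxes (glue bo bi D1)) b f (isoo f) (isoi f) (isonP f)
    (isooP f) (isoiP f) fn (isoop f) (isoip f)).
  by split=> // z; rewrite /t' /= gK.
- by move=> i; have [j cj] := c_onto i; exists j; rewrite cj.
move=> C w x' y' s u x y xE yE.
have [gi giK Kgi] := bi.
(* A colouring of the strings of [D] is the same as colours preserved by each step of the gluing,
   with [w] on [J]. *)
have key : compat t x s y u <->
   (forall z, match glue_step eo ei (D:=D1) z with inl j => w j | inr v => copair y' (u \o isoi f) v
     end =
      match z with inl j => w j | inr v => copair x' (s \o isoo f) v end).
  have [h hK Kh] := isooP f.
  split=> [H z|H z].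
    rewrite /glue_step.
    set z1 := (X in dgstr D1 X).
    have := H (sum_map id (isoo f) z1); rewrite ft.
    have -> : copair x s (sum_map id (isoo f) z1) = match z with inl j => w j | inr v =>
      copair x' (s \o
      isoo f) v end.
      by rewrite /z1; case: z {z1} => [j|[i|v]] //=; rewrite xE.
    move=> <-; case: (dgstr D1 z1) => [o|v] //=.
    by rewrite yE; case: (eo o).
  (* The starting point [z] of a string, turned into an argument of [glue_step]. *)
  pose z1 : J + ('I_q' + oslot (dglab D1)) := match z with
     | inl i => match gi i with inl j => inl j | inr i' => inr (inl i') end
     | inr v => inr (inr (h v)) end.
  have := H z1; rewrite /glue_step.
  have -> : match z1 with inl j => inl (ei (inl j)) | inr (inl i) => inl (ei (inr i)) | inr (inr
    v) => inr v end
     = sum_map id h z.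
    rewrite /z1; case: z {z1} => [i|v] //=.
    by case gii: (gi i) => [j|j]; rewrite -gii Kgi.
  have -> : match z1 with inl j => w j | inr v => copair x' (s \o isoo f) v end = copair x s z.
    rewrite /z1; case: z {z1} => [i|v] //=; last by rewrite Kh.
    by rewrite -{2}(Kgi i) xE; case: (gi i).
  have -> : t z = sum_map id (isoi f) (dgstr D1 (sum_map id h z)).
    by rewrite -ft; case: z {z1} => [i|v] //=; rewrite Kh.
  move=> <-; case: (dgstr D1 _) => [o|v] //=.
  by rewrite yE; case: (eo o).
rewrite key cP; split=> -[H1 [h hP]]; (split; last by exists h => j; rewrite hP;
  case: (c j) => [|[]]).
- move=> z; rewrite -(Kg z) /t' gK /glue_str ffunE -!copair_map.
  exact: H1.
- move=> z; have := H1 (sum_map id (isoo f) z).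
  by rewrite /t' gK /glue_str ffunE -!copair_map.
Qed.

End Ops.

Definition ord_copair (m n : nat) (C : Type) (a : 'I_m -> C) (b : 'I_n -> C)
  (i : 'I_(m + n)) : C := copair a b (split i).

Lemma ord_copair_lshift m n C (a : 'I_m -> C) (b : 'I_n -> C) i :
  ord_copair a b (lshift n i) = a i.
Proof. by rewrite /ord_copair (unsplitK (inl i)). Qed.

Lemma ord_copair_rshift m n C (a : 'I_m -> C) (b : 'I_n -> C) i :
  ord_copair a b (rshift m i) = b i.
Proof. by rewrite /ord_copair (unsplitK (inr i)). Qed.

Lemma ord_copair_l m n C (a : 'I_m -> C) (b : 'I_n -> C) : ord_copair a b \o @lshift m n = a.
Proof. by apply: functional_extensionality => i /=; rewrite ord_copair_lshift. Qed.

Lemma ord_copair_r m n C (a : 'I_m -> C) (b : 'I_n -> C) : ord_copair a b \o @rshift m n = b.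
Proof. by apply: functional_extensionality => i /=; rewrite ord_copair_rshift. Qed.

Lemma ord_copair_eta m n C (a : 'I_(m + n) -> C) : ord_copair (a \o @lshift m n)
    (a \o @rshift m n) = a.
Proof.
apply: functional_extensionality => i; rewrite /ord_copair.
by case: (split i) (splitK i) => j /= ->.
Qed.

Lemma copair_eta (A B C : Type) (a : A + B -> C) : copair (a \o inl) (a \o inr) = a.
Proof. by apply: functional_extensionality => -[]. Qed.

Definition compatb (A B A' B' : finType) (C : eqType) (t : A + B -> A' + B')
    (x : A -> C) (s : B -> C) (y : A' -> C) (s' : B' -> C) : bool :=
  [forall z, copair y s' (t z) == copair x s z].

Lemma compatP (A B A' B' : finType) (C : eqType) (t : A + B -> A' + B')
    (x : A -> C) (s : B -> C) (y : A' -> C) (s' : B' -> C) :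
  reflect (compat t x s y s') (compatb t x s y s').
Proof.
by apply: (iffP forallP) => H z; [apply/eqP/H|apply/eqP/H].
Qed.

(** Since [c] reaches every cycle, [h] can be recovered from the colouring of [J] that it induces,
    and the sum can be reindexed by [h]. *)
Lemma big_cycle_colours (R : Type) (idx : R) (op : Monoid.com_law idx) (J C : finType)
    (B : Type) k (c : J -> 'I_k + B) (be : B -> C) (P : pred {ffun J -> C})
    (G : {ffun J -> C} -> R) :
  (forall i, exists j, c j = inl i) ->
  (forall w : {ffun J -> C}, P w <-> exists h, forall j, w j = copair h be (c j)) ->
  \big[op/idx]_(w | P w) G w =
  \big[op/idx]_(h : {ffun 'I_k -> C}) G [ffun j => copair h be (c j)].
Proof.
move=> c_onto PE; pose F (h : {ffun 'I_k -> C}) : {ffun J -> C} := [ffun j => copair h be (c j)].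
have injF : injective F.
  move=> h h' /ffunP e; apply/ffunP => i; have [j cj] := c_onto i.
  by have := e j; rewrite !ffunE cj.
rewrite -(big_imset (h := F) (A := predT) G) /=; last by move=> h h' _ _ /injF.
apply: eq_bigl => w; apply/idP/imsetP => [/PE[h hP]|[h _ ->]].
  exists [ffun i => h i] => //; apply/ffunP => j; rewrite ffunE hP.
  by case: (c j) => //= i; rewrite ffunE.
by apply/PE; exists h => j; rewrite ffunE.
Qed.

(** Every loop created by a gluing carries a free colour. This is the origin of the factor
    [#|C| ^ l] in [weight]. *)
Lemma card_cycle_colours (J : finType) (C : finType) (B : Type) k
    (c : J -> 'I_k + B) (be : B -> C) (P : pred {ffun J -> C}) (Q : bool) :
  (forall i, exists j, c j = inl i) ->
  (forall w : {ffun J -> C}, P w <-> Q /\ exists h, forall j, w j = copair h be (c j)) ->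
  #|P| = (Q * #|C| ^ k)%N.
Proof.
move=> c_onto; case: Q => PQ; last first.
  by rewrite mul0n; apply: eq_card0 => w; apply/negP => /PQ[].
rewrite mul1n -sum1_card (@big_cycle_colours _ _ addn _ _ _ _ c be P _ c_onto) => [|w].
  by rewrite sum_nat_const muln1 card_ffun card_ord.
by rewrite PQ; split=> [[]|].
Qed.

Lemma big_mkcond_nat (T : finType) (P : pred T) :
  (\sum_(w | P w) 1 = \sum_w P w)%N.
Proof. by rewrite big_mkcond; apply: eq_bigr => w _; case: (P w). Qed.

Lemma sum_ffun_sum (R : Type) (idx : R) (op : Monoid.com_law idx) (A B C : finType)
    (F : (A -> C) -> (B -> C) -> R) :
  \big[op/idx]_(w : {ffun A + B -> C}) F (w \o inl) (w \o inr) =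
  \big[op/idx]_(w : {ffun A -> C}) \big[op/idx]_(w' : {ffun B -> C}) F w w'.
Proof.
rewrite pair_big /=.
pose f (w : {ffun A -> C} * {ffun B -> C}) : {ffun A + B -> C} := [ffun z => copair w.1 w.2 z].
pose g (w : {ffun A + B -> C}) := ([ffun a => w (inl a)], [ffun b => w (inr b)]).
have fK : cancel f g.
  by move=> [w w']; congr pair; apply/ffunP => a; rewrite !ffunE.
have gK : cancel g f.
  by move=> w; apply/ffunP => -[a|b]; rewrite !ffunE /= ffunE.
rewrite (reindex f); last by exists g => w _; [apply: fK|apply: gK].
by apply: eq_bigr => -[w w'] _; congr F; apply: functional_extensionality => a;
  rewrite /f /= ffunE.
Qed.

(** * State sums and gluing *)

Section Ops.
Variables (r : nat) (ty : 'I_r -> nat * nat).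
Local Notation boxes := (boxes ty).

(* By val_eq the weights for two colours determine a diagram, which reduces identities between
   gluings to identities between sums of products of weights. *)
Definition weight (C : finType) p q (b : boxes) (t : str b p q) (l : nat)
    (x : 'I_q -> C) (s : bout b -> C) (y : 'I_p -> C) (u : bin b -> C) : nat :=
  (compatb t x s y u * #|C| ^ l)%N.

Lemma val_eq p q (d d' : dclass ty p q) b b' (t : str b p q) (t' : str b' p q) l l'
    (f : box_iso b b') : pres d t l -> pres d' t' l' ->
  (forall (x : 'I_q -> bool) s y u,
     weight t l x (s \o isoo f) y (u \o isoi f) = weight t' l' x s y u) ->
  d = d'.
Proof.
move=> pd pd' tt'.
have ell : l = l'.
  (* A colouring with one colour is always compatible; its weight [2 ^ l] reveals the number of
     loops. *)
  have := tt' (fun=> false) (fun=> false) (fun=> false) (fun=> false).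
  have F (A B A' B' : finType) (t0 : A + B -> A' + B') : compatb t0 (fun=> false) (fun=> false)
    (fun=> false) (fun=> false).
    by apply/compatP => z; case: (t0 z); case: z.
  rewrite /weight !F !mul1n card_bool => /eqP.
  by rewrite eqn_exp2l // => /eqP.
subst l'; have [ti tK Kt] := pres_bij pd; apply: pres_eq (f) _ pd pd' => z.
have [g gK Kg] := isooP f; have [h hK Kh] := isoiP f.
(* Colour [true] only the string of [t] that starts at [z]; compatibility with [t'] forces [t'] to
   contain this string too. *)
pose z0 := z.
pose X i := (inl i : _ + bout b) == z0; pose S x := (inr (g x) : 'I_q + _) == z0.
pose Y i := (inl i : _ + bin b) == t z0; pose U x := (inr (h x) : 'I_p + _) == t z0.
have XE z1 : copair X (S \o isoo f) z1 = (z1 == z0).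
  by case: z1 => [i|x] //=; rewrite /S gK.
have YE z1 : copair Y (U \o isoi f) z1 = (z1 == t z0).
  by case: z1 => [i|x] //=; rewrite /U hK.
have : compatb t X (S \o isoo f) Y (U \o isoi f).
  by apply/compatP => z1; rewrite XE YE; apply: (can_eq tK).
have := tt' X S Y U; rewrite /weight => e ct; move: e; rewrite ct.
case: (compatP t' X S Y U) => [c' _|_ /eqP]; last first.
  by rewrite mul1n mul0n card_bool expn_eq0.
have := c' (sum_map id (isoo f) z); rewrite -[in RHS]copair_map XE eqxx.
case: (t' _) => [o|x] /=; rewrite /Y /U => /eqP <- //=.
by rewrite Kh.
Qed.

(* The colourings of the strings of a composite, or of a closure, are the colourings of its parts
   that agree along the glued points j; here c j is a cycle created by the gluing, coloured by h,
   or the starting point of the string through j. *)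
Definition comp_glued X Y Z (bE bD : boxes) (tE : str bE (Z.1 + Y.2) (Z.2 + Y.1))
    (tD : str bD (Y.1 + X.2) (Y.2 + X.1)) (t : str (badd bE bD) (Z.1 + X.2) (Z.2 + X.1)) k
    (c : 'I_Y.1 + 'I_Y.2 -> 'I_k + ('I_(Z.2 + X.1) + bout (badd bE bD))) : Prop :=
  forall (C : Type) (w : 'I_Y.1 -> C) (w' : 'I_Y.2 -> C) x s s' y u u',
    ((compat tE (ord_copair (x \o @lshift _ _) w) s (ord_copair (y \o @lshift _ _) w') u /\
      compat tD (ord_copair w' (x \o @rshift _ _)) s' (ord_copair w (y \o @rshift _ _)) u') <->
     compat t x (copair s s') y (copair u u') /\
       exists h, forall j, copair w w' j = copair h (copair x (copair s s')) (c j)).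

Definition trace_glued X (b : boxes) (t : str b (X.1 + X.2) (X.2 + X.1)) (t' : str b 0 0) k
    (c : 'I_X.1 + 'I_X.2 -> 'I_k + ('I_0 + bout b)) : Prop :=
  forall (C : Type) (w : 'I_X.1 -> C) (w' : 'I_X.2 -> C) x s y u,
    (compat t (ord_copair w' w) s (ord_copair w w') u <-> compat t' x s y u /\ exists h, forall j,
      copair w w' j = copair h (copair x s) (c j)).

Lemma comp0_pres X Y Z (dE : hom0 (dclass ty) Y Z) (dD : hom0 (dclass ty) X Y)
    bE bD (tE : str bE _ _) (tD : str bD _ _) lE lD :
  pres dE tE lE -> pres dD tD lD ->
  exists (t : str (badd bE bD) (Z.1 + X.2) (Z.2 + X.1)) k
    (c : 'I_Y.1 + 'I_Y.2 -> 'I_k + ('I_(Z.2 + X.1) + bout (badd bE bD))),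
  [/\ pres (comp0_class dE dD) t (lE + lD + k),
      forall i, exists j, c j = inl i & comp_glued tE tD t c].
Proof.
move=> pE pD; have := pres_juxt pE pD; rewrite /comp0_class.
rewrite -[dE in juxt_class dE]reprK -[dD in juxt_class _ dD]reprK pi_juxt => pj.
have [t [k [c [pt c_onto cP]]]] := pres_glue (@comp0_out_bij X.2 Y.1 Y.2 Z.1)
  (@comp0_in_bij X.1 Y.1 Y.2 Z.2) pj.
exists t, k, c; split=> // C w w' x s s' y u u'.
rewrite -(cP C (copair w w') x y (copair s s') (copair u u')
  (ord_copair (ord_copair (x \o @lshift _ _) w) (ord_copair w' (x \o @rshift _ _)))
  (ord_copair (ord_copair (y \o @lshift _ _) w') (ord_copair w (y \o @rshift _ _)))).
- by rewrite tjuxt_compat !ord_copair_l !ord_copair_r.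
- case=> [[j|j]|i] /=; rewrite ?ord_copair_lshift ?ord_copair_rshift //.
    by rewrite ?ord_copair_lshift ?ord_copair_rshift.
  by case: (split i) (splitK i) => i' /= <-; rewrite ?ord_copair_lshift ?ord_copair_rshift.
move=> o; rewrite /comp0_out {1}/ord_copair; case: (split o) => i /=;
  by rewrite /ord_copair; case: (split i).
Qed.

Lemma trace0_pres X (d : hom0 (dclass ty) X X) b (t : str b _ _) l :
  pres d t l ->
  exists (t' : str b 0 0) k (c : 'I_X.1 + 'I_X.2 -> 'I_k + ('I_0 + bout b)),
  [/\ pres (trace0_class d) t' (l + k),
      forall i, exists j, c j = inl i & trace_glued t t' c].
Proof.
rewrite -{1}[d]reprK /trace0_class => pd.
have [t' [k [c [pt c_onto cP]]]] := pres_glue (@trace0_out_bij X.1 X.2)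
  (@trace0_in_bij X.1 X.2) pd.
exists t', k, c; split=> // C w w' x s y u; apply: cP => [|o].
  by case=> [[i|i]|[]] //=; rewrite ?ord_copair_lshift ?ord_copair_rshift.
by rewrite /ord_copair /=.
Qed.

Lemma comp_pres p q q' (d : dclass ty p q) (d' : dclass ty q q')
    b b' (t : str b _ _) (t' : str b' _ _) l l' :
  pres d t l -> pres d' t' l' ->
  exists (t2 : str (badd b b') p q') k
    (c : 'I_q -> 'I_k + ('I_q' + bout (badd b b'))),
  [/\ pres (comp_class d d') t2 (l + l' + k),
      forall i, exists j, c j = inl i &
      forall (C : Type) (w : 'I_q -> C) x s s' y u u',
       (compat t w s y u /\ compat t' x s' w u' <-> compat t2 x (copair s s') y (copair u u') /\
          exists h, forall j, w j = copair h (copair x (copair s s')) (c j))].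
Proof.
move=> pd pd'; have := pres_juxt pd pd'; rewrite /comp_class.
rewrite -[d in juxt_class d]reprK -[d' in juxt_class _ d']reprK pi_juxt => pj.
have [t2 [k [c [pt c_onto cP]]]] := pres_glue (@comp_out_bij p q) (@comp_in_bij q q') pj.
exists t2, k, c; split=> // C w x s s' y u u'.
rewrite -(cP C w x y (copair s s') (copair u u') (ord_copair w x) (ord_copair y w)).
- by rewrite tjuxt_compat !ord_copair_l !ord_copair_r.
- by case=> i /=; rewrite ?ord_copair_lshift ?ord_copair_rshift.
by move=> o; rewrite /ord_copair /comp_out; case: (split o).
Qed.

Lemma trace_pres p (d : dclass ty p p) b (t : str b _ _) l :
  pres d t l ->
  exists (t' : str b 0 0) k (c : 'I_p -> 'I_k + ('I_0 + bout b)),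
  [/\ pres (trace_class d) t' (l + k),
      forall i, exists j, c j = inl i &
      forall (C : Type) (w : 'I_p -> C) x s y u,
       (compat t w s w u <->
        compat t' x s y u /\ exists h, forall j, w j = copair h (copair x s) (c j))].
Proof.
rewrite -{1}[d]reprK /trace_class => pd.
have [t' [k [c [pt c_onto cP]]]] := pres_glue (@trace_out_bij p) (@trace_in_bij p) pd.
exists t', k, c; split=> // C w x s y u; apply: cP => [|o] //.
by case=> [|[]].
Qed.

(** Weights behave like a state sum: composition becomes matrix multiplication, summing over the
    colours of the glued ports. *)
Lemma comp0_val X Y Z (dE : hom0 (dclass ty) Y Z) (dD : hom0 (dclass ty) X Y)
    bE bD (tE : str bE _ _) (tD : str bD _ _) lE lD :
  pres dE tE lE -> pres dD tD lD ->
  exists (t : str (badd bE bD) (Z.1 + X.2) (Z.2 + X.1)) l,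
    pres (comp0_class dE dD) t l /\
    forall (C : finType) (x : _ -> C) s s' y u u',
      weight t l x (copair s s') y (copair u u') =
      \sum_(w : {ffun 'I_Y.1 -> C}) \sum_(w' : {ffun 'I_Y.2 -> C})
        (weight tE lE (ord_copair (x \o @lshift _ _) w) s (ord_copair (y \o @lshift _ _) w') u *
         weight tD lD (ord_copair w' (x \o @rshift _ _)) s' (ord_copair w (y \o @rshift _ _)) u')%N.
Proof.
move=> pE pD; have [t [k [c [pt c_onto cP]]]] := comp0_pres pE pD.
exists t, (lE + lD + k)%N; split=> // C x s s' y u u'.
pose F (w : 'I_Y.1 -> C) (w' : 'I_Y.2 -> C) :=
  compatb tE (ord_copair (x \o @lshift _ _) w) s (ord_copair (y \o @lshift _ _) w') u &&
  compatb tD (ord_copair w' (x \o @rshift _ _)) s' (ord_copair w (y \o @rshift _ _)) u'.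
rewrite -(@sum_ffun_sum _ _ addn _ _ _ (fun w w' => weight tE lE (ord_copair (x \o @lshift _ _) w)
    s (ord_copair (y
  \o @lshift _ _) w') u *
         weight tD lD (ord_copair w' (x \o @rshift _ _)) s'
           (ord_copair w (y \o @rshift _ _)) u')%N).
rewrite (eq_bigr (fun w : {ffun 'I_Y.1 + 'I_Y.2 -> C} => F (w \o inl) (w \o inr) * #|C| ^ (lE +
  lD)))%N; last first.
  by move=> w _; rewrite /weight mulnACA -expnD mulnb.
rewrite -big_distrl /= -big_mkcond_nat sum1_card.
rewrite (@card_cycle_colours _ C _ k c (copair x (copair s s')) _
    (compatb t x (copair s s') y (copair u u')) c_onto).
  by rewrite /weight mulnAC -mulnA -expnD.
move=> w; rewrite -(rwP (compatP _ _ _ _ _)).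
have := cP C (w \o inl) (w \o inr) x s s' y u u'; rewrite copair_eta => <-.
by rewrite /F; split=> [/andP[/compatP ? /compatP ?]|[? ?]] //; apply/andP; split; apply/compatP.
Qed.

Lemma trace0_val X (d : hom0 (dclass ty) X X) b (t : str b _ _) l :
  pres d t l ->
  exists (t' : str b 0 0) l', pres (trace0_class d) t' l' /\
    forall (C : finType) (x : _ -> C) s y u,
      weight t' l' x s y u =
      \sum_(w : {ffun 'I_X.1 -> C}) \sum_(w' : {ffun 'I_X.2 -> C})
        weight t l (ord_copair w' w) s (ord_copair w w') u.
Proof.
move=> pd; have [t' [k [c [pt c_onto cP]]]] := trace0_pres pd.
exists t', (l + k)%N; split=> // C x s y u.
pose F (w : 'I_X.1 -> C) (w' : 'I_X.2 -> C) := compatb t (ord_copair w' w) s (ord_copair w w') u.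
rewrite -(@sum_ffun_sum _ _ addn _ _ _ (fun w w' => weight t l (ord_copair w' w) s
    (ord_copair w w') u)) /weight.
rewrite -big_distrl /= -(big_mkcond_nat (fun w : {ffun 'I_X.1 + 'I_X.2 -> C} =>
    F (w \o inl) (w \o inr))) sum1_card.
rewrite (@card_cycle_colours _ C _ k c (copair x s) _ (compatb t' x s y u) c_onto).
  by rewrite mulnAC -mulnA -expnD.
move=> w; rewrite -(rwP (compatP _ _ _ _ _)).
have := cP C (w \o inl) (w \o inr) x s y u; rewrite copair_eta => <-.
by rewrite /F; split=> /compatP.
Qed.

Lemma comp_val p q q' (d : dclass ty p q) (d' : dclass ty q q')
    b b' (t : str b _ _) (t' : str b' _ _) l l' :
  pres d t l -> pres d' t' l' ->
  exists (t2 : str (badd b b') p q') l2, pres (comp_class d d') t2 l2 /\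
    forall (C : finType) (x : _ -> C) s s' y u u',
      weight t2 l2 x (copair s s') y (copair u u') =
      \sum_(w : {ffun 'I_q -> C}) (weight t l w s y u * weight t' l' x s' w u')%N.
Proof.
move=> pd pd'; have [t2 [k [c [pt c_onto cP]]]] := comp_pres pd pd'.
exists t2, (l + l' + k)%N; split=> // C x s s' y u u'.
pose F (w : {ffun 'I_q -> C}) := compatb t w s y u && compatb t' x s' w u'.
rewrite (eq_bigr (fun w => F w * #|C| ^ (l + l')))%N; last first.
  by move=> w _; rewrite /weight mulnACA -expnD mulnb.
rewrite -big_distrl /= -(big_mkcond_nat F) sum1_card.
rewrite (@card_cycle_colours _ C _ k c (copair x (copair s s')) _
    (compatb t2 x (copair s s') y (copair u u')) c_onto).
  by rewrite /weight mulnAC -mulnA -expnD.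
move=> w; rewrite -(rwP (compatP _ _ _ _ _)) -(cP C w x s s' y u u').
by rewrite /F; split=> [/andP[/compatP ? /compatP ?]|[? ?]] //; apply/andP; split; apply/compatP.
Qed.

Lemma trace_val p (d : dclass ty p p) b (t : str b _ _) l :
  pres d t l ->
  exists (t' : str b 0 0) l', pres (trace_class d) t' l' /\
    forall (C : finType) (x : _ -> C) s y u,
      weight t' l' x s y u = \sum_(w : {ffun 'I_p -> C}) weight t l w s w u.
Proof.
move=> pd; have [t' [k [c [pt c_onto cP]]]] := trace_pres pd.
exists t', (l + k)%N; split=> // C x s y u.
pose F (w : {ffun 'I_p -> C}) := compatb t w s w u.
rewrite /weight -big_distrl /= -(big_mkcond_nat F) sum1_card.
rewrite (@card_cycle_colours _ C _ k c (copair x s) _ (compatb t' x s y u) c_onto).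
  by rewrite mulnAC -mulnA -expnD.
move=> w; rewrite -(rwP (compatP _ _ _ _ _)) -(cP C w x s y u).
by rewrite /F; split=> /compatP.
Qed.

End Ops.

Lemma exchange_big4 (A A' B B' : finType) (T : A -> A' -> B -> B' -> nat) :
  (\sum_a \sum_a' \sum_b \sum_b' T a a' b b' =
   \sum_b \sum_b' \sum_a \sum_a' T a a' b b')%N.
Proof.
under eq_bigr => a _ do rewrite exchange_big.
rewrite exchange_big; apply: eq_bigr => b _.
under eq_bigr => a _ do rewrite exchange_big.
by rewrite exchange_big.
Qed.

Definition sum_assoc (A B C : Type) (z : (A + B) + C) : A + (B + C) :=
  match z with
  | inl u => match u with inl x => inl x | inr x => inr (inl x) end
  | inr x => inr (inr x)
  end.

Lemma sum_assoc_bij (A B C : Type) : bijective (@sum_assoc A B C).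
Proof.
by exists (fun z => match z with inl x => inl (inl x)
  | inr u => match u with inl x => inl (inr x) | inr x => inr x end end) => [[[]|]|[|[]]].
Qed.

Definition sum_swap (A B : Type) (z : A + B) : B + A :=
  match z with inl x => inr x | inr x => inl x end.

Lemma sum_swap_bij (A B : Type) : bijective (@sum_swap A B).
Proof. by exists (@sum_swap B A); case. Qed.

Lemma inl_bij (A B : Type) (no : B -> False) : bijective (@inl A B).
Proof.
exists (fun z => match z with inl x => x | inr x => False_rect A (no x) end) => //.
by case=> // x; case: (no x).
Qed.

Lemma sum_ord_copair (R : Type) (idx : R) (op : Monoid.com_law idx) m n (C : finType)
    (F : ('I_(m + n) -> C) -> R) :
  \big[op/idx]_(w : {ffun 'I_(m + n) -> C}) F w =
  \big[op/idx]_(w : {ffun 'I_m -> C}) \big[op/idx]_(w' : {ffun 'I_n -> C}) F (ord_copair w w').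
Proof.
rewrite pair_big /=.
pose f (w : {ffun 'I_m -> C} * {ffun 'I_n -> C}) : {ffun 'I_(m + n) -> C} :=
    [ffun z => ord_copair w.1 w.2 z].
pose g (w : {ffun 'I_(m + n) -> C}) := ([ffun a => w (lshift n a)], [ffun b => w (rshift m b)]).
have fK : cancel f g.
  by move=> [w w']; congr pair; apply/ffunP => a; rewrite !ffunE ?ord_copair_lshift
    ?ord_copair_rshift.
have gK : cancel g f.
  by move=> w; apply/ffunP => i; rewrite ffunE /ord_copair; case: (split i) (splitK i) => a /= <-;
    rewrite ffunE.
rewrite (reindex f); last by exists g => w _; [apply: fK|apply: gK].
by apply: eq_bigr => -[w w'] _; congr F; apply: functional_extensionality => a;
  rewrite /f /= ffunE.
Qed.

(** * Associativity, cyclicity, identities and the pairing *)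

Section Ident.
Variables (r : nat) (ty : 'I_r -> nat * nat).
Local Notation boxes := (boxes ty).

Definition badd_assoc (a b c : boxes) :
    box_iso (badd (badd a b) c) (badd a (badd b c)).
Proof.
refine (@BoxIso _ _ (badd (badd a b) c) (badd a (badd b c)) (@sum_assoc _ _ _)
  (@sum_assoc _ _ _) (@sum_assoc _ _ _) (@sum_assoc_bij _ _ _)
  (@sum_assoc_bij _ _ _) (@sum_assoc_bij _ _ _) _ _ _); by case=> [[]|].
Defined.

Definition badd_comm (a b : boxes) : box_iso (badd a b) (badd b a).
Proof.
refine (@BoxIso _ _ (badd a b) (badd b a) (@sum_swap _ _) (@sum_swap _ _)
  (@sum_swap _ _) (@sum_swap_bij _ _) (@sum_swap_bij _ _) (@sum_swap_bij _ _)
  _ _ _); by case.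
Defined.

Definition badd_empty (a b : boxes) (no : bnode b -> False) :
  box_iso a (badd a b).
Proof.
refine (@BoxIso _ _ a (badd a b) inl inl inl (@inl_bij _ _ no)
  (@inl_bij _ _ (fun x => no (boutp x).1)) (@inl_bij _ _ (fun x => no (binp x).1)) _ _ _).
- by [].
- by move=> x; rewrite /=; case: (boutp x).
- by move=> x; rewrite /=; case: (binp x).
Defined.

Lemma pres_repr p q (d : dclass ty p q) :
  pres d (dgstr (repr d) : str (dboxes (repr d)) p q) (dgloops (repr d)).
Proof. by rewrite -{1}[d]reprK; apply: pres_self. Qed.

(** Both sides have the same state sum over the colours at [Y] and [Z], in two orders of
    summation. *)
Lemma comp0A X Y Z W (dF : hom0 (dclass ty) Z W) (dE : hom0 (dclass ty) Y Z)
    (dD : hom0 (dclass ty) X Y) :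
  comp0_class (comp0_class dF dE) dD = comp0_class dF (comp0_class dE dD).
Proof.
have [pF pE pD] := And3 (pres_repr dF) (pres_repr dE) (pres_repr dD).
have [t1 [l1 [p1 v1]]] := comp0_val pF pE.
have [t2 [l2 [p2 v2]]] := comp0_val p1 pD.
have [t3 [l3 [p3 v3]]] := comp0_val pE pD.
have [t4 [l4 [p4 v4]]] := comp0_val pF p3.
apply: (val_eq (f := badd_assoc _ _ _) p2 p4) => x s y u.
have -> : s \o isoo (badd_assoc _ _ _) = copair (copair (s \o inl) (s \o inr \o inl))
    (s \o inr \o inr).
  by apply: functional_extensionality => -[[]|].
have -> : u \o isoi (badd_assoc _ _ _) = copair (copair (u \o inl) (u \o inr \o inl))
    (u \o inr \o inr).
  by apply: functional_extensionality => -[[]|].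
have -> : weight t4 l4 x s y u = weight t4 l4 x (copair (s \o inl) (s \o inr)) y
    (copair (u \o inl) (u \o inr)).
  by rewrite !copair_eta.
rewrite v2 v4.
transitivity (\sum_(w : {ffun 'I_Y.1 -> bool}) \sum_(w' : {ffun 'I_Y.2 -> bool})
  \sum_(v : {ffun 'I_Z.1 -> bool}) \sum_(v' : {ffun 'I_Z.2 -> bool})
  (weight (dgstr (repr dF) : str (dboxes (repr dF)) _ _) (dgloops (repr dF))
     (ord_copair (x \o @lshift _ _) v) (s \o inl) (ord_copair (y \o @lshift _ _) v') (u \o inl) *
   weight (dgstr (repr dE) : str (dboxes (repr dE)) _ _) (dgloops (repr dE))
     (ord_copair v' w) (s \o inr \o inl) (ord_copair v w') (u \o inr \o inl) *
   weight (dgstr (repr dD) : str (dboxes (repr dD)) _ _) (dgloops (repr dD))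
     (ord_copair w' (x \o @rshift _ _)) (s \o inr \o inr) (ord_copair w (y \o @rshift _ _))
       (u \o inr \o inr)))%N.
  apply: eq_bigr => w _; apply: eq_bigr => w' _; rewrite v1 big_distrl /=.
  by apply: eq_bigr => v _; rewrite big_distrl /= !ord_copair_l !ord_copair_r.
rewrite exchange_big4; apply: eq_bigr => v _; apply: eq_bigr => v' _.
have -> x1 y1 : weight t3 l3 x1 (s \o inr) y1 (u \o inr) = weight t3 l3 x1
    (copair (s \o inr \o inl) (s \o inr \o inr)) y1 (copair (u \o inr \o inl) (u \o inr \o inr)).
  by rewrite !copair_eta.
rewrite v3 big_distrr /=.
apply: eq_bigr => w _; rewrite big_distrr /=; apply: eq_bigr => w' _.
by rewrite mulnA !ord_copair_l !ord_copair_r.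
Qed.

Lemma trace0C X Y (dE : hom0 (dclass ty) Y X) (dD : hom0 (dclass ty) X Y) :
  @trace0_class _ _ X (comp0_class dE dD) = @trace0_class _ _ Y (comp0_class dD dE).
Proof.
have [t1 [l1 [p1 v1]]] := comp0_val (pres_repr dE) (pres_repr dD).
have [t2 [l2 [p2 v2]]] := trace0_val p1.
have [t3 [l3 [p3 v3]]] := comp0_val (pres_repr dD) (pres_repr dE).
have [t4 [l4 [p4 v4]]] := trace0_val p3.
apply: (val_eq (f := badd_comm _ _) p2 p4) => x s y u.
have -> : s \o isoo (badd_comm _ _) = copair (s \o inr) (s \o inl).
  by apply: functional_extensionality => -[].
have -> : u \o isoi (badd_comm _ _) = copair (u \o inr) (u \o inl).
  by apply: functional_extensionality => -[].
rewrite v2 v4 -[s in RHS]copair_eta -[u in RHS]copair_eta.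
under eq_bigr => w _ do under eq_bigr => w' _ do rewrite v1 !ord_copair_l !ord_copair_r.
under [RHS]eq_bigr => v _ do under eq_bigr => v' _ do rewrite v3 !ord_copair_l !ord_copair_r.
rewrite exchange_big4; do 4 apply: eq_bigr => ? _; exact: mulnC.
Qed.

Lemma id0_wireK a b : cancel (@id0_wire a b) (@id0_wire b a).
Proof.
by move=> i; rewrite /id0_wire; case: (split i) (splitK i) => j /= <-;
  rewrite ?(unsplitK (inl _)) ?(unsplitK (inr _)).
Qed.

Lemma ord_copair_wire m n C (a : 'I_m -> C) (b : 'I_n -> C) i :
  ord_copair a b (id0_wire i) = ord_copair b a i.
Proof. by rewrite /ord_copair /id0_wire unsplitK; case: (split i). Qed.

Lemma weight_id X (C : finType) (w : {ffun 'I_X.1 -> C}) (w' : {ffun 'I_X.2 -> C}) a b s u :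
  weight (dgstr (did0 ty X) : str (dboxes (did0 ty X)) _ _) (dgloops (did0 ty X))
    (ord_copair w' a) s (ord_copair w b) u = ((w == [ffun i => a i]) && (w' == [ffun i => b i]))%N.
Proof.
rewrite /weight muln1; congr nat_of_bool; apply/compatP/andP => [H|[/eqP-> /eqP->] [i|[[]]]] //.
  have H' i : ord_copair b w i = ord_copair w' a i.
    by have := H (inl i); rewrite /= ffunE /= ord_copair_wire.
  split; apply/eqP/ffunP => i; rewrite ffunE.
    by have := H' (rshift _ i); rewrite !ord_copair_rshift.
  by have := H' (lshift _ i); rewrite !ord_copair_lshift.
rewrite /= ffunE /= ord_copair_wire /ord_copair; by case: (split i) => j /=; rewrite ffunE.
Qed.

Lemma comp0_id X Y (d : hom0 (dclass ty) X Y) : comp0_class d (id0_class ty X) = d.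
Proof.
have [t1 [l1 [p1 v1]]] := comp0_val (pres_repr d) (pres_self (did0 ty X)).
have no : bnode (dboxes (did0 ty X)) -> False by case.
symmetry; apply: (val_eq (f := badd_empty _ no) (pres_repr d) p1) => x s y u.
rewrite -[s in RHS]copair_eta -[u in RHS]copair_eta v1.
under eq_bigr => w _ do under eq_bigr => w' _ do rewrite weight_id.
rewrite (bigD1 [ffun i => x (rshift Y.2 i)]) //= (bigD1 [ffun i => y (rshift Y.1 i)]) //=.
rewrite !eqxx muln1 big1 ?addn0 => [|w' /negPf ->]; last by rewrite andbF muln0.
rewrite big1 ?addn0 => [|w /negPf ->]; last by rewrite big1 // => w' _; rewrite muln0.
by congr weight; apply: functional_extensionality => i; rewrite /ord_copair;
  case: (split i) (splitK i) => j /= <- //; rewrite ffunE.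
Qed.

(* The trace of an endomorphism in C_0 and the pairing list the ports of one factor in opposite
   orders. *)
Definition swaps a b c e (d : dclass ty (b + a) (c + e)) (d' : dclass ty (a + b) (e + c)) :=
  exists (bx : boxes) (t : str bx (b + a) (c + e)) t' l,
  [/\ pres d t l, pres d' t' l & forall z, t' (sum_map (@id0_wire _ _) id z) = sum_map (@id0_wire
    _ _) id (t z)].

Lemma swaps_ex a b c e (d : dclass ty (b + a) (c + e)) : exists d', swaps d d'.
Proof.
pose t := dgstr (repr d) : str (dboxes (repr d)) (b + a) (c + e).
have idb (A : Type) : bijective (@id A) by exists id.
have wb m n : bijective (@id0_wire m n) by exists (@id0_wire n m); apply: id0_wireK.
pose t' : str (dboxes (repr d)) (a + b) (e + c) := fun z => sum_map (@id0_wire _ _) id (t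
  (sum_map (@id0_wire _ _) id z)).
have bt' : bijective t'.
  apply: (@bij_comp _ _ _ (sum_map (@id0_wire _ _) id)); first exact: sum_map_bij.
  apply: (@bij_comp _ _ _ t); last exact: sum_map_bij.
  exact: pres_bij (pres_repr d).
have [d' pd'] := pres_ex (dgloops (repr d)) bt'.
exists d', (dboxes (repr d)), t, t', (dgloops (repr d)); split=> //; first exact: pres_repr.
by move=> z; rewrite /t'; congr (sum_map _ _ (t _)); case: z => [i|] //=; rewrite id0_wireK.
Qed.

Lemma swaps_sym a b c e (d : dclass ty (b + a) (c + e)) d' : swaps d d' -> swaps d' d.
Proof.
move=> [bx [t [t' [l [pd pd' tt']]]]]; exists bx, t', t, l; split=> // z.
pose z1 := sum_map (@id0_wire c e) id z.
have -> : z = sum_map (@id0_wire e c) id z1.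
  by rewrite /z1; case: z {z1} => [i|] //=; rewrite id0_wireK.
rewrite tt'.
have -> : sum_map (@id0_wire c e) id (sum_map (@id0_wire e c) id z1) = z1.
  by case: z1 => [i|] //=; rewrite id0_wireK.
by case: (t z1) => [i|] //=; rewrite id0_wireK.
Qed.

(** Both closures join each port of [d] to the port of [F] that faces it; the state sums differ only
    in the grouping of these ports. *)
Lemma swaps_pair X Y (d : hom0 (dclass ty) X Y) (F : hom0 (dclass ty) Y X)
    (y : dclass ty (Y.2 + X.1) (Y.1 + X.2)) :
  swaps y F -> @trace0_class _ _ X (comp0_class F d) = trace_class (comp_class d y).
Proof.
move=> [bx [t [t' [l [py pF tt']]]]].
have [t1 [l1 [p1 v1]]] := comp0_val pF (pres_repr d).
have [t2 [l2 [p2 v2]]] := trace0_val p1.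
have [t3 [l3 [p3 v3]]] := comp_val (pres_repr d) py.
have [t4 [l4 [p4 v4]]] := trace_val p3.
apply: (val_eq (f := badd_comm _ _) p2 p4) => x s u v.
have -> : s \o isoo (badd_comm _ _) = copair (s \o inr) (s \o inl).
  by apply: functional_extensionality => -[].
have -> : v \o isoi (badd_comm _ _) = copair (v \o inr) (v \o inl).
  by apply: functional_extensionality => -[].
rewrite v2 v4 -[s in RHS]copair_eta -[v in RHS]copair_eta.
under eq_bigr => w _ do under eq_bigr => w' _ do rewrite v1 !ord_copair_l !ord_copair_r.
under [RHS]eq_bigr => w _ do rewrite v3.
have wF w w' v1' v2' : weight t' l (ord_copair w' v1') (s \o inr) (ord_copair w v2') (v \o inr) =
    weight t l (ord_copair v1' w') (s \o inr) (ord_copair v2' w) (v \o inr).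
  rewrite /weight; congr (nat_of_bool _ * _)%N; apply/compatP/compatP => H z.
    have := H (sum_map (@id0_wire _ _) id z); rewrite tt'.
    by case: (t z) => [o|i] /=; case: z => [o'|i'] /=; rewrite ?ord_copair_wire.
  pose z1 := sum_map (@id0_wire _ _) id z; have := H z1.
  have -> : z = sum_map (@id0_wire _ _) id z1.
    by rewrite /z1; case: z {z1} => [i|] //=; rewrite id0_wireK.
  by rewrite tt'; case: (t z1) => [o|i] /=; case: z1 => [o'|i'] /=; rewrite ?ord_copair_wire.
pose T (p : 'I_(Y.1 + X.2) -> bool) (q : 'I_(Y.2 + X.1) -> bool) :=
  (weight (dgstr (repr d) : str (dboxes (repr d)) _ _) (dgloops (repr d)) q
    (s \o inl) p (v \o inl) *
   weight t l p (s \o inr) q (v \o inr))%N.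
rewrite exchange_big4 (@sum_ord_copair _ _ addn _ _ _ (fun p => \sum_(q : {ffun 'I_(Y.2 + X.1) ->
  bool}) T p q)%N).
apply: eq_bigr => v1' _.
under eq_bigr => v2' _ do rewrite exchange_big /=.
rewrite exchange_big /=; apply: eq_bigr => w' _.
rewrite (@sum_ord_copair _ _ addn _ _ _ (T _)); apply: eq_bigr => v2' _; apply: eq_bigr => w _.
by rewrite wF mulnC.
Qed.

End Ident.

(** * Splitting diagrams into two parts *)

Section Ext.
Variables (A1 A : finType) (e : A1 -> A).

Definition onto (P : A -> bool) := forall a, P a <-> exists a1, e a1 = a.

(** Extension by [false]: colourings of a part become colourings of the whole, where they can be
    compared with those of the whole. *)
Definition ext (f : A1 -> bool) (a : A) : bool := [exists a1, (e a1 == a) && f a1].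

Hypothesis e_inj : injective e.

Lemma extE f a1 : ext f (e a1) = f a1.
Proof.
apply/existsP/idP => [[a2 /andP[/eqP/e_inj-> //]]|fa1].
by exists a1; rewrite eqxx.
Qed.

Lemma ext_le P f a : onto P -> ext f a -> P a.
Proof. by move=> oP /existsP[a1 /andP[/eqP<- _]]; apply/oP; exists a1. Qed.

Lemma ext_restr P (v : A -> bool) : onto P -> (forall a, v a -> P a) -> ext (v \o e) = v.
Proof.
move=> oP vP; apply: functional_extensionality => a; apply/existsP/idP.
  by case=> a1 /andP[/eqP<-].
by move=> va; have /oP[a1 ea] := vP a va; exists a1; rewrite ea eqxx /= ea.
Qed.

End Ext.

Lemma sum_map_inj (A B A' B' : Type) (f : A -> A') (g : B -> B') :
  injective f -> injective g -> injective (sum_map f g).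
Proof. by move=> fi gi [a|b] [a'|b'] //= [] => [/fi|/gi] ->. Qed.

Lemma sum_map_onto (A1 B1 A B : finType) (e : A1 -> A) (e' : B1 -> B) P Q :
  onto e P -> onto e' Q -> onto (sum_map e e') (copair P Q).
Proof.
move=> oP oQ [a|b]; split=> /=.
- by move/oP=> [a1 <-]; exists (inl a1).
- by case=> -[a1|//] [<-]; apply/oP; exists a1.
- by move/oQ=> [b1 <-]; exists (inr b1).
- by case=> -[//|b1] [<-]; apply/oQ; exists b1.
Qed.

Lemma ext_copair (A1 B1 A B : finType) (e : A1 -> A) (e' : B1 -> B) f g z :
  ext (sum_map e e') (copair f g) z = copair (ext e f) (ext e' g) z.
Proof.
case: z => [a|b] /=; apply/existsP/existsP.
- by case=> -[a1|b1] //= /andP[/eqP[<-] fa]; exists a1; rewrite eqxx.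
- by case=> a1 /andP[/eqP<- fa]; exists (inl a1); rewrite eqxx.
- by case=> -[a1|b1] //= /andP[/eqP[<-] fa]; exists b1; rewrite eqxx.
- by case=> a1 /andP[/eqP<- fa]; exists (inr a1); rewrite eqxx.
Qed.

Section Restriction.
Variables (Z1 Z Y1 Y : finType) (t1 : Z1 -> Y1) (t : Z -> Y).
Variables (ez : Z1 -> Z) (ey : Y1 -> Y) (P : Z -> bool) (Q : Y -> bool).
Hypotheses (ez_inj : injective ez) (ey_inj : injective ey).
Hypotheses (oP : onto ez P) (oQ : onto ey Q) (PQ : forall z, Q (t z) = P z).

(** Inside the part this is the commuting square; outside it both extensions are [false], because
    [t] respects the part by [PQ]. *)
Lemma restr_ext (X1 : Z1 -> bool) (U1 : Y1 -> bool) :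
  (forall z, ey (t1 z) = t (ez z)) ->
  (forall z, U1 (t1 z) = X1 z) <-> (forall z, ext ey U1 (t z) = ext ez X1 z).
Proof.
move=> tt; split=> H z; last by have := H (ez z); rewrite -tt !extE.
have [Pz|nPz] := boolP (P z).
  by have /oP[z1 <-] := Pz; rewrite -tt !extE.
have /negPf-> : ~~ ext ey U1 (t z) by apply: contra nPz => /(ext_le oQ); rewrite PQ.
by apply/esym/negbTE; apply: contra nPz => /(ext_le oP).
Qed.

(** Tested on the indicator of a single point, whose extension is again the indicator of a single
    point. *)
Lemma restr_of_ext : bijective t1 -> injective t ->
  (forall (X1 : Z1 -> bool) (U1 : Y1 -> bool),
    (forall z, U1 (t1 z) = X1 z) -> (forall z, ext ey U1 (t z) = ext ez X1 z)) ->
  forall z, ey (t1 z) = t (ez z).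
Proof.
move=> [t1' t1K Kt1] injt H z.
have := H (fun z' => z' == z) (fun y => y == t1 z).
have H1 z' : (t1 z' == t1 z) = (z' == z) by apply: (can_eq t1K).
move/(_ H1 (ez z)); rewrite extE // eqxx => /existsP[y /andP[/eqP <- /eqP->]] //.
Qed.

End Restriction.

Lemma restr_bij (Z1 Z Y1 Y : finType) (t : Z -> Y) (ez : Z1 -> Z) (ey : Y1 -> Y)
    (P : Z -> bool) (Q : Y -> bool) : injective ez -> injective ey ->
  onto ez P -> onto ey Q -> (forall z, Q (t z) = P z) -> bijective t ->
  exists2 t1 : Z1 -> Y1, bijective t1 & forall z, ey (t1 z) = t (ez z).
Proof.
move=> ezi eyi oP oQ PQ [t' tK Kt].
have /fin_all_exists [t1 t1P] : forall z, exists y, ey y = t (ez z).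
  by move=> z; apply/oQ; rewrite PQ; apply/oP; exists z.
have /fin_all_exists [t2 t2P] : forall y, exists z, ez z = t' (ey y).
  by move=> y; apply/oP; rewrite -PQ Kt; apply/oQ; exists y.
exists t1 => //; exists t2 => z.
  by apply: ezi; rewrite t2P t1P tK.
by apply: eyi; rewrite t1P t2P Kt.
Qed.

Section Sub.
Variables (r : nat) (ty : 'I_r -> nat * nat).
Local Notation boxes := (boxes ty).

Definition out_colour (b : boxes) (k : bnode b -> bool) (s : bout b) := k (boutp s).1.
Definition in_colour (b : boxes) (k : bnode b -> bool) (s : bin b) := k (binp s).1.

Record sub_boxes (b1 b : boxes) (k : bnode b -> bool) := SubBoxes {
  sn : bnode b1 -> bnode b; so : bout b1 -> bout b; si : bin b1 -> bin b;
  sn_inj : injective sn; so_inj : injective so; si_inj : injective si;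
  sn_onto : onto sn k; so_onto : onto so (out_colour k); si_onto : onto si (in_colour k);
  sn_lab : forall x, blab (sn x) = blab x;
  soP : forall x, boutp (so x) = (sn (boutp x).1, (boutp x).2);
  siP : forall x, binp (si x) = (sn (binp x).1, (binp x).2) }.

Lemma sig_numbering (N S : finType) (w : N -> nat) (f : S -> N * nat) (k : N -> bool) :
  numbering w f ->
  numbering (fun n : {n | k n} => w (val n))
    (fun s : {s | k (f s).1} => (exist (fun n => k n) (f (val s)).1 (valP s), (f (val s)).2)).
Proof.
move=> [fi fP]; split=> [[s ks] [s' ks'] /= [e1 e2]|[n kn] i /=].
  by apply: val_inj; apply: fi => /=; rewrite [LHS]surjective_pairing e1 e2 -surjective_pairing.
rewrite fP; split=> [[s e]|[[s ks] /= [e1 e2]]]; last first.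
  by exists s; rewrite [LHS]surjective_pairing e1 e2.
have ks : k (f s).1 by rewrite e.
exists (exist (fun s => k (f s).1) s ks) => /=; congr (_, _); last by rewrite e.
by apply: val_inj; rewrite /= e.
Qed.

Definition bsub (b : boxes) (k : bnode b -> bool) : boxes :=
  @Boxes _ _ {n | k n} {s | k (boutp s).1} {s | k (binp s).1} (fun n => blab (val n)) _ _
    (sig_numbering k (boutP b)) (sig_numbering k (binP b)).

Lemma val_onto (T : finType) (k : T -> bool) : onto (val : {x | k x} -> T) k.
Proof. by move=> a; split=> [ka|[[a1 ka] <-] //]; exists (exist (fun x => k x) a ka). Qed.

Definition bsub_sub (b : boxes) (k : bnode b -> bool) : sub_boxes (bsub k) k.
Proof.
refine (@SubBoxes (bsub k) b k (fun x => val x) (fun x => val x) (fun x => val x)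
  _ _ _ _ _ _ _ _ _).
- exact: val_inj.
- exact: val_inj.
- exact: val_inj.
- exact: val_onto.
- exact: val_onto.
- exact: val_onto.
- by [].
- by move=> x; rewrite [LHS]surjective_pairing.
- by move=> x; rewrite [LHS]surjective_pairing.
Defined.

Lemma sub_boxes_iso b1 b2 b (k : bnode b -> bool) (u : sub_boxes b1 k) (v : sub_boxes b2 k) :
  exists f : box_iso b1 b2, [/\ forall x, sn v (f x) = sn u x,
    forall x, so v (isoo f x) = so u x & forall x, si v (isoi f x) = si u x].
Proof.
have key (T1 T2 T : finType) (f : T1 -> T) (g : T2 -> T) P : injective f -> injective g ->
    onto f P -> onto g P -> exists2 h : T1 -> T2, bijective h & forall x, g (h x) = f x.
  move=> fi gi fP gP.
  have /fin_all_exists [h hP] : forall x, exists y, g y = f x.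
    by move=> x; apply/gP/fP; exists x.
  have /fin_all_exists [h' hP'] : forall x, exists y, f y = g x.
    by move=> x; apply/fP/gP; exists x.
  exists h => //; exists h' => x; first by apply: fi; rewrite hP' hP.
  by apply: gi; rewrite hP hP'.
have [f fb fP] := key _ _ _ _ _ _ (@sn_inj _ _ _ u) (@sn_inj _ _ _ v) (sn_onto u) (sn_onto v).
have [g gb gP] := key _ _ _ _ _ _ (@so_inj _ _ _ u) (@so_inj _ _ _ v) (so_onto u) (so_onto v).
have [h hb hP] := key _ _ _ _ _ _ (@si_inj _ _ _ u) (@si_inj _ _ _ v) (si_onto u) (si_onto v).
have fl x : blab (f x) = blab x by rewrite -(sn_lab v) fP (sn_lab u).
have go x : boutp (g x) = (f (boutp x).1, (boutp x).2).
  have := soP v (g x); rewrite gP (soP u) => -[e1 e2].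
  by rewrite [LHS]surjective_pairing -e2; congr (_, _); apply: (@sn_inj _ _ _ v); rewrite -e1 fP.
have hi x : binp (h x) = (f (binp x).1, (binp x).2).
  have := siP v (h x); rewrite hP (siP u) => -[e1 e2].
  by rewrite [LHS]surjective_pairing -e2; congr (_, _); apply: (@sn_inj _ _ _ v); rewrite -e1 fP.
by exists (BoxIso fb gb hb fl go hi).
Qed.

(* The boxes in k and the ports in the images of e and f, with m loops, form the diagram d1. *)
Definition is_sub p q p1 q1 (b : boxes) (t : str b p q) (k : bnode b -> bool)
    (e : 'I_q1 -> 'I_q) (f : 'I_p1 -> 'I_p) (m : nat) (d1 : dclass ty p1 q1) : Prop :=
  exists b1 (u : sub_boxes b1 k) (t1 : str b1 p1 q1), pres d1 t1 m /\
    forall z, sum_map f (si u) (t1 z) = t (sum_map e (so u) z).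

Lemma is_sub_uniq p q p1 q1 b (t : str b p q) k (e : 'I_q1 -> 'I_q) (f : 'I_p1 -> 'I_p) m d1 d2 :
  injective f -> is_sub t k e f m d1 -> is_sub t k e f m d2 -> d1 = d2.
Proof.
move=> fi [b1 [u [t1 [pd1 ut]]]] [b2 [v [t2 [pd2 vt]]]].
have [h [hn ho hi]] := sub_boxes_iso u v.
apply: (pres_eq (f := h) _ pd1 pd2) => z.
apply: (sum_map_inj fi (@si_inj _ _ _ v)).
have -> : sum_map f (si v) (sum_map id (isoi h) (t1 z)) = sum_map f (si u) (t1 z).
  by case: (t1 z) => //= x; rewrite hi.
rewrite vt ut; congr t; by case: z => //= x; rewrite ho.
Qed.

Lemma is_sub_ex p q p1 q1 b (t : str b p q) (k : bnode b -> bool) (x : 'I_q -> bool)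
    (y : 'I_p -> bool) (e : 'I_q1 -> 'I_q) (f : 'I_p1 -> 'I_p) m :
  bijective t -> injective e -> injective f -> onto e x -> onto f y ->
  compat t x (out_colour k) y (in_colour k) -> exists d1, is_sub t k e f m d1.
Proof.
move=> bt ei fi ex fy ct; pose u := bsub_sub k.
have [t1 bt1 t1P] := restr_bij (sum_map_inj ei (@so_inj _ _ _ u)) (sum_map_inj fi (@si_inj _ _ _ u))
  (sum_map_onto ex (so_onto u)) (sum_map_onto fy (si_onto u)) ct bt.
have [d1 pd1] := pres_ex (b := bsub k) m bt1.
by exists d1, (bsub k), u, t1.
Qed.

(** The counterpart of [val_eq] for parts: the weights of the colourings extended by [false]
    determine both the loops and the strings of the part. *)
Lemma is_sub_weight_eq p q p1 q1 b (t : str b p q) (k : bnode b -> bool) (x : 'I_q -> bool)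
    (y : 'I_p -> bool) (e : 'I_q1 -> 'I_q) (f : 'I_p1 -> 'I_p) m m1 d1
    b1 (u : sub_boxes b1 k) (t1 : str b1 p1 q1) :
  bijective t -> injective e -> injective f -> onto e x -> onto f y ->
  compat t x (out_colour k) y (in_colour k) -> pres d1 t1 m1 ->
  (forall (x1 : 'I_q1 -> bool) s1 y1 u1, weight t1 m1 x1 s1 y1 u1 =
    weight t m (ext e x1) (ext (so u) s1) (ext f y1) (ext (si u) u1)) ->
  is_sub t k e f m d1.
Proof.
move=> bt ei fi ex fy ct pd1 H.
have port_emb : m1 = m.
  have := H (fun=> false) (fun=> false) (fun=> false) (fun=> false).
  have F (A B A' B' : finType) (t0 : A + B -> A' + B') : compatb t0 (fun=> false) (fun=> false)
    (fun=> false) (fun=> false).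
    by apply/compatP => z; case: (t0 z); case: z.
  have E (A A' : finType) (g : A -> A') : ext g (fun=> false) = (fun=> false).
    by apply: functional_extensionality => a; apply/existsP => -[a1]; rewrite andbF.
  by rewrite !E /weight !F !mul1n card_bool => /eqP; rewrite eqn_exp2l // => /eqP.
exists b1, u, t1; split; first by rewrite -port_emb.
apply: (restr_of_ext (sum_map_inj ei (@so_inj _ _ _ u)) (pres_bij pd1) (bij_inj bt)) => X1 U1 XU z.
rewrite -[X1]copair_eta -[U1]copair_eta !ext_copair.
have := H (X1 \o inl) (X1 \o inr) (U1 \o inl) (U1 \o inr); rewrite /weight.
have -> : compatb t1 (X1 \o inl) (X1 \o inr) (U1 \o inl) (U1 \o inr).
  by apply/compatP => z1; rewrite !copair_eta.
case: (compatP t) => [ct' _|_ /eqP]; first exact: ct'.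
by rewrite mul1n mul0n card_bool expn_eq0.
Qed.

End Sub.

(** A colouring of the part, extended by [false], vanishes on the cycles outside the part and is
    free on those inside; the exponent counts the latter. *)
Lemma card_sub_cycle_colours (J1 J X : finType) k (c : J -> 'I_k + X) (ej : J1 -> J)
    (h : 'I_k -> bool) (bd bd1 : X -> bool) (col : bool) (P : pred {ffun J1 -> bool}) (Q : bool) :
  injective ej -> onto ej (fun j => copair h bd (c j) == col) ->
  (forall i, exists j, c j = inl i) -> (Q -> forall x, bd1 x -> bd x == col) ->
  (forall w1 : {ffun J1 -> bool}, P w1 <->
     Q /\ exists h1, forall j, ext ej w1 j = copair h1 bd1 (c j)) ->
  #|P| = (Q * 2 ^ #|[pred i | h i == col]|)%N.
Proof.
move=> ei eo c_onto; case: Q => bdle PQ; last first.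
  by rewrite mul0n; apply: eq_card0 => w; apply/negP => /PQ[].
rewrite mul1n -card_bool.
have <- := card_pffun_on false [pred i | h i == col] (@predT bool).
pose F (h1 : {ffun 'I_k -> bool}) : {ffun J1 -> bool} := [ffun j => copair h1 bd1 (c (ej j))].
have hle (h1 : {ffun 'I_k -> bool}) : h1 \in pffun_on false [pred i | h i == col] predT <->
    forall i, h1 i -> h i == col.
  split=> [/pffun_onP[/subsetP le _] i hi|le].
    by apply: le; rewrite !inE hi.
  apply/pffun_onP; split; last by move=> b; rewrite !inE.
  by apply/subsetP => i; rewrite !inE; case hi: (h1 i) => // _; apply: le.
have Fext (h1 : {ffun 'I_k -> bool}) : (forall i, h1 i -> h i == col) ->
    forall j, ext ej (F h1) j = copair h1 bd1 (c j).
  move=> le j.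
  have -> : (F h1 : J1 -> bool) = (fun j => copair h1 bd1 (c j)) \o ej.
    by apply: functional_extensionality => j1; rewrite ffunE.
  rewrite (ext_restr eo) // => j'.
  by case: (c j') => [i /le|x /(bdle isT)].
rewrite -(@card_in_imset _ _ F) => [|h1 h2 /hle l1 /hle l2 e].
  apply: eq_card => w1; apply/idP/imsetP => [/PQ[_ [h1 h1P]]|[h1 /hle le ->]].
    exists [ffun i => h1 i].
      apply/hle => i; rewrite ffunE; have [j cj] := c_onto i.
      by have := h1P j; rewrite cj /= => <- /(ext_le eo); rewrite cj.
    apply/ffunP => j1; have := h1P (ej j1); rewrite extE // => ->.
    by rewrite ffunE; case: (c _) => //= i; rewrite ffunE.
  by apply/PQ; split=> //; exists h1; apply: Fext.
apply/ffunP => i; have [j cj] := c_onto i.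
by have := Fext _ l1 j; rewrite e (Fext _ l2) cj.
Qed.

Section Split.
Variables (r : nat) (ty : 'I_r -> nat * nat).
Local Notation boxes := (boxes ty).

Definition cnt n (c : bool) (ga : 'I_n -> bool) : nat := #|[pred i | ga i == c]|.
Definition port_emb1 n (c : bool) (ga : 'I_n -> bool) : 'I_(cnt c ga) -> 'I_n := enum_val.
Definition port_emb m n c (ga : 'I_m -> bool) (ga' : 'I_n -> bool)
    (i : 'I_(cnt c ga + cnt c ga')) : 'I_(m + n) :=
  unsplit (sum_map (@port_emb1 m c ga) (@port_emb1 n c ga') (split i)).
Arguments port_emb1 {n} c ga _.
Arguments port_emb {m n} c ga ga' _.

Lemma port_emb1_inj n c ga : injective (@port_emb1 n c ga). Proof. exact: enum_val_inj. Qed.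

Lemma port_emb1_onto n c ga : onto (@port_emb1 n c ga) (fun i => ga i == c).
Proof.
move=> i; split=> [gi|[j <-]]; last by have := enum_valP j; rewrite inE.
have gi' : i \in [pred i | ga i == c] by rewrite inE.
by exists (enum_rank_in gi' i); rewrite /port_emb1 enum_rankK_in.
Qed.

Lemma port_emb_inj m n c ga ga' : injective (@port_emb m n c ga ga').
Proof.
move=> i j /(can_inj (@unsplitK _ _)) e; apply: (can_inj (@splitK _ _)).
exact: (sum_map_inj (@port_emb1_inj _ c ga) (@port_emb1_inj _ c ga') e).
Qed.

Lemma port_emb_onto m n c ga ga' : onto (@port_emb m n c ga ga')
    (fun i => ord_copair ga ga' i == c).
Proof.
move=> i; have := sum_map_onto (@port_emb1_onto _ c ga) (@port_emb1_onto _ c ga') (split i).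
have -> : copair (fun i => ga i == c) (fun i => ga' i == c) (split i) = (ord_copair ga ga' i == c).
  by rewrite /ord_copair; case: (split i).
move=> ->; split=> -[z e]; last first.
  by exists (split z); rewrite -e /port_emb unsplitK.
by exists (unsplit z); rewrite /port_emb unsplitK e splitK.
Qed.

Lemma ext_port_emb m n c ga ga' f f' :
  ext (@port_emb m n c ga ga') (ord_copair f f') = ord_copair (ext (port_emb1 c ga) f)
    (ext (port_emb1 c ga') f').
Proof.
apply: functional_extensionality => i; rewrite /ord_copair -ext_copair.
apply/existsP/existsP => -[z /andP[/eqP e fz]].
  by exists (split z); rewrite -e /port_emb unsplitK eqxx.
by exists (unsplit z); rewrite /port_emb unsplitK e splitK eqxx.
Qed.

Lemma onto_sum (A1 B1 A B : finType) (e : A1 -> A) (e' : B1 -> B) P P' Q :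
  onto e P -> onto e' P' -> (forall z, copair P P' z = Q z) -> onto (sum_map e e') Q.
Proof. by move=> oP oP' PQ z; rewrite -PQ; apply: sum_map_onto. Qed.

Definition sub_add (bE bD bE1 bD1 : boxes) (kE : bnode bE -> bool)
    (kD : bnode bD -> bool) (c : bool)
    (uE : sub_boxes bE1 (fun n : bnode bE => kE n == c))
    (uD : sub_boxes bD1 (fun n : bnode bD => kD n == c)) :
  sub_boxes (badd bE1 bD1) (fun n : bnode (badd bE bD) => copair kE kD n == c).
Proof.
refine (@SubBoxes _ _ (badd bE1 bD1) (badd bE bD) _ (sum_map (sn uE) (sn uD))
  (sum_map (so uE) (so uD))
  (sum_map (si uE) (si uD)) _ _ _ _ _ _ _ _ _).
- exact: sum_map_inj (@sn_inj _ _ _ _ _ uE) (@sn_inj _ _ _ _ _ uD).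
- exact: sum_map_inj (@so_inj _ _ _ _ _ uE) (@so_inj _ _ _ _ _ uD).
- exact: sum_map_inj (@si_inj _ _ _ _ _ uE) (@si_inj _ _ _ _ _ uD).
- by apply: onto_sum (sn_onto uE) (sn_onto uD) _ => -[].
- by apply: onto_sum (so_onto uE) (so_onto uD) _ => -[].
- by apply: onto_sum (si_onto uE) (si_onto uD) _ => -[].
- by case=> x /=; rewrite sn_lab.
- by case=> x /=; rewrite soP.
- by case=> x /=; rewrite siP.
Defined.

Lemma is_sub_weight p q p1 q1 (b : boxes) (t : str b p q) (k : bnode b -> bool)
    (e : 'I_q1 -> 'I_q) (f : 'I_p1 -> 'I_p)
    (x : 'I_q -> bool) (y : 'I_p -> bool) m b1 (u : sub_boxes b1 k) (t1 : str b1 p1 q1) :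
  injective e -> injective f -> onto e x -> onto f y -> compat t x (out_colour k) y (in_colour k) ->
  (forall z, sum_map f (si u) (t1 z) = t (sum_map e (so u) z)) ->
  forall x1 s1 y1 u1, weight t1 m x1 s1 y1 u1 =
    weight t m (ext e x1) (ext (so u) s1) (ext f y1) (ext (si u) u1).
Proof.
move=> ei fi ox oy ct tt x1 s1 y1 u1; rewrite /weight; congr (nat_of_bool _ * _)%N.
have := restr_ext (sum_map_inj ei (@so_inj _ _ _ _ _ u)) (sum_map_inj fi (@si_inj _ _ _ _ _ u))
  (sum_map_onto ox (so_onto u)) (sum_map_onto oy (si_onto u)) ct (copair x1 s1) (copair y1 u1) tt.
move=> H; apply/compatP/compatP => [H1 z|H1]; last by apply/H => z; rewrite !ext_copair; apply: H1.
by rewrite -!ext_copair; apply: (proj1 H).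
Qed.

End Split.

(** * Parts of composites and of closures *)

Section Split.
Variables (r : nat) (ty : 'I_r -> nat * nat).
Local Notation boxes := (boxes ty).

Definition colouring (X : nat * nat) := (('I_X.1 -> bool) * ('I_X.2 -> bool))%type.
Definition obj (c : bool) X (ga : colouring X) : nat * nat := (cnt c ga.1, cnt c ga.2).

Lemma compat_col (A B A' B' : finType) (t : A + B -> A' + B') x s y u (c : bool) :
  compat t x s y u -> compat t (fun i => x i == c) (fun i => s i == c)
                     (fun i => y i == c) (fun i => u i == c).
Proof. by move=> ct z; have := ct z; case: (t z) => i /= ->; case: z. Qed.

(** By [is_sub_weight_eq] it is enough to compare weights. A cycle created by the gluing lies in a
    single part, told by [h], and counts as a loop of that part only; hence the last summand in the
    number of loops. *)
Lemma comp_sub X Y Z (bE bD : boxes)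
    (tE : str bE (Z.1 + Y.2) (Z.2 + Y.1)) (tD : str bD (Y.1 + X.2) (Y.2 + X.1))
    (tF : str (badd bE bD) (Z.1 + X.2) (Z.2 + X.1)) k
    (c : 'I_Y.1 + 'I_Y.2 -> 'I_k + ('I_(Z.2 + X.1) + bout (badd bE bD)))
    (gX : colouring X) (gY : colouring Y) (gZ : colouring Z)
    (kE : bnode bE -> bool) (kD : bnode bD -> bool) (h : 'I_k -> bool) (col : bool)
    mE mD (e1 : hom0 (dclass ty) (obj col gY) (obj col gZ))
    (d1 : hom0 (dclass ty) (obj col gX) (obj col gY)) :
  bijective tF -> (forall i, exists j, c j = inl i) ->
  comp_glued tE tD tF c ->
  compat tE (ord_copair gZ.2 gY.1) (out_colour kE) (ord_copair gZ.1 gY.2) (in_colour kE) ->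
  compat tD (ord_copair gY.2 gX.1) (out_colour kD) (ord_copair gY.1 gX.2) (in_colour kD) ->
  (forall j, copair gY.1 gY.2 j = copair h (copair (ord_copair gZ.2 gX.1)
    (copair (out_colour kE) (out_colour kD))) (c j)) ->
  is_sub tE (fun n => kE n == col) (@port_emb _ _ col gZ.2 gY.1)
    (@port_emb _ _ col gZ.1 gY.2) mE e1 ->
  is_sub tD (fun n => kD n == col) (@port_emb _ _ col gY.2 gX.1)
    (@port_emb _ _ col gY.1 gX.2) mD d1 ->
  is_sub tF (fun n => copair kE kD n == col) (@port_emb _ _ col gZ.2 gX.1)
    (@port_emb _ _ col gZ.1 gX.2)
    (mE + mD + #|[pred i | h i == col]|) (comp0_class e1 d1).
Proof.
move=> btF c_onto cP cE cD hW [bE1 [uE [tE1 [pE ttE]]]] [bD1 [uD [tD1 [pD ttD]]]].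
have cF : compat tF (ord_copair gZ.2 gX.1) (copair (out_colour kE) (out_colour kD))
    (ord_copair gZ.1 gX.2) (copair (in_colour kE) (in_colour
  kD)).
  have [] // := proj1 (cP _ gY.1 gY.2 (ord_copair gZ.2 gX.1) (out_colour kE) (out_colour kD)
    (ord_copair gZ.1 gX.2) (in_colour kE) (in_colour kD)).
  by rewrite !ord_copair_l !ord_copair_r.
have weightE x1 s1 y1 u1 := is_sub_weight mE (@port_emb_inj _ _ col gZ.2 gY.1)
  (@port_emb_inj _ _ col gZ.1 gY.2) (@port_emb_onto _ _ col _ _) (@port_emb_onto _ _ col _ _)
  (compat_col col cE) ttE x1 s1 y1 u1.
have weightD x1 s1 y1 u1 := is_sub_weight mD (@port_emb_inj _ _ col gY.2 gX.1)
  (@port_emb_inj _ _ col gY.1 gX.2) (@port_emb_onto _ _ col _ _) (@port_emb_onto _ _ col _ _)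
  (compat_col col cD) ttD x1 s1 y1 u1.
have [t' [l' [p' v']]] :=
  @comp0_val r ty (obj col gX) (obj col gY) (obj col gZ) e1 d1 _ _ _ _ _ _ pE pD.
apply: (is_sub_weight_eq (x := fun i => ord_copair gZ.2 gX.1 i == col)
    (y := fun i => ord_copair gZ.1 gX.2 i == col)
  (u := sub_add uE uD) btF _ _ (@port_emb_onto _ _ col _ _) (@port_emb_onto _ _ col _ _) _ p').
- exact: port_emb_inj.
- exact: port_emb_inj.
- move=> z; have := compat_col col cF z.
  by case: (tF z) => [o|[o|o]]; case: z => [i|[i|i]].
move=> x1 s1 y1 u1.
pose Xl := ext (@port_emb1 _ col gZ.2) (x1 \o @lshift _ _).
pose Xr := ext (@port_emb1 _ col gX.1) (x1 \o @rshift _ _).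
pose Yl := ext (@port_emb1 _ col gZ.1) (y1 \o @lshift _ _).
pose Yr := ext (@port_emb1 _ col gX.2) (y1 \o @rshift _ _).
pose Sl := ext (so uE) (s1 \o inl); pose Sr := ext (so uD) (s1 \o inr).
pose Ul := ext (si uE) (u1 \o inl); pose Ur := ext (si uD) (u1 \o inr).
have -> : ext (@port_emb _ _ col gZ.2 gX.1) x1 = ord_copair Xl Xr by rewrite -ext_port_emb
    ord_copair_eta.
have -> : ext (@port_emb _ _ col gZ.1 gX.2) y1 = ord_copair Yl Yr by rewrite -ext_port_emb
    ord_copair_eta.
have -> : ext (so (sub_add uE uD)) s1 = copair Sl Sr.
  by apply: functional_extensionality => z; rewrite -ext_copair copair_eta.
have -> : ext (si (sub_add uE uD)) u1 = copair Ul Ur.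
  by apply: functional_extensionality => z; rewrite -ext_copair copair_eta.
rewrite -[s1]copair_eta -[u1]copair_eta v'.
pose PE w w' := compatb tE (ord_copair Xl (ext (@port_emb1 _ col gY.1) w)) Sl
    (ord_copair Yl (ext (@port_emb1 _ col gY.2) w')) Ul.
pose PD w w' := compatb tD (ord_copair (ext (@port_emb1 _ col gY.2) w') Xr) Sr
    (ord_copair (ext (@port_emb1 _ col gY.1) w) Yr) Ur.
(* Only glued points of colour [col] are summed over here; [card_sub_cycle_colours] then counts the
   nonzero terms. *)
transitivity (\sum_(w : {ffun 'I_(cnt col gY.1) + 'I_(cnt col gY.2) -> bool})
   (PE (w \o inl) (w \o inr) && PD (w \o inl) (w \o inr)) * 2 ^ (mE + mD))%N.
  rewrite (@sum_ffun_sum _ _ addn _ _ _ (fun w w' => (PE w w' && PD w w') * 2 ^ (mE + mD))%N).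
  apply: eq_bigr => w _; apply: eq_bigr => w' _.
  by rewrite weightE weightD !ext_port_emb /weight card_bool mulnACA -expnD mulnb.
pose P := [pred w : {ffun 'I_(cnt col gY.1) + 'I_(cnt col gY.2) -> bool} |
  PE (w \o inl) (w \o inr) && PD (w \o inl) (w \o inr)].
rewrite -big_distrl /= -(big_mkcond_nat P) sum1_card.
rewrite (@card_sub_cycle_colours _ _ _ k c (sum_map (@port_emb1 _ col gY.1)
    (@port_emb1 _ col gY.2)) h
  (copair (ord_copair gZ.2 gX.1) (copair (out_colour kE) (out_colour kD)))
    (copair (ord_copair Xl Xr) (copair Sl Sr)) col P
  (compatb tF (ord_copair Xl Xr) (copair Sl Sr) (ord_copair Yl Yr) (copair Ul Ur))) //.
- by rewrite /weight card_bool -mulnA -expnD; congr (_ * 2 ^ _)%N; rewrite addnC.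
- exact: sum_map_inj (@port_emb1_inj _ _ _) (@port_emb1_inj _ _ _).
- move=> j; rewrite -hW -(sum_map_onto (@port_emb1_onto _ col gY.1) (@port_emb1_onto _ col gY.2) j).
  by case: j.
- move=> _ [i|[s|s]] /=.
  + by rewrite -ext_port_emb => /(ext_le (@port_emb_onto _ _ _ _ _)).
  + by move/(ext_le (so_onto uE)).
  + by move/(ext_le (so_onto uD)).
move=> w; have := cP _ (ext (@port_emb1 _ col gY.1) (w \o inl))
    (ext (@port_emb1 _ col gY.2) (w \o inr))
  (ord_copair Xl Xr) Sl Sr (ord_copair Yl Yr) Ul Ur.
rewrite !ord_copair_l !ord_copair_r => e; split.
  move=> /andP[/compatP H1 /compatP H2]; have [/compatP -> [h1 h1P]] := proj1 e (conj H1 H2).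
  by split=> //; exists h1 => j; rewrite -h1P -ext_copair copair_eta.
case=> /compatP cF1 [h1 h1P]; have [|H1 H2] := proj2 e.
  by split=> //; exists h1 => j; rewrite -h1P -ext_copair copair_eta.
by apply/andP; split; apply/compatP.
Qed.

(** As for composites: a cycle created by the closure is a loop of the part that has its colour. *)
Lemma trace_sub X (b : boxes) (t : str b (X.1 + X.2) (X.2 + X.1)) (t' : str b 0 0) k
    (c : 'I_X.1 + 'I_X.2 -> 'I_k + ('I_0 + bout b)) (ga : colouring X)
    (kb : bnode b -> bool) (h : 'I_k -> bool) (col : bool) m
    (d1 : hom0 (dclass ty) (obj col ga) (obj col ga)) (x0 y0 : 'I_0 -> bool) :
  bijective t' -> (forall i, exists j, c j = inl i) ->
  trace_glued t t' c ->
  compat t (ord_copair ga.2 ga.1) (out_colour kb) (ord_copair ga.1 ga.2) (in_colour kb) ->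
  (forall j, copair ga.1 ga.2 j = copair h (copair x0 (out_colour kb)) (c j)) ->
  is_sub t (fun n => kb n == col) (@port_emb _ _ col ga.2 ga.1)
    (@port_emb _ _ col ga.1 ga.2) m d1 ->
  is_sub t' (fun n => kb n == col) id id
    (m + #|[pred i | h i == col]|) (trace0_class d1).
Proof.
move=> btF c_onto cP cE hW [b1 [u [t1 [p1 tt]]]].
have cF : compat t' x0 (out_colour kb) y0 (in_colour kb).
  by have [] // := proj1 (cP _ ga.1 ga.2 x0 (out_colour kb) y0 (in_colour kb)).
have weight1 x1 s1 y1 u1 := is_sub_weight m (@port_emb_inj _ _ col ga.2 ga.1)
  (@port_emb_inj _ _ col ga.1 ga.2) (@port_emb_onto _ _ col _ _) (@port_emb_onto _ _ col _ _)
  (compat_col col cE) tt x1 s1 y1 u1.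
have [t2 [l' [p' v']]] := @trace0_val r ty (obj col ga) d1 _ _ _ p1.
apply: (is_sub_weight_eq (x := fun i => x0 i == col) (y := fun i => y0 i == col)
  (u := u) btF _ _ _ _ _ p') => //; try by case.
  exact: compat_col cF.
move=> x1 s1 y1 u1; rewrite v'.
set S := ext (so u) s1; set U := ext (si u) u1; set X' := ext _ x1; set Y' := ext _ y1.
pose PE w w' := compatb t (ord_copair (ext (@port_emb1 _ col ga.2) w')
    (ext (@port_emb1 _ col ga.1) w)) S
  (ord_copair (ext (@port_emb1 _ col ga.1) w) (ext (@port_emb1 _ col ga.2) w')) U.
transitivity (\sum_(w : {ffun 'I_(cnt col ga.1) + 'I_(cnt col ga.2) -> bool})
   PE (w \o inl) (w \o inr) * 2 ^ m)%N.
  rewrite (@sum_ffun_sum _ _ addn _ _ _ (fun w w' => PE w w' * 2 ^ m)%N).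
  apply: eq_bigr => w _; apply: eq_bigr => w' _.
  by rewrite weight1 !ext_port_emb /weight card_bool.
pose P := [pred w : {ffun 'I_(cnt col ga.1) + 'I_(cnt col ga.2) -> bool} |
  PE (w \o inl) (w \o inr)].
rewrite -big_distrl /= -(big_mkcond_nat P) sum1_card.
rewrite (@card_sub_cycle_colours _ _ _ k c (sum_map (@port_emb1 _ col ga.1)
    (@port_emb1 _ col ga.2)) h
  (copair x0 (out_colour kb)) (copair X' S) col P (compatb t' X' S Y' U)) //.
- by rewrite /weight card_bool -mulnA -expnD; congr (_ * 2 ^ _)%N; rewrite addnC.
- exact: sum_map_inj (@port_emb1_inj _ _ _) (@port_emb1_inj _ _ _).
- move=> j; rewrite -hW -(sum_map_onto (@port_emb1_onto _ col ga.1) (@port_emb1_onto _ col ga.2) j).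
  by case: j.
- by move=> _ [[]|s] //= /(ext_le (so_onto u)).
move=> w; have e := cP _ (ext (@port_emb1 _ col ga.1) (w \o inl))
    (ext (@port_emb1 _ col ga.2) (w \o inr)) X'
  S Y' U.
split.
  move=> /compatP H1; have [/compatP -> [h1 h1P]] := proj1 e H1.
  by split=> //; exists h1 => j; rewrite -h1P -ext_copair copair_eta.
case=> /compatP cF1 [h1 h1P]; apply/compatP; apply: (proj2 e); split=> //.
by exists h1 => j; rewrite -h1P -ext_copair copair_eta.
Qed.

End Split.

Lemma numbering_iso (N N' S S' : finType) (w : N -> nat) (w' : N' -> nat)
    (f : S -> N * nat) (f' : S' -> N' * nat) (g : N -> N') :
  numbering w f -> numbering w' f' -> bijective g -> (forall n, w' (g n) = w n) ->
  exists2 h : S -> S', bijective h & forall x, f' (h x) = (g (f x).1, (f x).2).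
Proof.
move=> [fi fP] [fi' fP'] [g' gK Kg] ww.
have /fin_all_exists [h hP] : forall x, exists y, f' y = (g (f x).1, (f x).2).
  by move=> x; apply/fP'; rewrite ww; apply/fP; exists x; apply: surjective_pairing.
exists h => //.
have /fin_all_exists [h' hP'] : forall y, exists x, f x = (g' (f' y).1, (f' y).2).
  by move=> y; apply/fP; rewrite -ww Kg; apply/fP'; exists y; apply: surjective_pairing.
exists h' => x.
  by apply: fi; rewrite hP' hP /= gK -surjective_pairing.
by apply: fi'; rewrite hP hP' /= Kg -surjective_pairing.
Qed.

Section SplitSum.
Variables (r : nat) (ty : 'I_r -> nat * nat).
Local Notation boxes := (boxes ty).

Lemma box_inv (b b' : boxes) (f : box_iso b b') : exists g : box_iso b' b,
  [/\ cancel f g /\ cancel g f, cancel (isoo f) (isoo g) /\ cancel (isoo g) (isoo f) &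
      cancel (isoi f) (isoi g) /\ cancel (isoi g) (isoi f)].
Proof.
have [gn nK Kn] := isonP f; have [go oK Ko] := isooP f; have [gi iK Ki] := isoiP f.
have bn : bijective gn by exists f.
have bo : bijective go by exists (isoo f).
have bi : bijective gi by exists (isoi f).
have l x : blab (gn x) = blab x by rewrite -(isol f) Kn.
have o x : boutp (go x) = (gn (boutp x).1, (boutp x).2).
  by rewrite -{2 3}(Ko x) isoop /= nK -surjective_pairing.
have i x : binp (gi x) = (gn (binp x).1, (binp x).2).
  by rewrite -{2 3}(Ki x) isoip /= nK -surjective_pairing.
by exists (BoxIso bn bo bi l o i).
Qed.

Lemma pres_unique p q (d : dclass ty p q) b b' (t : str b p q) (t' : str b' p q) l l' :
  pres d t l -> pres d t' l' -> l = l' /\ exists f : box_iso b b',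
    forall z, t' (sum_map id (isoo f) z) = sum_map id (isoi f) (t z).
Proof.
move=> [D [u [-> eD ut]]] [D' [u' [e eD' ut']]].
have /diagram_isoP [el [f [fbij flab fstr]]] : diagram_iso D D'
  by rewrite -[diagram_iso _ _]eqmodE e.
split; first by rewrite -eD -eD' el.
have [h hb hP] := numbering_iso (boutP (dboxes D)) (boutP (dboxes D')) fbij
  (fun n => congr1 (fun i => (ty i).1) (flab n)).
have [h' hb' hP'] := numbering_iso (binP (dboxes D)) (binP (dboxes D')) fbij
  (fun n => congr1 (fun i => (ty i).2) (flab n)).
pose F : box_iso (dboxes D) (dboxes D') :=
  @BoxIso _ _ (dboxes D) (dboxes D') f h h' fbij hb hb' flab hP hP'.
have Ft z : dgstr D' (sum_map id h z) = sum_map id h' (dgstr D z).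
  have := fstr z (sum_map id h z).
  have -> : same_point f z (sum_map id h z).
    by case: z => //= x; have [e1 e2] := hP x; apply/andP; split; apply/eqP; rewrite ?e1 ?e2.
  move=> /(_ isT); case: (dgstr D z) (dgstr D' _) => [o|x] [o'|x'] //=; first by move/eqP->.
  move=> /andP[/eqP e1 /eqP e2]; congr inr; apply: (binP (dboxes D')).1.
  by rewrite hP' /= e1 e2.
have [v [[uK _] [uoK uKo] [uiK uKi]]] := box_inv u.
exists (box_comp (box_comp v F) u') => z.
have -> : z = sum_map id (isoo u) (sum_map id (isoo v) z) by case: z => //= x; rewrite uKo.
rewrite ut; set z1 := sum_map id (isoo v) z.
have -> : sum_map id (isoo (box_comp (box_comp v F) u')) (sum_map id (isoo u) z1) =
    sum_map id (isoo u') (sum_map id h z1) by case: z1 => //= x; rewrite uoK.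
by rewrite ut' Ft; case: (dgstr D z1) => //= x; rewrite uiK.
Qed.

Definition sub_boxes_comp (b1 b b' : boxes) (f : box_iso b b') (k : bnode b' -> bool)
  (u : sub_boxes b1 (k \o f)) : sub_boxes b1 k.
Proof.
refine (@SubBoxes _ _ b1 b' k (f \o sn u) (isoo f \o so u) (isoi f \o si u) _ _ _ _ _ _ _ _ _).
- exact: inj_comp (bij_inj (isonP f)) (@sn_inj _ _ _ _ _ u).
- exact: inj_comp (bij_inj (isooP f)) (@so_inj _ _ _ _ _ u).
- exact: inj_comp (bij_inj (isoiP f)) (@si_inj _ _ _ _ _ u).
- move=> n; have [g fK gK] := isonP f; have := sn_onto u (g n); rewrite /= gK => ->.
  by split=> -[x e]; exists x; [rewrite /= e gK|rewrite -e /= fK].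
- move=> n; have [g fK gK] := isooP f; have := so_onto u (g n).
  rewrite {1}/out_colour /= -[f _](congr1 fst (isoop f (g n))) gK => ->.
  by split=> -[x e]; exists x; [rewrite /= e gK|rewrite -e /= fK].
- move=> n; have [g fK gK] := isoiP f; have := si_onto u (g n).
  rewrite {1}/in_colour /= -[f _](congr1 fst (isoip f (g n))) gK => ->.
  by split=> -[x e]; exists x; [rewrite /= e gK|rewrite -e /= fK].
- by move=> x; rewrite /= isol sn_lab.
- by move=> x; rewrite /= isoop soP.
- by move=> x; rewrite /= isoip siP.
Defined.

Lemma is_sub_iso p q p1 q1 (b b' : boxes) (f : box_iso b b') (t : str b p q) (t' : str b' p q) k
    (e : 'I_q1 -> 'I_q) (g : 'I_p1 -> 'I_p) m (d : dclass ty p1 q1) :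
  (forall z, t' (sum_map id (isoo f) z) = sum_map id (isoi f) (t z)) ->
  is_sub t (k \o f) e g m d -> is_sub t' k e g m d.
Proof.
move=> tt' [b1 [u [t1 [p1' ut]]]]; exists b1, (sub_boxes_comp u), t1; split=> // z.
transitivity (sum_map id (isoi f) (sum_map g (si u) (t1 z))); first by case: (t1 z).
by rewrite ut -tt'; congr t'; case: z.
Qed.

(** The value is [None] when some string joins the part to the rest. The class is picked by choice,
    and [is_sub_uniq] shows that there is only one. *)
Definition subc p q p1 q1 (b : boxes) (t : str b p q) (k : bnode b -> bool)
    (e : 'I_q1 -> 'I_q) (f : 'I_p1 -> 'I_p) m : option (dclass ty p1 q1) :=
  match excluded_middle_informative (exists d, is_sub t k e f m d) with
  | left ex => Some (proj1_sig (constructive_indefinite_description _ ex))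
  | right _ => None
  end.

Lemma subcP p q p1 q1 (b : boxes) (t : str b p q) k (e : 'I_q1 -> 'I_q) (f : 'I_p1 -> 'I_p) m d :
  injective f -> subc t k e f m = Some d <-> is_sub t k e f m d.
Proof.
move=> fi; rewrite /subc; case: excluded_middle_informative => [ex|nex].
  case: constructive_indefinite_description => d' sd' /=; split=> [[<-] //|sd].
  by rewrite (is_sub_uniq fi sd sd').
by split=> // sd; case: nex; exists d.
Qed.

Lemma eq_subc p q p1 q1 (b b' : boxes) (t : str b p q) (t' : str b' p q) k k'
    (e : 'I_q1 -> 'I_q) (f : 'I_p1 -> 'I_p) m : injective f ->
  (forall d, is_sub t k e f m d <-> is_sub t' k' e f m d) ->
  subc t k e f m = subc t' k' e f m.
Proof.
move=> fi tt'; case E: (subc t' _ _ _ _) => [d|].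
  by apply/(subcP _ _ _ _ _ fi)/tt'/(subcP _ _ _ _ _ fi).
case E': (subc t _ _ _ _) => [d|] //.
by move/(subcP _ _ _ _ _ fi)/tt'/(subcP _ _ _ _ _ fi): E'; rewrite E.
Qed.

Section Sum.
Variables (V : nmodType) (p q : nat) (pp qq : bool -> nat).
Variables (e : forall c, 'I_(qq c) -> 'I_q) (f : forall c, 'I_(pp c) -> 'I_p).
Hypothesis f_inj : forall c, injective (@f c).
Variable Phi : option (dclass ty (pp true) (qq true)) ->
  option (dclass ty (pp false) (qq false)) -> V.

(* Incompatible colourings contribute nothing if Phi vanishes at None. *)
Definition split_sum (b : boxes) (t : str b p q) l : V :=
  (\sum_(k : {ffun bnode b -> bool}) \sum_(S : {ffun 'I_l -> bool})
    Phi (subc t (fun n => k n == true) (@e true) (@f true) (cnt true S))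
        (subc t (fun n => k n == false) (@e false) (@f false) (cnt false S)))%R.

Lemma split_sum_pres d b b' (t : str b p q) (t' : str b' p q) l l' :
  pres d t l -> pres d t' l' -> split_sum t l = split_sum t' l'.
Proof.
move=> pd pd'; have [el [F tt']] := pres_unique pd pd'; subst l'.
have [G [[FG GF] [FoG GoF] [FiG GiF]]] := box_inv F.
have t't z : t (sum_map id (isoo G) z) = sum_map id (isoi G) (t' z).
  have -> : z = sum_map id (isoo F) (sum_map id (isoo G) z) by case: z => //= x; rewrite GoF.
  set z1 := sum_map id (isoo G) z; rewrite tt'.
  have -> : sum_map id (isoo G) (sum_map id (isoo F) z1) = z1.
    by case: z1 => //= x; rewrite FoG.
  by case: (t z1) => //= x; rewrite FiG.
rewrite /split_sum (reindex (fun k : {ffun bnode b' -> bool} => [ffun n => k (F n)])) /=;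
  last first.
  exists (fun k : {ffun bnode b -> bool} => [ffun n => k (G n)]) => k _; apply/ffunP => n;
    by rewrite !ffunE ?FG ?GF.
have H c (k : {ffun bnode b' -> bool}) m :
    subc t (fun n => [ffun n => k (F n)] n == c) (@e c) (@f c) m =
    subc t' (fun n => k n == c) (@e c) (@f c) m.
  have kF : (fun n => [ffun n => k (F n)] n == c) = (fun n => k n == c) \o F.
    by apply: functional_extensionality => n; rewrite ffunE.
  have kG : (fun n => k n == c) = (fun n => [ffun n => k (F n)] n == c) \o G.
    by apply: functional_extensionality => n; rewrite /= ffunE GF.
  apply: eq_subc => // d0; split.
    by rewrite kF; apply: is_sub_iso.
  by rewrite [in X in X -> _]kG; apply: is_sub_iso.
by apply: eq_bigr => k _; apply: eq_bigr => S _; rewrite !H.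
Qed.

End Sum.
End SplitSum.

(** * Splittings of composites and of closures *)

Section SplitOps.
Variables (r : nat) (ty : 'I_r -> nat * nat).
Local Notation boxes := (boxes ty).

(** A starting point belongs to the part of its own colour [c], and its string stays within that
    part. *)
Lemma is_sub_compat p q (pp qq : bool -> nat) (b : boxes) (t : str b p q) (k : bnode b -> bool)
    (x : 'I_q -> bool) (y : 'I_p -> bool) (e : forall c, 'I_(qq c) -> 'I_q)
    (f : forall c, 'I_(pp c) -> 'I_p) (m : bool -> nat) :
  (forall c, onto (@e c) (fun i => x i == c)) -> (forall c, onto (@f c) (fun i => y i == c)) ->
  (forall c, exists d, is_sub t (fun n => k n == c) (@e c) (@f c) (m c) d) ->
  compat t x (out_colour k) y (in_colour k).
Proof.
move=> oe of_ sub z; set c := copair x _ z; have [d [b1 [u [t1 [_ tt]]]]] := sub c.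
have [|z1 ez] := proj1 (sum_map_onto (oe c) (so_onto u) z).
  by rewrite /c; case: (z) => a /=; rewrite /out_colour eqxx.
have := sum_map_onto (of_ c) (si_onto u) (t z); rewrite -{2}ez -tt => H.
have := proj2 H (ex_intro _ _ erefl).
by case: (t z) => a /= /eqP.
Qed.

Lemma cnt_copair m n c (a : 'I_m -> bool) (b : 'I_n -> bool) : cnt c (ord_copair a b) =
    (cnt c a + cnt c b)%N.
Proof.
rewrite /cnt -!sum1_card big_mkcond /= big_split_ord /=; congr addn;
  by rewrite [RHS]big_mkcond; apply: eq_bigr => i _; rewrite !inE ?ord_copair_lshift
    ?ord_copair_rshift.
Qed.

Definition ocomp X Y Z (E : option (hom0 (dclass ty) Y Z)) (D : option (hom0 (dclass ty) X Y)) :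
  option (hom0 (dclass ty) X Z) :=
  match E, D with Some e, Some d => Some (comp0_class e d) | _, _ => None end.

Definition homsub X Y (gX : colouring X) (gY : colouring Y) (b : boxes)
    (t : str b (Y.1 + X.2) (Y.2 + X.1)) (k : bnode b -> bool) (col : bool) (m : nat) :
    option (hom0 (dclass ty) (obj col gX) (obj col gY)) :=
  subc t (fun n => k n == col) (@port_emb _ _ col gY.2 gX.1) (@port_emb _ _ col gY.1 gX.2) m.

Lemma homsubP X Y (gX : colouring X) (gY : colouring Y) (b : boxes)
    (t : str b (Y.1 + X.2) (Y.2 + X.1)) k col m d :
  @homsub X Y gX gY b t k col m = Some d <->
  is_sub t (fun n => k n == col) (@port_emb _ _ col gY.2 gX.1) (@port_emb _ _ col gY.1 gX.2) m d.
Proof. by apply: subcP; apply: port_emb_inj. Qed.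

Lemma homsub_compat X Y (gX : colouring X) (gY : colouring Y) (b : boxes)
    (t : str b (Y.1 + X.2) (Y.2 + X.1)) k m m' :
  homsub gX gY t k true m -> homsub gX gY t k false m' ->
  compat t (ord_copair gY.2 gX.1) (out_colour k) (ord_copair gY.1 gX.2) (in_colour k).
Proof.
case e1: (homsub _ _ _ _ true _) => [d1|] // _; case e0: (homsub _ _ _ _ false _) => [d0|] // _.
apply: (is_sub_compat (e := fun c => @port_emb _ _ c gY.2 gX.1)
    (f := fun c => @port_emb _ _ c gY.1 gX.2)
  (m := fun c => if c then m else m')).
- by move=> c; apply: port_emb_onto.
- by move=> c; apply: port_emb_onto.
by case; [exists d1; apply/homsubP|exists d0; apply/homsubP].
Qed.

Lemma homsub_ex X Y (gX : colouring X) (gY : colouring Y) (b : boxes)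
    (t : str b (Y.1 + X.2) (Y.2 + X.1)) k col m : bijective t ->
  compat t (ord_copair gY.2 gX.1) (out_colour k) (ord_copair gY.1 gX.2) (in_colour k) ->
  exists d, homsub gX gY t k col m = Some d.
Proof.
move=> bt ct; have [d sd] := is_sub_ex (k := fun n => k n == col) m bt (@port_emb_inj _ _ col gY.2
  gX.1) (@port_emb_inj _ _ col gY.1 gX.2)
  (@port_emb_onto _ _ col _ _) (@port_emb_onto _ _ col _ _) (compat_col col ct).
by exists d; apply/homsubP.
Qed.

Section Hom.
Variable V : nmodType.
Local Open Scope ring_scope.

(** A coproduct of diagrams with prescribed colours at the ports, followed by [Phi] on its two legs:
    [k] distributes the boxes over the two parts, [S] the loops. *)
Definition pres_split X Y (gX : colouring X) (gY : colouring Y)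
    (Phi : option (hom0 (dclass ty) (obj true gX) (obj true gY)) ->
      option (hom0 (dclass ty) (obj false gX) (obj false gY)) -> V)
    (b : boxes) (t : str b (Y.1 + X.2) (Y.2 + X.1)) l : V :=
  \sum_(k : {ffun bnode b -> bool}) \sum_(S : {ffun 'I_l -> bool})
    Phi (homsub gX gY t k true (cnt true S)) (homsub gX gY t k false (cnt false S)).

Lemma pres_split_pres X Y gX gY Phi (d : hom0 (dclass ty) X Y) (b b' : boxes)
    (t : str b _ _) (t' : str b' _ _) l l' :
  pres d t l -> pres d t' l' -> @pres_split X Y gX gY Phi b t l = pres_split Phi t' l'.
Proof.
exact: (@split_sum_pres r ty V _ _ (fun c => ((obj c gY).1 + (obj c gX).2)%N)
    (fun c => ((obj c gY).2 + (obj c gX).1)%N)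
    (fun c => @port_emb _ _ c gY.2 gX.1) (fun c => @port_emb _ _ c gY.1 gX.2)
      (fun c => @port_emb_inj _ _ c _ _)).
Qed.

(** A splitting of the composite amounts to splittings of both factors with the same colours at the
    middle ports. For fixed colours of the boxes, the admissible colours of the middle ports
    correspond to the colours of the new loops, so no splitting is counted twice. *)
Lemma pres_split_comp X Y Z (gX : colouring X) (gZ : colouring Z)
    (Phi : option (hom0 (dclass ty) (obj true gX) (obj true gZ)) ->
      option (hom0 (dclass ty) (obj false gX) (obj false gZ)) -> V)
    (bE bD : boxes) (tE : str bE (Z.1 + Y.2) (Z.2 + Y.1)) (tD : str bD (Y.1 + X.2) (Y.2 + X.1))
    lE lD k (t : str (badd bE bD) (Z.1 + X.2) (Z.2 + X.1))
    (c : 'I_Y.1 + 'I_Y.2 -> 'I_k + ('I_(Z.2 + X.1) + bout (badd bE bD))) :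
  (forall a, Phi None a = 0) -> (forall a, Phi a None = 0) ->
  bijective tE -> bijective tD -> bijective t ->
  (forall i, exists j, c j = inl i) ->
  comp_glued tE tD t c ->
  pres_split Phi t (lE + lD + k)%N =
  \sum_(w : {ffun 'I_Y.1 -> bool}) \sum_(w' : {ffun 'I_Y.2 -> bool})
    @pres_split Y Z (fun_of_fin w, fun_of_fin w') gZ (fun e1 e0 =>
      @pres_split X Y gX (fun_of_fin w, fun_of_fin w') (fun d1 d0 =>
        Phi (ocomp e1 d1) (ocomp e0 d0)) bD tD lD) bE tE lE.
Proof.
move=> Phi0l Phi0r btE btD bt c_onto cP.
pose G (w : 'I_Y.1 -> bool) (w' : 'I_Y.2 -> bool) : colouring Y := (w, w').
rewrite -(@sum_ffun_sum V 0 +%R _ _ _ (fun w w' =>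
  @pres_split Y Z (G w w') gZ (fun e1 e0 => @pres_split X Y gX (G w w')
   (fun d1 d0 => Phi (ocomp e1 d1) (ocomp e0 d0)) bD tD lD) bE tE lE)).
rewrite /pres_split.
pose T (kE : bnode bE -> bool) (SE : 'I_lE -> bool) (kD : bnode bD -> bool)
  (SD : 'I_lD -> bool) w w' :=
  Phi (ocomp (homsub (G w w') gZ tE kE true (cnt true SE))
    (homsub gX (G w w') tD kD true (cnt true SD)))
      (ocomp (homsub (G w w') gZ tE kE false (cnt false SE))
        (homsub gX (G w w') tD kD false (cnt false SD))).
pose F (kE : bnode bE -> bool) (SE : 'I_lE -> bool) (kD : bnode bD -> bool) (SD : 'I_lD -> bool)
    (h : 'I_k -> bool) :=
  Phi (homsub gX gZ t (copair kE kD) true (cnt true (ord_copair (ord_copair SE SD) h)))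
      (homsub gX gZ t (copair kE kD) false (cnt false (ord_copair (ord_copair SE SD) h))).
(* The loops of the composite come from [E], from [D] and from the gluing; [SE], [SD] and [h] are
   their colours. *)
transitivity (\sum_(kE : {ffun bnode bE -> bool}) \sum_(kD : {ffun bnode bD -> bool})
    \sum_(SE : {ffun 'I_lE -> bool}) \sum_(SD : {ffun 'I_lD -> bool})
    \sum_(h : {ffun 'I_k -> bool}) F kE SE kD SD h).
  pose U kk := \sum_(S : {ffun 'I_(lE + lD + k) -> bool})
    Phi (homsub gX gZ t kk true (cnt true S)) (homsub gX gZ t kk false (cnt false S)).
  rewrite -(@sum_ffun_sum V 0 +%R _ _ _ (fun kE kD => \sum_(SE : {ffun 'I_lE -> bool})
    \sum_(SD : {ffun 'I_lD -> bool}) \sum_(h : {ffun 'I_k -> bool}) F kE SE kD SD h)).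
  apply: eq_bigr => k0 _.
  transitivity (U (copair (k0 \o inl) (k0 \o inr))); first by rewrite copair_eta.
  rewrite /U (@sum_ord_copair V 0 +%R _ _ _ (fun S => Phi (homsub gX gZ t _ true (cnt true S))
    (homsub gX gZ t _ false (cnt false S)))).
  by rewrite (@sum_ord_copair V 0 +%R _ _ _ (fun S => \sum_(h : {ffun 'I_k -> bool})
    Phi (homsub gX gZ t _ true (cnt true (ord_copair S h)))
      (homsub gX gZ t _ false (cnt false (ord_copair S h))))).
transitivity (\sum_(kE : {ffun bnode bE -> bool}) \sum_(SE : {ffun 'I_lE -> bool})
    \sum_(kD : {ffun bnode bD -> bool}) \sum_(SD : {ffun 'I_lD -> bool})
    \sum_(v : {ffun 'I_Y.1 + 'I_Y.2 -> bool}) T kE SE kD SD (v \o inl) (v \o inr)); last first.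
  rewrite [RHS]exchange_big; apply: eq_bigr => kE _.
  rewrite [RHS]exchange_big; apply: eq_bigr => SE _.
  rewrite [RHS]exchange_big; apply: eq_bigr => kD _.
  by rewrite [RHS]exchange_big; apply: eq_bigr => SD _.
apply: eq_bigr => kE _; rewrite exchange_big; apply: eq_bigr => SE _.
apply: eq_bigr => kD _; apply: eq_bigr => SD _.
pose P (v : {ffun 'I_Y.1 + 'I_Y.2 -> bool}) :=
  compatb tE (ord_copair gZ.2 (v \o inl)) (out_colour kE) (ord_copair gZ.1 (v \o inr))
    (in_colour kE) &&
  compatb tD (ord_copair (v \o inr) gX.1) (out_colour kD) (ord_copair (v \o inl) gX.2)
    (in_colour kD).
pose Q := compatb t (ord_copair gZ.2 gX.1) (copair (out_colour kE) (out_colour kD))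
    (ord_copair gZ.1 gX.2) (copair (in_colour kE) (in_colour
  kD)).
have PQ v : P v <-> Q /\ exists h, forall j, v j =
    copair h (copair (ord_copair gZ.2 gX.1) (copair (out_colour kE) (out_colour kD))) (c j).
  rewrite /P /Q -(rwP (compatP _ _ _ _ _)).
  have := cP _ (v \o inl) (v \o inr) (ord_copair gZ.2 gX.1) (out_colour kE) (out_colour kD)
    (ord_copair gZ.1 gX.2) (in_colour kE) (in_colour kD).
  rewrite copair_eta !ord_copair_l !ord_copair_r => <-.
  by split=> [/andP[/compatP ? /compatP ?]|[/compatP ? /compatP ?]] //; apply/andP.
have Phi0 a b : Phi a b != 0 -> a /\ b.
  by case: a b => [?|] [?|] //=; rewrite ?Phi0l ?Phi0r eqxx.
have TP (v : {ffun 'I_Y.1 + 'I_Y.2 -> bool}) : T kE SE kD SD (v \o inl) (v \o inr) != 0 -> P v.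
  move/Phi0; rewrite /ocomp; case e1: (homsub _ _ tE _ true _) => [E1|] [] //.
  case d1: (homsub _ _ tD _ true _) => [D1|] // _.
  case e0: (homsub _ _ tE _ false _) => [E0|] //.
  case d0: (homsub _ _ tD _ false _) => [D0|] // _.
  apply/andP; split; apply/compatP.
    by apply: (@homsub_compat Y Z (G (v \o inl) (v \o inr)) gZ _ tE kE (cnt true SE) (cnt false
      SE)); rewrite ?e1 ?e0.
  by apply: (@homsub_compat X Y gX (G (v \o inl) (v \o inr)) _ tD kD (cnt true SD) (cnt false SD));
    rewrite ?d1 ?d0.
have -> : \sum_(v : {ffun 'I_Y.1 + 'I_Y.2 -> bool}) T kE SE kD SD (v \o inl) (v \o inr) =
    \sum_(v | P v) T kE SE kD SD (v \o inl) (v \o inr).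
  rewrite [RHS]big_mkcond; apply: eq_bigr => v _; case: ifP => // /negbT nP.
  by apply/eqP; apply: contraNT nP; apply: TP.
have so : out_colour (copair kE kD : bnode (badd bE bD) -> bool) = copair (out_colour kE)
    (out_colour kD).
  by apply: functional_extensionality => -[].
have si : in_colour (copair kE kD : bnode (badd bE bD) -> bool) = copair (in_colour kE)
    (in_colour kD).
  by apply: functional_extensionality => -[].
(* If the colours of the boxes and outer ports are incompatible, both sides vanish. *)
have [QT|QF] := boolP Q; last first.
  rewrite [RHS]big_pred0 => [|v]; last by apply: contraNF QF => /PQ[].
  apply: big1 => h _; apply/eqP; apply: contraNT QF => /Phi0 [].
  move=> h1 h0; apply/compatP; rewrite -so -si; exact: homsub_compat h1 h0.
(* Otherwise the boxes and the outer ports determine the colours of the middle ports, except along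
   the new cycles, where [h] is free. *)
rewrite (big_cycle_colours _ _ c_onto (be := copair (ord_copair gZ.2 gX.1)
    (copair (out_colour kE) (out_colour kD))));
  last first.
  by move=> v; rewrite PQ; split=> [[]|].
apply: eq_bigr => h _; set v : {ffun 'I_Y.1 + 'I_Y.2 -> bool} := [ffun j => _].
have /andP[/compatP cE /compatP cD] : P v by apply/PQ; split=> //; exists h => j; rewrite ffunE.
have key col : homsub gX gZ t (copair kE kD) col (cnt col (ord_copair (ord_copair SE SD) h)) =
    ocomp (homsub (G (v \o inl) (v \o inr)) gZ tE kE col (cnt col SE))
          (homsub gX (G (v \o inl) (v \o inr)) tD kD col (cnt col SD)).
  have [e1 E1] := @homsub_ex Y Z (G (v \o inl) (v \o inr)) gZ _ tE kE col (cnt col SE) btE cE.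
  have [d1 D1] := @homsub_ex X Y gX (G (v \o inl) (v \o inr)) _ tD kD col (cnt col SD) btD cD.
  rewrite E1 D1; apply/homsubP; rewrite !cnt_copair.
  apply: (comp_sub (c := c) (gY := G (v \o inl) (v \o inr)) bt c_onto cP cE cD).
  - by move=> j; rewrite /= copair_eta /v ffunE.
  - exact/homsubP.
  - exact/homsubP.
by rewrite /F /T !key.
Qed.

Lemma hom_split_comp X Y Z (gX : colouring X) (gZ : colouring Z)
    (dE : hom0 (dclass ty) Y Z) (dD : hom0 (dclass ty) X Y)
    (Phi : option (hom0 (dclass ty) (obj true gX) (obj true gZ)) ->
      option (hom0 (dclass ty) (obj false gX) (obj false gZ)) -> V) :
  (forall a, Phi None a = 0) -> (forall a, Phi a None = 0) ->
  pres_split Phi (dgstr (repr (comp0_class dE dD)) : str (dboxes (repr (comp0_class dE dD))) _ _)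
    (dgloops (repr (comp0_class dE dD))) =
  \sum_(w : {ffun 'I_Y.1 -> bool}) \sum_(w' : {ffun 'I_Y.2 -> bool})
    @pres_split Y Z (fun_of_fin w, fun_of_fin w') gZ (fun e1 e0 =>
      @pres_split X Y gX (fun_of_fin w, fun_of_fin w') (fun d1 d0 =>
        Phi (ocomp e1 d1) (ocomp e0 d0)) (dboxes (repr dD)) (dgstr (repr dD)) (dgloops (repr dD)))
      (dboxes (repr dE)) (dgstr (repr dE)) (dgloops (repr dE)).
Proof.
move=> Phi0l Phi0r; have pE := pres_repr dE; have pD := pres_repr dD.
have [t [k [c [pt c_onto cP]]]] := comp0_pres pE pD.
rewrite (pres_split_pres Phi (pres_repr _) pt).
exact: (pres_split_comp _ _ Phi0l Phi0r (pres_bij pE) (pres_bij pD) (pres_bij pt) c_onto cP).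
Qed.

End Hom.
End SplitOps.

Section Closed.
Variables (r : nat) (ty : 'I_r -> nat * nat).
Local Notation boxes := (boxes ty).

Definition csub (b : boxes) (t : str b 0 0) (k : bnode b -> bool) (col : bool) (m : nat) :
    option (dclass ty 0 0) := subc t (fun n => k n == col) id id m.

Lemma csubP (b : boxes) (t : str b 0 0) k col m d :
  csub t k col m = Some d <-> is_sub t (fun n => k n == col) id id m d.
Proof. by apply: subcP. Qed.

Lemma onto_ord0 (x : 'I_0 -> bool) : onto id x.
Proof. by case. Qed.

Lemma csub_compat (b : boxes) (t : str b 0 0) k m m' x y :
  csub t k true m -> csub t k false m' -> compat t x (out_colour k) y (in_colour k).
Proof.
case e1: (csub _ _ true _) => [d1|] // _; case e0: (csub _ _ false _) => [d0|] // _.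
apply: (@is_sub_compat r ty 0 0 (fun=> 0) (fun=> 0) b t k x y (fun=> id) (fun=> id)
  (fun c => if c then m else m')).
- by move=> c; apply: onto_ord0.
- by move=> c; apply: onto_ord0.
by case; [exists d1; apply/csubP|exists d0; apply/csubP].
Qed.

Lemma csub_ex (b : boxes) (t : str b 0 0) k col m x y : bijective t ->
  compat t x (out_colour k) y (in_colour k) -> exists d, csub t k col m = Some d.
Proof.
move=> bt ct; have [d sd] := is_sub_ex (k := fun n => k n == col) m bt (@inj_id _) (@inj_id _)
  (@onto_ord0 _) (@onto_ord0 _) (compat_col col ct).
by exists d; apply/csubP.
Qed.

Section Sum.
Variable V : nmodType.
Local Open Scope ring_scope.

Definition closed_split (Phi : option (dclass ty 0 0) -> option (dclass ty 0 0) -> V)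
    (b : boxes) (t : str b 0 0) l : V :=
  \sum_(k : {ffun bnode b -> bool}) \sum_(S : {ffun 'I_l -> bool})
    Phi (csub t k true (cnt true S)) (csub t k false (cnt false S)).

Lemma closed_split_pres Phi d (b b' : boxes) (t : str b 0 0) (t' : str b' 0 0) l l' :
  pres d t l -> pres d t' l' -> closed_split Phi t l = closed_split Phi t' l'.
Proof.
exact: (@split_sum_pres r ty V 0 0 (fun=> 0) (fun=> 0) (fun=> id) (fun=> id) (fun=> @inj_id _)).
Qed.

Variable Phi : option (dclass ty 0 0) -> option (dclass ty 0 0) -> V.
Hypotheses (Phi0l : forall a, Phi None a = 0) (Phi0r : forall a, Phi a None = 0).

Fact Phi_neq0 a b : Phi a b != 0 -> a /\ b.
Proof. by case: a b => [?|] [?|] //=; rewrite ?Phi0l ?Phi0r eqxx. Qed.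

(** The argument of [pres_split_comp] for a closure: joined ports must have equal colours, so only
    splittings with the same colouring at source and target occur. *)
Lemma pres_split_trace X (b : boxes) (t : str b (X.1 + X.2) (X.2 + X.1)) (t' : str b 0 0) k
    (c : 'I_X.1 + 'I_X.2 -> 'I_k + ('I_0 + bout b)) l :
  bijective t -> bijective t' -> (forall i, exists j, c j = inl i) ->
  trace_glued t t' c ->
  closed_split Phi t' (l + k)%N =
  \sum_(w : {ffun 'I_X.1 -> bool}) \sum_(w' : {ffun 'I_X.2 -> bool})
    @pres_split r ty V X X (fun_of_fin w, fun_of_fin w') (fun_of_fin w, fun_of_fin w')
      (fun d1 d0 => Phi (omap (@trace0_class _ _ _) d1) (omap (@trace0_class _ _ _) d0)) b t l.
Proof.
move=> bt bt' c_onto cP.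
pose G (w : 'I_X.1 -> bool) (w' : 'I_X.2 -> bool) : colouring X := (w, w').
rewrite -(@sum_ffun_sum V 0 +%R _ _ _ (fun w w' => @pres_split r ty V X X (G w w') (G w w')
   (fun d1 d0 => Phi (omap (@trace0_class _ _ _) d1) (omap (@trace0_class _ _ _) d0)) b t l)).
rewrite [RHS]exchange_big; apply: eq_bigr => kb _.
rewrite [RHS]exchange_big (@sum_ord_copair V 0 +%R _ _ _ (fun S => Phi (csub t' _ true (cnt true S))
    (csub t' _ false (cnt false S)))); apply: eq_bigr => S _.
pose T (w : 'I_X.1 -> bool) (w' : 'I_X.2 -> bool) :=
  Phi (omap (@trace0_class _ _ _) (homsub (G w w') (G w w') t kb true (cnt true S)))
      (omap (@trace0_class _ _ _) (homsub (G w w') (G w w') t kb false (cnt false S))).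
pose x0 (i : 'I_0) := true.
pose P (v : {ffun 'I_X.1 + 'I_X.2 -> bool}) :=
  compatb t (ord_copair (v \o inr) (v \o inl)) (out_colour kb) (ord_copair (v \o inl) (v \o inr))
    (in_colour kb).
pose Q := compatb t' x0 (out_colour kb) x0 (in_colour kb).
have PQ v : P v <-> Q /\ exists h, forall j, v j = copair h (copair x0 (out_colour kb)) (c j).
  rewrite /P /Q -!(rwP (compatP _ _ _ _ _)).
  by have := cP _ (v \o inl) (v \o inr) x0 (out_colour kb) x0 (in_colour kb); rewrite copair_eta.
have TP (v : {ffun 'I_X.1 + 'I_X.2 -> bool}) : T (v \o inl) (v \o inr) != 0 -> P v.
  move/Phi_neq0; case e1: (homsub _ _ t _ true _) => [E1|] [] //.
  case e0: (homsub _ _ t _ false _) => [E0|] // _ _; apply/compatP.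
  by apply: (@homsub_compat r ty X X (G (v \o inl) (v \o inr)) (G (v \o inl) (v \o inr)) _ t kb
    (cnt true S) (cnt false S)); rewrite ?e1 ?e0.
transitivity (\sum_(v | P v) T (v \o inl) (v \o inr)); last first.
  rewrite big_mkcond; apply: eq_bigr => v _; case: ifP => // /negbT nP.
  by apply/esym/eqP; apply: contraNT nP; apply: TP.
have [QT|QF] := boolP Q; last first.
  rewrite [RHS]big_pred0 => [|v]; last by apply: contraNF QF => /PQ[].
  apply: big1 => h _; apply/eqP; apply: contraNT QF => /Phi_neq0 [].
  by move=> h1 h0; apply/compatP; exact: csub_compat h1 h0.
rewrite (big_cycle_colours _ _ c_onto (be := copair x0 (out_colour kb))); last first.
  by move=> v; rewrite PQ; split=> [[]|].
apply: eq_bigr => h _; set v : {ffun 'I_X.1 + 'I_X.2 -> bool} := [ffun j => _].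
have /compatP cE : P v by apply/PQ; split=> //; exists h => j; rewrite ffunE.
have key col : csub t' kb col (cnt col (ord_copair S h)) =
    omap (@trace0_class _ _ _) (homsub (G (v \o inl) (v \o inr)) (G (v \o inl) (v \o inr)) t kb
      col (cnt col S)).
  have [e1 E1] := @homsub_ex r ty X X (G (v \o inl) (v \o inr)) (G (v \o inl) (v \o inr)) _ t kb
    col (cnt col S) bt cE.
  rewrite E1; apply/csubP; rewrite cnt_copair.
  apply: (trace_sub (c := c) (ga := G (v \o inl) (v \o inr)) (x0 := x0) x0 bt' c_onto cP cE).
  - by move=> j; rewrite /= copair_eta /v ffunE.
  - exact/homsubP.
by rewrite /T !key.
Qed.

Definition ojuxt (a b : option (dclass ty 0 0)) : option (dclass ty 0 0) :=
  match a, b with Some d, Some d' => Some (juxt_class d d' : dclass ty 0 0) | _, _ => None end.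

Lemma closed_split_juxt (b b' : boxes) (t : str b 0 0) (t' : str b' 0 0) l l' :
  bijective t -> bijective t' ->
  closed_split Phi (tjuxt t t' : str _ 0 0) (l + l') =
  closed_split (fun a1 a0 => closed_split
    (fun a1' a0' => Phi (ojuxt a1 a1') (ojuxt a0 a0')) t' l') t l.
Proof.
move=> bt bt'.
pose U (kk : bnode (badd b b') -> bool) := \sum_(S : {ffun 'I_(l + l') -> bool})
    Phi (csub (tjuxt t t') kk true (cnt true S)) (csub (tjuxt t t') kk false (cnt false S)).
transitivity (\sum_(k : {ffun bnode b -> bool}) \sum_(k' : {ffun bnode b' -> bool}) U
    (copair k k')).
  rewrite -(@sum_ffun_sum V 0 +%R _ _ _ (fun k k' => U (copair k k'))).
  by apply: eq_bigr => k _; rewrite copair_eta.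
apply: eq_bigr => k _; rewrite [RHS]exchange_big; apply: eq_bigr => k' _.
rewrite /U (@sum_ord_copair V 0 +%R _ _ _ (fun S => Phi (csub _ _ true (cnt true S))
    (csub _ _ false (cnt false S)))); apply: eq_bigr => S _; apply: eq_bigr => S' _.
pose x (i : 'I_0) := true.
pose Q := compatb t x (out_colour k) x (in_colour k) && compatb t' x (out_colour k') x
    (in_colour k').
have [/andP[/compatP c1 /compatP c2]|QF] := boolP Q.
  have key col : csub (tjuxt t t') (copair k k') col (cnt col (ord_copair S S')) =
      ojuxt (csub t k col (cnt col S)) (csub t' k' col (cnt col S')).
    have [d1 D1] := csub_ex col (cnt col S) bt c1.
    have [d2 D2] := csub_ex col (cnt col S') bt' c2.
    rewrite D1 D2; apply/csubP; rewrite cnt_copair.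
    move: D1 D2 => /csubP [b1 [u [t1 [p1 tt]]]] /csubP [b1' [u' [t1' [p1' tt']]]].
    exists (badd b1 b1'), (sub_add u u'), (tjuxt t1 t1'); split; first exact: (pres_juxt p1 p1').
    case=> [[]//|[s|s]]; rewrite /tjuxt /=.
      by have := tt (inr s) => /= <-; case: (t1 _) => [[]|].
    by have := tt' (inr s) => /= <-; case: (t1' _) => [[]|].
  by rewrite !key.
have -> : Phi (ojuxt (csub t k true (cnt true S)) (csub t' k' true (cnt true S')))
   (ojuxt (csub t k false (cnt false S)) (csub t' k' false (cnt false S'))) = 0.
  apply/eqP; apply: contraNT QF => /Phi_neq0.
  case e1: (csub t _ true _) => [?|] [] //; case e1': (csub t' _ true _) => [?|] // _.
  case e0: (csub t _ false _) => [?|] //; case e0': (csub t' _ false _) => [?|] // _.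
  apply/andP; split; apply/compatP.
    by apply: (@csub_compat b t k (cnt true S) (cnt false S)); rewrite ?e1 ?e0.
  by apply: (@csub_compat b' t' k' (cnt true S') (cnt false S')); rewrite ?e1' ?e0'.
apply/eqP; apply: contraNT QF => /Phi_neq0[h1 h0].
have := csub_compat (ord_copair x x) (ord_copair x x) h1 h0.
have so : out_colour (copair k k' : bnode (badd b b') -> bool) = copair (out_colour k)
    (out_colour k').
  by apply: functional_extensionality => -[].
have si : in_colour (copair k k' : bnode (badd b b') -> bool) = copair (in_colour k) (in_colour k').
  by apply: functional_extensionality => -[].
rewrite so si => ct; have := proj1 (tjuxt_compat t t' (ord_copair x x) _ _ (ord_copair x x) _ _) ct;
  rewrite !ord_copair_l !ord_copair_r => -[c1 c2].
by apply/andP; split; apply/compatP.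
Qed.

End Sum.
End Closed.

Local Open Scope ring_scope.

(** * Trace representations *)

Section Matrices.
Variable K : fieldType.

(** By induction on the size: a rank factorisation [M = C *m B] yields the smaller nilpotent matrix
    [B *m C], which has the same trace. *)
Lemma mxtrace_nilp n (M : 'M[K]_n) k : M ^+ k = 0 -> \tr M = 0.
Proof.
have [m lenm] := ubnP n; elim: m => // m IHm in n M k lenm *.
move=> Mk; have [Mfull|Mnfull] := eqVneq (\rank M) n.
  have Mu : M \in unitmx by rewrite -row_free_unit /row_free Mfull.
  have : (1%:M : 'M[K]_n) = 0.
    have Mu' j : M ^+ j \in unitmx.
      by elim: j => [|j IHj]; rewrite ?expr0 ?unitmx1 // exprS unitmx_mul Mu.
    by rewrite -(mulmxV (Mu' k)) Mk mul0mx.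
  by move=> e; rewrite -[M]mulmx1 e mulmx0 mxtrace0.
have [q [ltqn [C [B MCB]]]] : exists q, (q < n)%N /\
    exists (C : 'M_(n, q)) (B : 'M_(q, n)), M = C *m B.
  exists (\rank M); split; first by rewrite ltn_neqAle Mnfull rank_leq_row.
  by exists (col_base M), (row_base M); rewrite mulmx_base.
have NE j : (B *m C) ^+ j.+1 = B *m M ^+ j *m C.
  elim: j => [|j IHj]; first by rewrite expr1 expr0 mulmx1.
  rewrite exprSr IHj [M ^+ j.+1]exprSr -[LHS]/(_ *m _) -[M ^+ j * M]/(_ *m _).
  by rewrite {3}MCB !mulmxA.
rewrite {1}MCB mxtrace_mulC; apply: (IHm _ _ k.+1); last by rewrite NE Mk mulmx0 mul0mx.
exact: leq_trans ltqn _.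
Qed.

(** For an idempotent, the two factors of its rank factorisation multiply to the identity in the
    opposite order. *)
Lemma mxtrace_idem n (E : 'M[K]_n) : E *m E = E -> \tr E = (\rank E)%:R.
Proof.
move=> EE; rewrite -{1}[E]mulmx_base mxtrace_mulC.
suff -> : row_base E *m col_base E = 1%:M by rewrite mxtrace1.
apply: (row_full_inj (col_base_full E)); apply: (row_free_inj (row_base_free E)).
by rewrite mulmx1 mulmxA mulmx_base -mulmxA mulmx_base EE.
Qed.

(** [g] is the characteristic polynomial freed from its factors ['X], hence coprime to ['X^N].
    Taking [N] at least the multiplicity of the root 0, Cayley-Hamilton gives the last equation. *)
Lemma fitting_poly n (M : 'M[K]_n.+1) k : exists (N : nat) (u v g : {poly K}),
  [/\ (k < N)%N, u * 'X^N + v * g = 1 & horner_mx M (g * 'X^N) = 0].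
Proof.
have [m [q]] := multiplicity_XsubC (char_poly M) 0.
rewrite monic_neq0 ?char_poly_monic //= subr0 => q0 pE.
have /Bezout_eq1_coprimepP [[u v] /= uv] : coprimep ('X^(m + k.+1)) q.
  by apply: coprimep_expl; rewrite coprimep_sym coprimepX.
exists (m + k.+1)%N, u, v, q; split=> //; first by rewrite addnS ltnS leq_addl.
by rewrite exprD mulrA -pE rmorphM /= Cayley_Hamilton mul0r.
Qed.

(* By Bezout, M is a combination of high powers of M plus a nilpotent polynomial in M. *)
Lemma mxtrace_eventually n (M W : 'M[K]_n) k :
  M *m W = W *m M -> (forall m, (k <= m)%N -> \tr (M ^+ m *m W) = 0) ->
  \tr (M *m W) = 0.
Proof.
case: n M W => [|n] M W cMW trM; first by rewrite /mxtrace big_ord0.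
have [N [u [v [g [ltkN uvg gM]]]]] := fitting_poly M k.
have cpW p : horner_mx M p *m W = W *m horner_mx M p by apply: comm_horner_mx.
have -> : M = horner_mx M (u * 'X^(N.+1)) + horner_mx M (v * g * 'X).
  rewrite -rmorphD /= exprSr mulrA -mulrDl uvg mul1r.
  by rewrite horner_mx_X.
rewrite mulmxDl mxtraceD [X in _ + X](@mxtrace_nilp _ _ N.+1) ?addr0; last first.
  rewrite -[_ *m W]/(_ * W) exprMn_comm; last exact: cpW.
  rewrite -rmorphXn /= !exprMn.
  have -> : v ^+ N.+1 * g ^+ N.+1 * 'X^(N.+1) = (v ^+ N.+1 * g ^+ N * 'X) * (g * 'X^N).
    by rewrite !exprSr; ring.
  by rewrite rmorphM /= gM mulr0 mul0r.
rewrite (_ : u * _ = \sum_(i < size u) u`_i *: 'X^(i + N.+1)); last first.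
  rewrite -{1}[u]coefK poly_def mulr_suml; apply: eq_bigr => i _.
  by rewrite -scalerAl -exprD.
rewrite rmorph_sum /= mulmx_suml raddf_sum /= big1 // => i _.
rewrite linearZ /= -scalemxAl linearZ /= rmorphXn /= horner_mx_X trM ?mulr0 //.
by rewrite addnS ltnW // ltnS (leq_trans (ltnW ltkN)) // leq_addl.
Qed.

Lemma horner_mx_powers n (M : 'M[K]_n.+1) p :
  horner_mx M p = \sum_(i < size p) p`_i *: M ^+ i.
Proof.
rewrite {1}[p](_ : _ = \sum_(i < size p) p`_i *: 'X^i); last by rewrite -poly_def coefK.
by rewrite rmorph_sum /=; apply: eq_bigr => i _; rewrite linearZ /= rmorphXn /= horner_mx_X.
Qed.

(** The power of an invertible [M] cancels, so [g] itself annihilates [M], and the Bezout identity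
    exhibits the inverse. *)
Lemma invmx_powers n (M : 'M[K]_n) : M \in unitmx ->
  exists m (c : 'I_m -> K), invmx M = \sum_i c i *: M ^+ i.
Proof.
case: n M => [|n] M Mu; first by exists 0%N, (fun=> 0); apply/matrixP => -[].
have [N [u [v [g [N0 uvg gM]]]]] := fitting_poly M 0.
case: N N0 uvg gM => // N _ uvg gM.
have g0 : horner_mx M g = 0.
  move: gM; rewrite rmorphM rmorphXn /= horner_mx_X -[_ * _]/(_ *m _) => gM.
  have MNu : M ^+ N.+1 \in unitmx.
    by elim: (N.+1) => [|j IHj]; rewrite ?expr0 ?unitmx1 // exprS unitmx_mul Mu.
  by rewrite -(mulmxK MNu (horner_mx M g)) gM mul0mx.
have uM : horner_mx M (u * 'X^N) *m M = 1%:M.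
  have := congr1 (horner_mx M) uvg.
  rewrite rmorphD [X in _ + X]rmorphM /= g0 mulr0 addr0 rmorph1 exprSr mulrA rmorphM /=.
  by rewrite horner_mx_X.
exists (size (u * 'X^N)), (fun i => (u * 'X^N)`_i).
by rewrite -horner_mx_powers -[LHS]mul1mx -uM mulmxK.
Qed.

(** [E] is the value of [v * g] at [M], the projection onto the generalised kernel; if it were 0,
    the Bezout identity would invert [M]. *)
Lemma fitting_idempotent n (M : 'M[K]_n) : M \notin unitmx ->
  exists N m (c : 'I_m -> K), let E := \sum_i c i *: M ^+ i in
  [/\ E *m E = E, E != 0, E *m M = M *m E & E *m M ^+ N = 0].
Proof.
case: n M => [|n] M Mu; first by rewrite unitmxE det_mx00 unitr1 in Mu.
have [N [u [v [g [N0 uvg gM]]]]] := fitting_poly M 0.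
case: N N0 uvg gM => // N _ uvg gM.
exists N.+1, (size (v * g)), (fun i => (v * g)`_i).
rewrite -horner_mx_powers /=.
have vgM : horner_mx M (v * g) *m M ^+ N.+1 = 0.
  have -> : M ^+ N.+1 = horner_mx M 'X^(N.+1) by rewrite rmorphXn /= horner_mx_X.
  by rewrite -[LHS]rmorphM /= -mulrA rmorphM /= gM mulr0.
have E1 : horner_mx M (v * g) = 1 - horner_mx M (u * 'X^(N.+1)).
  by rewrite -(rmorph1 (horner_mx M)) -uvg rmorphD /= addrC addKr.
split=> //.
- rewrite {2}E1 -[_ *m _]/(_ * _) mulrBr mulr1 -rmorphM /=.
  have -> : v * g * (u * 'X^(N.+1)) = v * u * (g * 'X^(N.+1)) by ring.
  by rewrite [in X in _ - X]rmorphM /= gM mulr0 subr0.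
- apply: contraNneq Mu => E0; rewrite E0 in E1.
  have := subr0_eq (esym E1); rewrite exprSr mulrA rmorphM /= horner_mx_X => e.
  by have [] := mulmx1_unit (esym e).
- by apply: comm_horner_mx.
Qed.

End Matrices.

(** * Dual bases and the Casimir element *)

Section Twisted.
Variables (K : fieldType) (A : Type) (mul : A -> A -> A) (tr : A -> K).

Definition twisted_rep : Prop :=
  exists n (R : A -> 'M[K]_n) (W : 'M[K]_n),
  [/\ forall x y, R (mul x y) = R x *m R y,
      forall x, R x *m W = W *m R x &
      forall x, tr x = \tr (R x *m W)].

(** Lists are enough, since combinations are only evaluated; [A] is a bare type without decidable
    equality. *)
Definition comb := seq (K * A).
Definition comb_eval (V : lmodType K) (f : A -> V) (s : comb) : V :=
  \sum_(p <- s) p.1 *: f p.2.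
Definition cmul (s s' : comb) : comb :=
  [seq (p.1 * p'.1, mul p.2 p'.2) | p <- s, p' <- s'].
Definition cscale (c : K) (s : comb) : comb := [seq (c * p.1, p.2) | p <- s].
(** The exponent is [k.+1], because [A] has no unit to start from. *)
Fixpoint cpow (s : comb) (k : nat) : comb :=
  if k is k'.+1 then cmul s (cpow s k') else s.

Lemma comb_eval_cat (V : lmodType K) (f : A -> V) s s' : comb_eval f (s ++ s') = comb_eval f s +
    comb_eval f s'.
Proof. exact: big_cat. Qed.

Lemma comb_eval_cscale (V : lmodType K) (f : A -> V) c s : comb_eval f (cscale c s) = c
    *: comb_eval f s.
Proof.
by rewrite /comb_eval big_map scaler_sumr; apply: eq_bigr => p _; rewrite scalerA.
Qed.

Lemma comb_eval_cmul n (f : A -> 'M[K]_n) s s' :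
  (forall x y, f (mul x y) = f x *m f y) -> comb_eval f (cmul s s') =
    comb_eval f s *m comb_eval f s'.
Proof.
move=> fM; rewrite /comb_eval big_allpairs_dep /= mulmx_suml; apply: eq_bigr => p _.
rewrite mulmx_sumr; apply: eq_bigr => p' _.
by rewrite fM -scalemxAl -scalemxAr scalerA.
Qed.

Lemma comb_eval_cpow n (f : A -> 'M[K]_n) s k :
  (forall x y, f (mul x y) = f x *m f y) -> comb_eval f (cpow s k) = comb_eval f s ^+ k.+1.
Proof.
by move=> fM; elim: k => [|k IHk] //=; rewrite comb_eval_cmul // IHk [RHS]exprS.
Qed.

Lemma twisted_nilpotent (s : comb) k : twisted_rep ->
  (forall m, (k <= m)%N -> comb_eval (tr : A -> K^o) (cpow s m) = 0) ->
    comb_eval (tr : A -> K^o) s = 0.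
Proof.
move=> [n [R [W [RM RW trR]]]] sk.
have trE u : comb_eval (tr : A -> K^o) u = \tr (comb_eval R u *m W).
  rewrite /comb_eval mulmx_suml linear_sum; apply: eq_bigr => p _.
  by rewrite -scalemxAl linearZ /= -trR.
rewrite trE; apply: (@mxtrace_eventually _ _ _ _ k.+1).
  rewrite /comb_eval mulmx_suml mulmx_sumr; apply: eq_bigr => p _.
  by rewrite -scalemxAl RW scalemxAr.
by case=> // m lekm; rewrite -comb_eval_cpow // -trE sk.
Qed.

Hypothesis mulA : forall x y z, mul x (mul y z) = mul (mul x y) z.
Hypothesis trC : forall x y, tr (mul x y) = tr (mul y x).
Variables (L : finType) (one : L -> A).
Hypothesis tr1 : forall x, \sum_l tr (mul x (one l)) = tr x.

(* Here e and d index a maximal nonzero minor of the form tr (mul x y). *)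
Section Frame.
Variables (n : nat) (e d : 'I_n -> A).
Let G := \matrix_(i, j) tr (mul (e i) (d j)).
Hypothesis Gunit : G \in unitmx.
Let rv x := \row_k tr (mul x (d k)).
Let cv y := \col_l tr (mul (e l) y).
Hypothesis frame : forall x y, tr (mul x y) = (rv x *m invmx G *m cv y) 0 0.

Definition frame_gram x := \matrix_(i, j) tr (mul (mul (e i) x) (d j)).
(** Right multiplication by [x] on the quotient by the radical of the trace form: row [i] holds the
    coordinates of [mul (e i) x] in the basis [e]. *)
Definition frame_rep x : 'M_n := frame_gram x *m invmx G.
(** The usual sum over dual bases: the inner sum over [j] forms the element dual to [e i] out of the
    [d j]. *)
Definition frame_casimir : 'M_n :=
  \sum_i \sum_j invmx G j i *: (frame_rep (d j) *m frame_rep (e i)).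
Definition frame_functional (X : 'M_n) : K :=
  ((\row_k tr (d k)) *m invmx G *m X *m (\col_l tr (e l))) 0 0.
Local Notation M := frame_gram.
Local Notation R := frame_rep.
Local Notation Z := frame_casimir.
Local Notation theta := frame_functional.

Lemma mulmx3E m1 m2 m3 m4 (B : 'M[K]_(m1, m2)) (C : 'M_(m2, m3)) (D : 'M_(m3, m4)) i j :
  (B *m C *m D) i j = (row i B *m C *m col j D) 0 0.
Proof. by rewrite -row_mul !mxE; apply: eq_bigr => k _; rewrite !mxE. Qed.

Lemma row_gram x i : row i (M x) = rv (mul (e i) x).
Proof. by apply/rowP => j; rewrite !mxE. Qed.

Lemma col_gram x j : col j (M x) = cv (mul x (d j)).
Proof. by apply/colP => i; rewrite !mxE mulA. Qed.

Lemma frame_repM x y : R (mul x y) = R x *m R y.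
Proof.
rewrite /R mulmxA; congr (_ *m _); apply/matrixP => i j.
by rewrite mulmx3E row_gram col_gram -frame mxE !mulA.
Qed.

(** Under [tr], the sum of the [one l] acts as a unit although [A] has none; so the image of [R]
    spans a unital algebra. *)
Lemma frame_rep1 : \sum_l R (one l) = 1%:M.
Proof.
rewrite -mulmx_suml -(mulmxV Gunit); congr (_ *m _); apply/matrixP => i j.
rewrite summxE mxE trC -tr1; apply: eq_bigr => l _.
by rewrite mxE trC mulA.
Qed.

(** Inserting units on the left and on the right of [x] brings [tr x] into a shape that [frame]
    expands. *)
Lemma frame_tr x : tr x = theta (R x).
Proof.
have tr1' y : \sum_l tr (mul (one l) y) = tr y.
  by rewrite -[RHS]tr1; apply: eq_bigr => l _; rewrite trC.
have e1 y : tr y = ((\row_k tr (d k)) *m invmx G *m cv y) 0 0.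
  rewrite -tr1' (eq_bigr _ (fun l _ => frame (one l) y)) -summxE -!mulmx_suml.
  by congr ((_ *m _ *m _) 0 0); apply/rowP => k; rewrite summxE mxE -tr1';
    apply: eq_bigr => l _; rewrite mxE.
rewrite e1 /theta /R !mulmxA -!(mulmxA (_ *m invmx G)); congr ((_ *m _) 0 0).
apply/colP => i; rewrite mxE -tr1 (eq_bigr _ (fun l _ => frame _ (one l))) -summxE -mulmx_sumr.
rewrite -row_gram -!row_mul [RHS]mxE !mxE; apply: eq_bigr => k _; rewrite !mxE; congr (_ * _).
by rewrite summxE -tr1; apply: eq_bigr => l _; rewrite mxE.
Qed.

(** The trace of right multiplication by [x] is the sum of the values of [tr] at [e i], [x] and the
    dual of [e i]; by cyclicity this is [tr] of [x] times the Casimir element. *)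
Lemma frame_trace_rep x : \tr (R x) = theta (R x *m Z).
Proof.
have thE i j : tr (mul (mul (e i) x) (d j)) = theta (R x *m (R (d j) *m R (e i))).
  by rewrite -!frame_repM -frame_tr -mulA trC !mulA.
rewrite /frame_casimir mulmx_sumr /theta mulmx_sumr mulmx_suml summxE.
apply: eq_bigr => i _; rewrite !mulmx_sumr mulmx_suml summxE mxE.
by apply: eq_bigr => j _; rewrite mxE thE -!scalemxAr -scalemxAl [RHS]mxE mulrC.
Qed.

Lemma frame_rep_dual x j :
  R (mul x (d j)) = \sum_k (invmx G *m M x) k j *: R (d k).
Proof.
rewrite {1}/R.
have -> : \sum_k (invmx G *m M x) k j *: R (d k) =
    (\sum_k (invmx G *m M x) k j *: M (d k)) *m invmx G.
  by rewrite mulmx_suml; apply: eq_bigr => k _; rewrite scalemxAl.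
congr (_ *m _); apply/matrixP => i l; rewrite summxE mxE.
have -> : tr (mul (mul (e i) (mul x (d j))) (d l)) =
    tr (mul (mul (d l) (e i)) (mul x (d j))) by rewrite trC mulA.
rewrite frame -mulmxA -col_gram mxE; apply: eq_bigr => k _.
rewrite [in RHS]mxE mulrC; congr (_ * _); last by rewrite !mxE -mulA trC.
by rewrite !mxE; apply: eq_bigr => k' _; rewrite [in LHS]mxE.
Qed.

Lemma frame_rep_primal x i :
  R (mul (e i) x) = \sum_k (M x *m invmx G) i k *: R (e k).
Proof.
rewrite {1}/R.
have -> : \sum_k (M x *m invmx G) i k *: R (e k) =
    (\sum_k (M x *m invmx G) i k *: M (e k)) *m invmx G.
  by rewrite mulmx_suml; apply: eq_bigr => k _; rewrite scalemxAl.
congr (_ *m _); apply/matrixP => j l; rewrite summxE mxE.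
have -> : tr (mul (mul (e j) (mul (e i) x)) (d l)) =
    tr (mul (mul (e i) x) (mul (d l) (e j))) by rewrite -mulA trC -mulA.
rewrite frame -row_gram -row_mul mxE; apply: eq_bigr => k _.
rewrite [in RHS]mxE; congr (_ * _); first by rewrite !mxE.
by rewrite !mxE -mulA [in RHS]trC -mulA.
Qed.

(** Left multiplication on the [d j] and right multiplication on the [e i] are adjoint for the trace
    form: moving [x] into either basis produces the coefficients [invmx G *m M x *m invmx G]. *)
Lemma frame_casimirC x : R x *m Z = Z *m R x.
Proof.
transitivity (\sum_i \sum_k (invmx G *m M x *m invmx G) k i *: (R (d k) *m R (e i))).
  rewrite mulmx_sumr; apply: eq_bigr => i _; rewrite mulmx_sumr.
  under eq_bigr => j _.
    rewrite -scalemxAr mulmxA -frame_repM frame_rep_dual mulmx_suml scaler_sumr.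
    under eq_bigr do rewrite -scalemxAl scalerA. over.
  rewrite exchange_big; apply: eq_bigr => k _; rewrite -scaler_suml; congr (_ *: _).
  by rewrite [RHS]mxE; apply: eq_bigr => j _; rewrite mulrC.
rewrite /Z mulmx_suml exchange_big [RHS](eq_bigr (fun i => \sum_j \sum_k
   (invmx G j i * (M x *m invmx G) i k) *: (R (d j) *m R (e k)))); last first.
  move=> i _; rewrite mulmx_suml; apply: eq_bigr => j _.
  rewrite -scalemxAl -mulmxA -frame_repM frame_rep_primal mulmx_sumr scaler_sumr.
  by apply: eq_bigr => k _; rewrite -scalemxAr scalerA.
rewrite [RHS]exchange_big; apply: eq_bigr => j _; rewrite exchange_big.
by apply: eq_bigr => k _; rewrite -scaler_suml -mulmxA mxE.
Qed.

(** The span of the image of [R]. It contains the polynomials in [Z], and on it [theta] computes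
    [tr] of a combination, so that facts about arrows apply to such matrices. *)
Definition frame_span (X : 'M_n) := exists s, X = comb_eval R s.

Lemma span_rep x : frame_span (R x).
Proof. by exists [:: (1, x)]; rewrite /comb_eval big_seq1 scale1r. Qed.

Lemma span_sum (I : Type) (r : seq I) (F : I -> 'M_n) :
  (forall i, frame_span (F i)) -> frame_span (\sum_(i <- r) F i).
Proof.
move=> FP; elim: r => [|i r [s IHr]]; first by exists [::]; rewrite /comb_eval !big_nil.
by have [s' Fi] := FP i; exists (s' ++ s); rewrite big_cons IHr Fi comb_eval_cat.
Qed.

Lemma span_scale c X : frame_span X -> frame_span (c *: X).
Proof. by move=> [s ->]; exists (cscale c s); rewrite comb_eval_cscale. Qed.

Lemma span_mul X Y : frame_span X -> frame_span Y -> frame_span (X *m Y).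
Proof. by move=> [s ->] [s' ->]; exists (cmul s s'); rewrite comb_eval_cmul //; apply: frame_repM.
    Qed.

Lemma span_casimir : frame_span Z.
Proof.
do 2! apply: span_sum => ?; apply/span_scale/span_mul; exact: span_rep.
Qed.

Lemma span_exp X i : frame_span X -> frame_span (X ^+ i).
Proof.
move=> sX; elim: i => [|i IHi]; last by rewrite exprS; apply: span_mul.
by rewrite expr0 -[1]frame_rep1; apply: span_sum => l; apply: span_rep.
Qed.

Lemma theta_ev s : theta (comb_eval R s) = comb_eval (tr : A -> K^o) s.
Proof.
rewrite /theta /comb_eval mulmx_sumr mulmx_suml summxE; apply: eq_bigr => p _.
by rewrite -scalemxAr -scalemxAl mxE [tr _]frame_tr.
Qed.

Lemma span_trace X : frame_span X -> \tr X = theta (X *m Z).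
Proof.
move=> [s ->]; rewrite /theta /comb_eval mulmx_suml mulmx_sumr mulmx_suml summxE linear_sum.
apply: eq_bigr => p _; rewrite -scalemxAl linearZ /= frame_trace_rep.
by rewrite -scalemxAr -scalemxAl [RHS]mxE.
Qed.

(** The inverse of [Z] is a polynomial in [Z], so [span_trace] applies to [R x *m invmx Z] and the
    two factors [Z] cancel. *)
Lemma frame_twisted : Z \in unitmx -> twisted_rep.
Proof.
move=> Zu; have [m [c Winv]] := invmx_powers Zu.
have sW : frame_span (invmx Z).
  by rewrite Winv; apply: span_sum => i; apply/span_scale/span_exp/span_casimir.
exists n, R, (invmx Z); split; first exact: frame_repM.
  move=> x; have := frame_casimirC x.
  move=> /(congr1 (fun X => invmx Z *m X *m invmx Z)).
  by rewrite /= [in LHS]mulmxA (mulmxK Zu) (mulKmx Zu).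
move=> x; rewrite frame_tr (span_trace (span_mul (span_rep x) sW)).
by rewrite (mulmxKV Zu).
Qed.

(* Otherwise a nonzero idempotent E, polynomial in Z, makes E Z nilpotent: \tr E = theta (E Z) = 0. *)
Lemma casimir_unit : [pchar K] =i pred0 ->
  (forall s k, (forall x, comb_eval (fun y => tr (mul y x) : K^o) (cpow s k) = 0) ->
     comb_eval (tr : A -> K^o) s = 0) ->
  Z \in unitmx.
Proof.
move=> charK nil; apply/negPn/negP => Zu.
have [N [m [c]]] := fitting_idempotent Zu; set E := \sum_i _ => /= -[EE E0 EZ EZN].
have sE : frame_span E by apply: span_sum => i; apply/span_scale/span_exp/span_casimir.
have [s EZs] : frame_span (E *m Z) := span_mul sE span_casimir.
have : \tr E = 0.
  (* [s] represents [E *m Z] only modulo the radical; so nilpotency is tested against all [x]. *)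
  rewrite (span_trace sE) EZs theta_ev; apply: (nil _ N) => x.
  have -> : comb_eval (fun y => tr (mul y x) : K^o) (cpow s N) = theta
    (comb_eval R (cpow s N) *m R x).
    rewrite /comb_eval mulmx_suml /theta mulmx_sumr mulmx_suml summxE; apply: eq_bigr => p _.
    by rewrite -scalemxAl -frame_repM -scalemxAr -scalemxAl [RHS]mxE [tr _]frame_tr.
  rewrite (comb_eval_cpow _ _ frame_repM) -EZs.
  have -> : (E *m Z) ^+ N.+1 = 0.
    rewrite -[E *m Z]/(E * Z) exprMn_comm; last by rewrite /GRing.comm -[LHS]/(_ *m _)
      -[RHS]/(_ *m _) EZ.
    rewrite exprSr [Z ^+ N.+1]exprSr -mulrA (mulrA E).
    by rewrite -[E * Z ^+ N]/(E *m Z ^+ N) EZN mul0r mulr0.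
  by rewrite mul0mx /theta mulmx0 mul0mx mxE.
rewrite (mxtrace_idem EE) => /eqP; have /pcharf0P -> := charK.
by rewrite mxrank_eq0 (negPf E0).
Qed.

End Frame.
End Twisted.

(** * Minors of a bilinear form *)

Definition gram (A A' R : Type) (g : A -> A' -> R) n (e : 'I_n -> A)
  (d : 'I_n -> A') : 'M[R]_n := \matrix_(i, j) g (e i) (d j).

(** Descending from the bound [b], the search ends at the latest with the empty minor, which is 1.
    The coefficients are in a ring, since polynomial forms are needed too. *)
Lemma maximal_minor (A A' : Type) (R : comNzRingType) (g : A -> A' -> R) b :
  (forall (e : 'I_b.+1 -> A) d, \det (gram g e d) = 0) ->
  exists n (e : 'I_n -> A) d, \det (gram g e d) != 0 /\
    forall (e' : 'I_n.+1 -> A) d', \det (gram g e' d') = 0.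
Proof.
elim: b => [|b IHb] minor0.
  case: (classic (exists (e : 'I_0 -> A) (d : 'I_0 -> A'), true)) => [[e [d _]]|no].
    by exists 0%N, e, d; split=> //; rewrite det_mx00 oner_neq0.
  by case: no; exists (@no_ord A), (@no_ord A').
case: (classic (exists (e : 'I_b.+1 -> A) d, \det (gram g e d) != 0)) => [[e [d ed]]|no].
  by exists b.+1, e, d.
by apply: IHb => e d; apply/eqP/negPn/negP => ed; case: no; exists e, d.
Qed.

(** The minor bordered by [x] and [y] is the determinant of [G] times the Schur complement, which
    must therefore vanish. *)
Lemma bordered_minor (A A' : Type) (K : fieldType) (g : A -> A' -> K) n
    (e : 'I_n -> A) (d : 'I_n -> A') x y :
  gram g e d \in unitmx ->
  (forall (e' : 'I_n.+1 -> A) d', \det (gram g e' d') = 0) ->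
  g x y = ((\row_k g x (d k)) *m invmx (gram g e d) *m (\col_l g (e l) y)) 0 0.
Proof.
set G := gram g e d => Gu minor0.
set r := \row_k _; set c := \col_l _.
pose ext (T : Type) (x : T) (e : 'I_n -> T) (i : 'I_n.+1) : T :=
  match @split 1 n i with inl _ => x | inr j => e j end.
have := minor0 (ext A x e) (ext A' y d).
have -> : gram g (ext A x e) (ext A' y d) = block_mx (g x y)%:M r c G :> 'M_(1 + n).
  apply/matrixP => i j; rewrite mxE /ext.
  case: (split i) (splitK i) => i' <-; case: (split j) (splitK j) => j' <-.
  - by rewrite block_mxEul !ord1 mxE eqxx.
  - by rewrite block_mxEur mxE.
  - by rewrite block_mxEdl mxE.
  - by rewrite block_mxEdr mxE.
have -> : block_mx (g x y)%:M r c G = block_mx 1%:M (r *m invmx G) 0 1%:M *m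
    block_mx ((g x y)%:M - r *m invmx G *m c) 0 c G :> 'M_(1 + n).
  rewrite mulmx_block !mul1mx !mul0mx !add0r subrK.
  by rewrite mulmxKV.
rewrite det_mulmx (@det_ublock _ 1 n) !det1 !mul1r (@det_lblock _ 1 n) => /eqP.
rewrite mulf_eq0 [X in _ || X](negPf _) ?orbF; last first.
  by rewrite -unitfE -unitmxE.
by rewrite det_mx11 !mxE eqxx subr_eq0 => /eqP.
Qed.

Lemma minor_factor (A A' : Type) (K : fieldType) (g : A -> A' -> K) (B : finType) n
    (e : 'I_n -> A) (d : 'I_n -> A') (al be : 'I_n -> B -> K) :
  (#|B| < n)%N -> (forall i j, g (e i) (d j) = \sum_b al i b * be j b) ->
  \det (gram g e d) = 0.
Proof.
move=> ltBn gE.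
have -> : gram g e d = (\matrix_(i < n, j < #|B|) al i (enum_val j)) *m
    (\matrix_(i < #|B|, j < n) be j (enum_val i)).
  apply/matrixP => i j; rewrite !mxE gE (reindex (@enum_val B predT)) /=; last first.
    by exists enum_rank => b _; rewrite ?enum_valK ?enum_rankK.
  by apply: eq_bigr => k _; rewrite !mxE.
apply/eqP; rewrite -[_ == 0]negbK -unitfE -unitmxE -row_full_unit /row_full.
rewrite neq_ltn; apply/orP; left; apply: leq_ltn_trans ltBn.
exact: leq_trans (mxrankM_maxl _ _) (rank_leq_col _).
Qed.

(** * Linear extension to combinations of diagrams *)

Section LinearExtension.
Variables (K : fieldType) (A : choiceType) (V : lmodType K) (f : A -> V).

Definition lext (x : {malg K[A]}) : V := \sum_(k <- msupp x) x@_k *: f k.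

Lemma lextEw (d : {fset A}) x : (msupp x `<=` d)%fset ->
  lext x = \sum_(k <- d) x@_k *: f k.
Proof.
move=> le; rewrite /lext (big_fset_incl _ le) // => k _ /mcoeff_outdom ->.
by rewrite scale0r.
Qed.

Lemma lext_is_linear : linear lext.
Proof.
move=> c x y; pose d := (msupp x `|` msupp y)%fset.
rewrite (@lextEw d (c *: x + y)); last first.
  apply: (fsubset_trans (msuppD_le _ _)); apply: fsetSU; exact: msuppZ_le.
rewrite (@lextEw d x) ?fsubsetUl // (@lextEw d y) ?fsubsetUr //.
rewrite scaler_sumr -big_split /=; apply: eq_bigr => k _.
by rewrite mcoeffD mcoeffZ scalerDl scalerA.
Qed.

HB.instance Definition _ := GRing.isLinear.Build K {malg K[A]} V _ lext lext_is_linear.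

Lemma lextU k : lext << k >> = f k.
Proof. by rewrite /lext msuppU oner_eq0 big_seq_fset1 mcoeffUU scale1r. Qed.

Lemma lextUc c k : lext << c *g k >> = c *: f k.
Proof.
rewrite /lext msuppU; case: eqP => [->|_]; first by rewrite big_seq_fset0 scale0r.
by rewrite big_seq_fset1 mcoeffUU.
Qed.

End LinearExtension.

Section LinearExtension2.
Variables (K : fieldType) (A : choiceType) (V : lmodType K).

Lemma lext_unique (g : {linear {malg K[A]} -> V}) x : g x = lext (fun k => g << k >>) x.
Proof.
rewrite {1}[x]monalgE linear_sum; apply: eq_bigr => k _; rewrite -linearZ /=; congr (g _).
by apply/malgP => k'; rewrite mcoeffZ !mcoeffU; case: eqP => _;
  rewrite ?mulr1n ?mulr0n ?mulr1 ?mulr0.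
Qed.

Lemma lext_lin_ext (B : choiceType) (op : A -> B) (f : B -> V) x :
  lext f (lin_ext op x) = lext (f \o op) x.
Proof. by rewrite /lin_ext linear_sum; apply: eq_bigr => k _; rewrite /= lextUc. Qed.

Lemma lext_bilin_ext (B C : choiceType) (op : A -> B -> C) (f : C -> V) x (y : {malg K[B]}) :
  lext f (bilin_ext op x y) = lext (fun a => lext (fun b => f (op a b)) y) x.
Proof.
rewrite /bilin_ext linear_sum; apply: eq_bigr => a _; rewrite linear_sum /lext scaler_sumr.
by apply: eq_bigr => b _; rewrite /= lextUc scalerA.
Qed.

Lemma eq_lext (f g : A -> V) : f =1 g -> lext f =1 lext g.
Proof. by move=> fg x; apply: eq_bigr => k _; rewrite fg. Qed.
End LinearExtension2.

Lemma lextC (K : fieldType) (A B : choiceType) (V : lmodType K) (f : A -> B -> V)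
    (x : {malg K[A]}) (y : {malg K[B]}) :
  lext (fun a => lext (f a) y) x = lext (fun b => lext (f^~ b) x) y.
Proof.
rewrite /lext; under eq_bigr do rewrite scaler_sumr; rewrite exchange_big.
by apply: eq_bigr => b _; rewrite scaler_sumr; apply: eq_bigr => a _; rewrite !scalerA mulrC.
Qed.

(** * Arrows between finitely many objects *)

Section Arrows.
Variables (r : nat) (ty : 'I_r -> nat * nat).
Variables (L : finType) (B : L -> nat * nat).

(* The arrows between the objects B i, with an absorbing element for undefined composites. *)
Definition arr := option {ij : L * L & hom0 (dclass ty) (B ij.2) (B ij.1)}.

Definition mkarr i j (E : hom0 (dclass ty) (B j) (B i)) : arr :=
  Some (existT (fun ij : L * L => hom0 (dclass ty) (B ij.2) (B ij.1)) (i, j) E).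

Definition arr_comp (x y : arr) : arr :=
  match x, y with
  | Some (existT (i, j) E), Some (existT (j', k) D) =>
    match j' =P j with
    | ReflectT e => mkarr (comp0_class E (ecast z (hom0 (dclass ty) (B k) (B z)) e D))
    | ReflectF _ => None
    end
  | _, _ => None
  end.

Definition arr_trace (T : nmodType) (g : dclass ty 0 0 -> T) (x : arr) : T :=
  match x with
  | Some (existT (i, j) E) =>
    match i =P j with
    | ReflectT e => g (@trace0_class _ _ (B j) (ecast z (hom0 (dclass ty) (B j) (B z)) e E))
    | ReflectF _ => 0
    end
  | _ => 0
  end.

Local Arguments arr_comp : simpl never.
Local Arguments arr_trace : simpl never.

Lemma arr_compE i j k (E : hom0 (dclass ty) (B j) (B i)) (D : hom0 (dclass ty) (B k) (B j)) :
  arr_comp (mkarr E) (mkarr D) = mkarr (comp0_class E D).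
Proof. by rewrite /arr_comp /mkarr; case: eqP => // e; rewrite eq_axiomK. Qed.

Lemma arr_comp_ne i j j' k (E : hom0 (dclass ty) (B j) (B i)) (D : hom0 (dclass ty) (B k) (B j')) :
  j != j' -> arr_comp (mkarr E) (mkarr D) = None.
Proof. by rewrite eq_sym /arr_comp /mkarr; case: eqP. Qed.

Lemma arr_traceE (T : nmodType) (g : _ -> T) i (E : hom0 (dclass ty) (B i) (B i)) :
  arr_trace g (mkarr E) = g (trace0_class E).
Proof. by rewrite /arr_trace /mkarr; case: eqP => // e; rewrite eq_axiomK. Qed.

Lemma arr_trace_ne (T : nmodType) (g : _ -> T) i j (E : hom0 (dclass ty) (B j) (B i)) :
  i != j -> arr_trace g (mkarr E) = 0.
Proof. by rewrite /arr_trace /mkarr; case: eqP. Qed.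

Lemma arr_compx0 x : arr_comp x None = None.
Proof. by case: x => // -[[i j] E]. Qed.

Lemma arrP (P : arr -> Prop) : P None -> (forall i j E, P (@mkarr i j E)) -> forall x, P x.
Proof. by move=> P0 P1 [[[i j] E]|] //; apply: P1. Qed.

Lemma arr_compA x y z : arr_comp x (arr_comp y z) = arr_comp (arr_comp x y) z.
Proof.
elim/arrP: x => // i j E; elim/arrP: z => [|k l F]; first by rewrite !arr_compx0.
elim/arrP: y => [|j' k' D]; first by rewrite arr_compx0.
have [ej|nj] := eqVneq j j'; last first.
  rewrite (arr_comp_ne _ _ nj); have [ek|nk] := eqVneq k' k; last by rewrite (arr_comp_ne _ _ nk).
  by subst k'; rewrite arr_compE arr_comp_ne.
subst j'; rewrite arr_compE; have [ek|nk] := eqVneq k' k.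
  by subst k'; rewrite !arr_compE comp0A.
by rewrite !(arr_comp_ne _ _ nk).
Qed.

Lemma arr_traceC (T : nmodType) (g : _ -> T) x y : arr_trace g (arr_comp x y) = arr_trace g
    (arr_comp y x).
Proof.
elim/arrP: x => [|i j E]; first by rewrite arr_compx0.
elim/arrP: y => [|j' i' D]; first by rewrite arr_compx0.
have [ej|nj] := eqVneq j j'; [subst j'|rewrite (arr_comp_ne _ _ nj)];
  (have [ei|ni] := eqVneq i' i; [subst i'|rewrite ?(arr_comp_ne _ _ ni)]) => //.
- by rewrite !arr_compE !arr_traceE trace0C.
- by rewrite arr_compE arr_trace_ne 1?eq_sym.
- by rewrite arr_compE arr_trace_ne 1?eq_sym.
Qed.

Definition arr_id l : arr := mkarr (id0_class ty (B l)).

Lemma arr_comp1 i j (E : hom0 (dclass ty) (B j) (B i)) : arr_comp (mkarr E) (arr_id j) = mkarr E.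
Proof. by rewrite /arr_id arr_compE comp0_id. Qed.

Lemma arr_trace1 (T : nmodType) (g : _ -> T) x : \sum_l arr_trace g (arr_comp x (arr_id l)) =
    arr_trace g x.
Proof.
elim/arrP: x => [|i j E]; first by rewrite big1.
rewrite (bigD1 j) // arr_comp1 big1 => [|l nl]; first exact: addr0.
by rewrite /arr_id arr_comp_ne // eq_sym.
Qed.

End Arrows.
Arguments arr_comp : simpl never.
Arguments arr_trace : simpl never.
Arguments mkarr : simpl never.

Definition twisted (K : fieldType) (r : nat) (ty : 'I_r -> nat * nat)
    (g : dclass ty 0 0 -> K) (L : finType) (B : L -> nat * nat) : Prop :=
  twisted_rep (@arr_comp r ty L B) (arr_trace g).

Lemma lext_sum (K : fieldType) (A : choiceType) (V : lmodType K) (I : finType)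
    (f : I -> A -> V) x : lext (fun a => \sum_i f i a) x = \sum_i lext (f i) x.
Proof.
rewrite /lext; under eq_bigr do rewrite scaler_sumr.
by rewrite exchange_big.
Qed.

Lemma lext0 (K : fieldType) (A : choiceType) (V : lmodType K) (f : A -> V) x :
  (forall a, f a = 0) -> lext f x = 0.
Proof. by move=> f0; rewrite /lext big1 // => a _; rewrite f0 scaler0. Qed.

Lemma lext_linear (K : fieldType) (A : choiceType) (V V' : lmodType K)
    (h : {linear V -> V'}) (f : A -> V) x : h (lext f x) = lext (h \o f) x.
Proof. by rewrite linear_sum; apply: eq_bigr => a _; rewrite linearZ. Qed.

Section Uev.
Variables (K : fieldType) (r : nat) (ty : 'I_r -> nat * nat).
Variables (L : finType) (B : L -> nat * nat).
Local Notation arr := (arr ty B).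
Local Notation lhom := (forall i j : L, hom0 (Con K ty) (B j) (B i)).

Definition hom_eval (V : lmodType K) (f : arr -> V) (T : lhom) : V :=
  \sum_i \sum_j lext (fun d => f (@mkarr _ _ _ _ i j d)) (T i j).

Definition lcomp (G T : lhom) : lhom :=
  fun i k => \sum_j hom_comp0 (G i j) (T j k).

Lemma eq_hom_eval (V : lmodType K) (f g : arr -> V) T : f =1 g -> hom_eval f T = hom_eval g T.
Proof. by move=> fg; do 2 (apply: eq_bigr => ? _); apply: eq_lext => d. Qed.

Lemma hom_eval0 (V : lmodType K) (f : arr -> V) T : (forall x, f x = 0) -> hom_eval f T = 0.
Proof. by move=> f0; rewrite /hom_eval big1 // => i _; rewrite big1 // => j _; apply: lext0. Qed.

Lemma hom_eval_comp (V : lmodType K) (f : arr -> V) G T : f None = 0 ->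
  hom_eval f (lcomp G T) = hom_eval (fun x => hom_eval (fun y => f (arr_comp x y)) T) G.
Proof.
move=> f0; apply: eq_bigr => i _.
under eq_bigr => k _.
  rewrite linear_sum /=.
  under eq_bigr => j _ do rewrite lext_bilin_ext. over.
rewrite exchange_big; apply: eq_bigr => j _ /=.
rewrite -lext_sum; apply: eq_lext => a; rewrite /hom_eval [RHS](bigD1 j) //=
  [RHS]addrC [X in _ = X +
  _]big1 ?add0r => [|j' nj].
  by apply: eq_bigr => k _; apply: eq_lext => b; rewrite arr_compE.
by rewrite big1 // => k _; apply: lext0 => b; rewrite arr_comp_ne // eq_sym.
Qed.

Lemma hom_eval_linear (V V' : lmodType K) (h : {linear V -> V'}) (f : arr -> V) T :
  h (hom_eval f T) = hom_eval (h \o f) T.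
Proof.
rewrite linear_sum; apply: eq_bigr => i _; rewrite linear_sum.
by apply: eq_bigr => j _; apply: lext_linear.
Qed.

(** As in [cpow], the exponent is [k.+1]. *)
Fixpoint lpow (T : lhom) (k : nat) : lhom :=
  if k is k'.+1 then lcomp T (lpow T k') else T.

Variable chi : {scalar Con K ty 0 0}.
Let g (d : dclass ty 0 0) : K := chi << d >>.

Lemma chi_lext x : chi x = lext (g : _ -> K^o) x.
Proof. exact: (@lext_unique K _ K^o chi). Qed.

Lemma chi_trace (T : lhom) :
  chi (\sum_i hom_trace0 (T i i)) = hom_eval (arr_trace g : arr -> K^o) T.
Proof.
rewrite linear_sum; apply: eq_bigr => i _; rewrite (bigD1 i) //= addrC big1 ?add0r => [|j nj].
  by rewrite chi_lext lext_lin_ext; apply: (@eq_lext _ _ K^o) => d; rewrite arr_traceE.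
by apply: (@lext0 _ _ K^o) => d; rewrite arr_trace_ne // eq_sym.
Qed.

Lemma chi_pairing p q (x : Con K ty p q) (y : Con K ty q p) :
  chi (pairing x y) =
  lext (fun a => lext (fun b => g (trace_class (comp_class a b)) : K^o) y) x.
Proof. by rewrite chi_lext lext_lin_ext lext_bilin_ext. Qed.

Lemma hom_eval_arrow i j (F : hom0 (dclass ty) (B j) (B i)) (X : lhom) :
  hom_eval (fun y => arr_trace g (arr_comp (mkarr F) y) : K^o) X =
  lext (fun d => g (trace0_class (comp0_class F d)) : K^o) (X j i).
Proof.
rewrite /hom_eval (bigD1 j) //= (bigD1 i) //= [X in _ + X + _]big1 ?addr0; last first.
  move=> k nk; apply: (@lext0 _ _ K^o) => d; rewrite arr_compE arr_trace_ne // eq_sym //.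
rewrite [X in _ + X]big1 ?addr0 => [|j' nj].
  by apply: (@eq_lext _ _ K^o) => d; rewrite arr_compE arr_traceE.
by rewrite big1 // => k _; apply: (@lext0 _ _ K^o) => d; rewrite arr_comp_ne // eq_sym.
Qed.

(** Pairing an entry with a diagram is, up to the order of the ports, closing its composite with an
    arrow, by [swaps_pair]. *)
Lemma rad_arrow (X : lhom) :
  (forall i j, rad chi (X i j)) <->
  (forall x, hom_eval (fun y => arr_trace g (arr_comp x y) : K^o) X = 0).
Proof.
split=> [radX x|H j i y].
  elim/arrP: x => [|i j F].
    by apply: big1 => i _; apply: big1 => j _; apply: (@lext0 _ _ K^o).
  have [y /swaps_sym sy] := swaps_ex F.
  rewrite hom_eval_arrow -[RHS](radX j i << y >>) chi_pairing.
  by apply: (@eq_lext _ _ K^o) => d; rewrite lextU (swaps_pair d sy).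
rewrite chi_pairing lextC; apply: (@lext0 _ _ K^o) => b.
have [F sF] := swaps_ex b; rewrite -[RHS](H (mkarr F)) hom_eval_arrow.
by apply: (@eq_lext _ _ K^o) => d; rewrite (swaps_pair d sF).
Qed.

End Uev.

(** * Good characters and twisted functions *)

Section GoodTwisted.
Variables (K : fieldType) (r : nat) (ty : 'I_r -> nat * nat).

Lemma hom_comp0_0 X Y Z (x : hom0 (Con K ty) Y Z) :
  hom_comp0 x (0 : hom0 (Con K ty) X Y) = 0.
Proof.
rewrite /hom_comp0 /bilin_ext big1 // => a _.
by rewrite msupp0 big_seq_fset0.
Qed.

Lemma hom_comp0_id X Y (x : hom0 (Con K ty) X Y) :
  hom_comp0 x << id0_class ty X >> = x.
Proof.
rewrite [RHS]monalgE; apply: eq_bigr => a _.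
by rewrite msuppU oner_eq0 big_seq_fset1 mcoeffUU mulr1 comp0_id.
Qed.

Lemma ucomp_id B C (T : uhom K ty B C) i j : ucomp T (@uid K r ty B) i j = T i j.
Proof.
rewrite /ucomp (bigD1 j) //= big1 ?addr0 => [|k nk].
  rewrite /uid; case: eqP => // e; rewrite eq_axiomK /=; exact: hom_comp0_id.
rewrite /uid; case: eqP => [e|_]; last exact: hom_comp0_0.
by rewrite e eqxx in nk.
Qed.

Lemma upow_lpow (B : uobj) (T : uhom K ty B B) k i j :
  upow T k.+1 i j = lpow T k i j.
Proof.
elim: k i j => [|k IHk] i j; first exact: ucomp_id.
by apply: eq_bigr => m _; congr hom_comp0; apply: IHk.
Qed.

(** [R z] absorbs every [R x], so subtracting it preserves products, and [tr z = 0] preserves the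
    trace formula. Undefined composites may thus be assumed to act as 0. *)
Lemma twisted_rep0 (A : Type) (mul : A -> A -> A) (tr : A -> K) (z : A) :
  tr z = 0 -> (forall x, mul x z = z) -> (forall x, mul z x = z) ->
  twisted_rep mul tr -> exists n (R : A -> 'M[K]_n) (W : 'M[K]_n),
  [/\ forall x y, R (mul x y) = R x *m R y,
      forall x, R x *m W = W *m R x,
      forall x, tr x = \tr (R x *m W) & R z = 0].
Proof.
move=> trz xz zx [n [R [W [RM RW trR]]]]; exists n, (fun x => R x - R z), W; split.
- move=> x y; rewrite mulmxBl !mulmxBr -!RM xz zx zx subrr subr0 //.
- by move=> x; rewrite mulmxBl mulmxBr !RW.
- by move=> x; rewrite mulmxBl linearB /= -!trR trz subr0.
by rewrite subrr.
Qed.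

Variable chi : {scalar Con K ty 0 0}.
Let g (d : dclass ty 0 0) : K := chi << d >>.

Lemma twisted_nilpotent_trace (B : uobj) (T : uhom K ty B B) k :
  twisted g B -> (0 < k)%N -> negligible chi (upow T k) -> chi (utrace T) = 0.
Proof.
case: k => // k tw _ negT.
have [n [R [W [RM RW trR R0]]]] :=
  twisted_rep0 (z := None) erefl (@arr_compx0 _ _ _ _) (fun=> erefl)
  tw.
have uM G H : hom_eval R (lcomp G H) = hom_eval R G *m hom_eval R H.
  rewrite hom_eval_comp // -[RHS]/(mulmxr (hom_eval R H) (hom_eval R G)) hom_eval_linear.
  apply: eq_hom_eval => x; rewrite -[RHS]/(mulmx (R x) (hom_eval R H)) hom_eval_linear.
  by apply: eq_hom_eval => y; apply: RM.
have trU X : hom_eval (arr_trace g : _ -> K^o) X = \tr (hom_eval R X *m W).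
  rewrite -[RHS]/((mxtrace \o mulmxr W : {linear _ -> K^o}) (hom_eval R X)) hom_eval_linear.
  by apply: (@eq_hom_eval _ _ _ _ _ K^o) => x; rewrite /= -trR.
have uP m : hom_eval R (lpow T m) = hom_eval R T ^+ m.+1.
  by elim: m => [|m IHm] //=; rewrite uM IHm [RHS]exprS.
rewrite /utrace (chi_trace chi T) trU.
(* [R] need not kill a negligible power; only the traces of its composites vanish. The bound [k.+2]
   leaves a nonempty factor in front of the negligible power. *)
apply: (@mxtrace_eventually _ _ _ _ k.+2).
  rewrite -[LHS]/(mulmxr W (hom_eval R T)) -[RHS]/(mulmx W (hom_eval R T)) !hom_eval_linear.
  by apply: eq_hom_eval => x; apply: RW.
move=> m lekm; have -> : m = ((m - k.+2).+1 + k.+1)%N by rewrite addSnnS subnK.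
rewrite exprD -!uP -[_ * _]/(_ *m _) -uM -trU hom_eval_comp //.
apply: (@hom_eval0 _ _ _ _ _ K^o) => x.
by apply: (rad_arrow chi (lpow T k)).1 => i j; rewrite -upow_lpow; apply: negT.
Qed.

Lemma twisted_finite_codim p q :
  (forall (L : finType) (B : L -> nat * nat), twisted g B) ->
  exists n (e : 'I_n -> Con K ty p q),
    forall x, exists c : 'I_n -> K, rad chi (x - \sum_i c i *: e i).
Proof.
(* The diagrams with [q] inputs and [p] outputs are the arrows from the object [(q, p)] to the unit
   object. *)
move=> tw; pose B (b : bool) : nat * nat := if b then (q, p) else (0, 0)%N.
have [n [R [W [RM RW trR]]]] := tw _ B.
pose gg (a : dclass ty p q) (b : dclass ty q p) := g (trace_class (comp_class a b)).
pose ar (a : dclass ty p q) : arr ty B := @mkarr _ _ _ B false true a.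
have ggE b : exists V : 'M_n, forall a, gg a b = \tr (R (ar a) *m V).
  have [F sF] := @swaps_ex r ty q 0 0 p b.
  exists (W *m R (@mkarr _ _ _ B true false F)) => a.
  have := @swaps_pair r ty (B true) (B false) a F b sF; rewrite /gg => <-.
  rewrite -[LHS](@arr_traceE r ty _ B _ g true (@comp0_class r ty (q, p) (0, 0)%N (q, p) F a)).
  rewrite -(@arr_compE r ty _ B true false true) trR RM.
  by rewrite -mulmxA mxtrace_mulC -mulmxA.
(* The pairing factors through the [n * n] entries of a matrix, which bounds its rank. *)
have minor0 (e : 'I_(n * n).+1 -> _) d : \det (gram gg e d) = 0.
  have /fin_all_exists [V VP] : forall j, exists V : 'M_n, forall a,
    gg a (d j) = \tr (R (ar a) *m V).
    by move=> j; apply: ggE.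
  apply: (@minor_factor _ _ _ _ ('I_n * 'I_n)%type _ _ _ (fun i uv => R (ar (e i)) uv.1 uv.2)
    (fun j uv => V j uv.2 uv.1)).
    by rewrite card_prod card_ord.
  move=> i j; rewrite VP -(pair_bigA _ (fun u v => R (ar (e i)) u v * V j v u)) /=.
  by apply: eq_bigr => u _; rewrite mxE.
have [m [e [d [ed bord]]]] := maximal_minor minor0.
have Gu : gram gg e d \in unitmx by rewrite unitmxE unitfE.
exists m, (fun i => << e i >>) => x.
(* The coordinates of [a] in the frame [e], valid modulo the radical. *)
pose c a i := ((\row_k gg a (d k)) *m invmx (gram gg e d)) 0 i.
exists (fun i => lext (c ^~ i : _ -> K^o) x) => y.
rewrite chi_pairing lextC; apply: (@lext0 _ _ K^o) => b.
rewrite linearB /= [X in _ - X]linear_sum /=.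
under [X in _ - X]eq_bigr => i _ do rewrite linearZ /= lextU.
apply/eqP; rewrite subr_eq0; apply/eqP.
transitivity (lext (fun a => \sum_i (c a i * gg (e i) b : K^o)) x).
  apply: (@eq_lext _ _ K^o) => a.
  rewrite -[LHS]/(gg a b) (bordered_minor a b Gu bord) mxE.
  by apply: eq_bigr => i _; rewrite [X in _ * X]mxE.
rewrite lext_sum; apply: eq_bigr => i _.
rewrite -[RHS]/(_ * _) /lext mulr_suml; apply: eq_bigr => a _; exact: mulrA.
Qed.

Lemma twisted_good :
  (forall (L : finType) (B : L -> nat * nat), twisted g B) -> good chi.
Proof.
move=> tw; split=> [p q|B T k]; first exact: twisted_finite_codim.
exact: twisted_nilpotent_trace.
Qed.

Lemma rad_trace0 X Y (x : hom0 (Con K ty) X Y) (F : hom0 (dclass ty) Y X) :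
  rad chi x -> lext (fun d => g (@trace0_class _ _ X (comp0_class F d)) : K^o) x = 0.
Proof.
move=> radx; have [y /swaps_sym sy] := swaps_ex F.
rewrite -[RHS](radx << y >>) chi_pairing.
by apply: (@eq_lext _ _ K^o) => d; rewrite lextU (swaps_pair d sy).
Qed.

Section Converse.
Variables (L : finType) (B : L -> nat * nat).
Local Notation arr := (arr ty B).

Lemma rad_amul i j (x : hom0 (Con K ty) (B j) (B i)) (y : arr) : rad chi x ->
  lext (fun d => arr_trace g (arr_comp y (mkarr d)) : K^o) x = 0.
Proof.
move=> radx; elim/arrP: y => [|j' i' F]; first exact: (@lext0 _ _ K^o).
have [ei|ni] := eqVneq i i'; last first.
  by apply: (@lext0 _ _ K^o) => d; rewrite arr_comp_ne // eq_sym.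
subst i'; have [ej|nj] := eqVneq j' j; last first.
  by apply: (@lext0 _ _ K^o) => d; rewrite arr_compE arr_trace_ne.
subst j'; rewrite -[RHS](rad_trace0 F radx).
by apply: (@eq_lext _ _ K^o) => d; rewrite arr_compE arr_traceE.
Qed.

(** Modulo the radical an arrow is a combination of finitely many elements spanning its hom space;
    so the trace form has finite rank. *)
Lemma good_factor : good chi ->
  exists (D : finType) (be : D -> arr -> K), forall x, exists al : D -> K,
    forall y, arr_trace g (arr_comp x y) = \sum_b al b * be b y.
Proof.
move=> [fin _].
have /fin_all_exists [n] := fun ij : L * L =>
  fin ((B ij.1).1 + (B ij.2).2)%N ((B ij.1).2 + (B ij.2).1)%N.
move=> /fin_all_exists [e eP].
pose D := {ij : L * L & 'I_(n ij)}.
exists D, (fun b y => lext (fun d => arr_trace g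
    (arr_comp y (@mkarr _ _ _ B (tag b).1 (tag b).2 d)) : K^o)
  (e (tag b) (tagged b))).
elim/arrP => [|i j E]; first by exists (fun=> 0) => y; rewrite big1 // => b _; rewrite mul0r.
have [c cP] := eP (i, j) << E >>.
exists (fun b : D => match tag b =P (i, j) with
   | ReflectT eb => c (ecast z 'I_(n z) eb (tagged b)) | ReflectF _ => 0 end) => y.
pose F (ij : L * L) (k : 'I_(n ij)) : K := match ij =P (i, j) with
   | ReflectT eb => c (ecast z 'I_(n z) eb k) | ReflectF _ => 0 end *
   (lext (fun d => arr_trace g (arr_comp y (@mkarr _ _ _ B ij.1 ij.2 d)) : K^o) (e ij k)).
transitivity (\sum_ij \sum_k F ij k); last by rewrite sig_big_dep.
rewrite (bigD1 (i, j)) //= [X in _ + X]big1 ?addr0 => [|ij nij]; last first.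
  by apply: big1 => k _; rewrite /F; case: eqP => [eb|_]; [case/eqP: nij|rewrite mul0r].
have := rad_amul y cP; rewrite linearB /= [X in _ - X]linear_sum /= lextU => /subr0_eq E0.
rewrite arr_traceC [LHS]E0; apply: eq_bigr => k _.
by rewrite linearZ /F; case: eqP => // eb; rewrite eq_axiomK.
Qed.

Definition entry (x : arr) (i j : L) : hom0 (Con K ty) (B j) (B i) :=
  match x with
  | Some (existT ij E) =>
    match ij =P (i, j) with
    | ReflectT e => << ecast z (hom0 (dclass ty) (B z.2) (B z.1)) e E >>
    | ReflectF _ => 0
    end
  | None => 0
  end.

Lemma hom_eval_entry (V : lmodType K) (f : arr -> V) x :
  f None = 0 -> hom_eval f (entry x) = f x.
Proof.
move=> f0; elim/arrP: x => [|i j E].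
  by rewrite f0 /hom_eval big1 // => i _; rewrite big1 // => j _; rewrite /entry linear0.
rewrite /hom_eval (bigD1 i) //= (bigD1 j) //= [X in _ + X + _]big1 => [|j' nj].
  rewrite [X in _ + X]big1 => [|i' ni].
    by rewrite /entry /mkarr; case: eqP => // e; rewrite eq_axiomK /= lextU !addr0.
  rewrite big1 // => j' _; rewrite /entry /mkarr; case: eqP => [e|_]; last exact: linear0.
  by rewrite (congr1 fst e : i = i') eqxx in ni.
rewrite /entry /mkarr; case: eqP => [e|_]; last exact: linear0.
by rewrite (congr1 snd e : j = j') eqxx in nj.
Qed.

Definition comb_hom (s : comb K arr) i j : hom0 (Con K ty) (B j) (B i) :=
  \sum_(p <- s) p.1 *: (entry p.2 i j : Con K ty _ _).

Lemma hom_eval_comb (V : lmodType K) (f : arr -> V) s :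
  f None = 0 -> hom_eval f (comb_hom s) = comb_eval f s.
Proof.
move=> f0; transitivity (\sum_(p <- s) p.1 *: hom_eval f (entry p.2)); last first.
  by apply: eq_bigr => p _; rewrite hom_eval_entry.
rewrite /hom_eval; under eq_bigr => i _ do under eq_bigr => j _ do rewrite linear_sum /=.
under eq_bigr => i _ do rewrite exchange_big /=.
rewrite exchange_big; apply: eq_bigr => p _ /=; rewrite scaler_sumr.
by apply: eq_bigr => i _; rewrite scaler_sumr; apply: eq_bigr => j _; rewrite linearZ.
Qed.

Lemma hom_eval_cpow (V : lmodType K) (f : arr -> V) s k : f None = 0 ->
  hom_eval f (lpow (comb_hom s) k) = comb_eval f (cpow (@arr_comp r ty L B) s k).
Proof.
elim: k f => [|k IHk] f f0; first exact: hom_eval_comb.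
rewrite /= hom_eval_comp //.
transitivity (hom_eval (fun x => comb_eval (fun y => f (arr_comp x y))
    (cpow (@arr_comp r ty L B) s k)) (comb_hom s)).
  by apply: eq_hom_eval => x; rewrite IHk // arr_compx0.
rewrite hom_eval_comb; last by rewrite /comb_eval big1 // => p _; rewrite f0 scaler0.
rewrite /comb_eval big_allpairs_dep /=; apply: eq_bigr => p _; rewrite scaler_sumr.
by apply: eq_bigr => p' _; rewrite scalerA.
Qed.

(** A combination of arrows is an endomorphism of the direct sum of all [B i]; the hypothesis says
    that a power of it is negligible. The reindexing by ordinals only produces an object of the
    additive envelope. *)
Lemma good_nilpotent s k : good chi ->
  (forall x, comb_eval (fun y => arr_trace g (arr_comp y x) : K^o)
    (cpow (@arr_comp r ty L B) s k) = 0) ->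
  comb_eval (arr_trace g : arr -> K^o) s = 0.
Proof.
move=> [_ nil] sk; pose T := comb_hom s.
pose B' := UObj (fun a : 'I_#|L| => B (enum_val a)).
pose T' : uhom K ty B' B' := fun a b => T (enum_val a) (enum_val b).
have sum_enum (V : nmodType) (F : L -> V) : \sum_(a < #|L|) F (enum_val a) = \sum_i F i.
  rewrite [RHS](reindex (@enum_val L predT)) //.
  by exists enum_rank => i _; rewrite ?enum_valK ?enum_rankK.
have TT' m a b : lpow T' m a b = lpow T m (enum_val a) (enum_val b).
  elim: m a b => [|m IHm] a b //=; rewrite /lcomp -sum_enum.
  by apply: eq_bigr => c _; rewrite IHm.
rewrite -hom_eval_comb // -chi_trace -sum_enum -[RHS](nil B' T' k.+1 erefl) // => a b.
rewrite upow_lpow TT'; apply: (rad_arrow chi (lpow T k)).2 => x.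
by rewrite hom_eval_cpow ?arr_compx0 // -[RHS](sk x); apply: eq_bigr => p _; rewrite arr_traceC.
Qed.

Lemma good_twisted : [pchar K] =i pred0 -> good chi -> twisted g B.
Proof.
move=> charK gchi; have [D [be gP]] := good_factor gchi.
pose gg (x y : arr) := arr_trace g (arr_comp x y).
have minor0 (e : 'I_#|D|.+1 -> arr) d : \det (gram gg e d) = 0.
  have /fin_all_exists [al alP] := fun i => gP (e i).
  by apply: (@minor_factor _ _ _ _ D _ _ _ al (fun j b => be b (d j))) => // i j; apply: alP.
have [n [e [d [ed bord]]]] := maximal_minor minor0.
have Gu : gram gg e d \in unitmx by rewrite unitmxE unitfE.
have frame x y := bordered_minor x y Gu bord.
apply: (frame_twisted (@arr_compA _ _ _ _) (arr_traceC g) (arr_trace1 g) Gu frame).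
apply: (casimir_unit (@arr_compA _ _ _ _) (arr_traceC g) (arr_trace1 g) Gu frame charK) => s k.
exact: good_nilpotent.
Qed.

End Converse.
End GoodTwisted.

Lemma bilin_extU (K : fieldType) (A B C : choiceType) (op : A -> B -> C) a b :
  bilin_ext op << a >> << b >> = << op a b >> :> {malg K[C]}.
Proof. by rewrite /bilin_ext !msuppU oner_eq0 !big_seq_fset1 !mcoeffUU mulr1. Qed.

(** * Characters as multiplicative functions on diagrams; products *)

Section Product.
Variables (K : fieldType) (r : nat) (ty : 'I_r -> nat * nat).

Definition con_lin (g : dclass ty 0 0 -> K) (x : Con K ty 0 0) : K :=
  lext (g : _ -> K^o) x.

Fact con_lin_linear g : linear_for *%R (con_lin g).
Proof. by move=> c x y; rewrite /con_lin linearP. Qed.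

HB.instance Definition _ g :=
  GRing.isLinear.Build K (Con K ty 0 0) K *%R (con_lin g) (con_lin_linear g).

Definition juxt_morphism (g : dclass ty 0 0 -> K) : Prop :=
  g (id0_class ty (0, 0)%N) = 1 /\ forall a b : dclass ty 0 0, g (juxt_class a b) = g a * g b.

Lemma con_linU g d : con_lin g << d >> = g d.
Proof. exact: (@lextU _ _ K^o). Qed.

Lemma good_character_intro g (f : closed_connected ty -> K) :
  juxt_morphism g -> (forall (L : finType) (B : L -> nat * nat), twisted g B) ->
  (forall D, g (sval D) = f D) -> good_character f.
Proof.
move=> [g1 gM] tw gf; exists (con_lin g); split=> [||D]; last by rewrite /= con_linU.
  split=> [|x y]; first by rewrite /= con_linU.
  rewrite /= /con_lin /Umul lext_bilin_ext.
  transitivity (lext (fun a => g a * con_lin g y : K^o) x).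
    apply: (@eq_lext _ _ K^o) => a; rewrite /con_lin /lext mulr_sumr.
    by apply: eq_bigr => b _; rewrite gM -[_ *: _]/(_ * _) mulrCA.
  by rewrite /lext mulr_suml; apply: eq_bigr => a _; rewrite -[_ *: _]/(_ * _) mulrA.
apply: twisted_good => L B.
have [n [R [W [RM RW trR]]]] := tw L B; exists n, R, W; split=> // x; rewrite -trR.
by elim/arrP: x => // i j E; rewrite /arr_trace /=; case: eqP => // e; rewrite /= con_linU.
Qed.

Lemma good_character_elim (f : closed_connected ty -> K) : [pchar K] =i pred0 ->
  good_character f -> exists g, [/\ juxt_morphism g,
    forall (L : finType) (B : L -> nat * nat), twisted g B & forall D, g (sval D) = f D].
Proof.
move=> charK [chi [[chi1 chiM] gchi chif]]; exists (fun d => chi << d >>); split=> //.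
  split=> // a b; rewrite -chiM; congr (chi _).
  exact/esym/bilin_extU.
by move=> L B; apply: good_twisted.
Qed.

Lemma mxtrace_tens m n (A : 'M[K]_m) (B : 'M[K]_n) : \tr (A *t B) = \tr A * \tr B.
Proof.
rewrite /mxtrace mulr_suml; under [RHS]eq_bigr do rewrite mulr_sumr.
rewrite pair_bigA (reindex (@mxtens_index m n)) /=; last first.
  by exists (@mxtens_unindex m n) => i _; rewrite ?mxtens_indexK ?mxtens_unindexK.
by apply: eq_bigr => -[i j] _; rewrite tensmxE.
Qed.

Lemma twisted_mul (g1 g2 : dclass ty 0 0 -> K) (L : finType) (B : L -> nat * nat) :
  twisted g1 B -> twisted g2 B -> twisted (fun d : dclass ty 0 0 => g1 d * g2 d) B.
Proof.
move=> [n1 [R1 [W1 [RM1 RW1 tr1]]]] [n2 [R2 [W2 [RM2 RW2 tr2]]]].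
exists (n1 * n2)%N, (fun x => R1 x *t R2 x), (W1 *t W2); split.
- by move=> x y; rewrite RM1 RM2 tensmx_mul.
- by move=> x; rewrite !tensmx_mul RW1 RW2.
move=> x; rewrite tensmx_mul mxtrace_tens -tr1 -tr2.
elim/arrP: x => [|i j E]; first by rewrite mul0r.
by rewrite /arr_trace /=; case: eqP => // e; rewrite mul0r.
Qed.

Lemma juxt_morphism_mul (g1 g2 : dclass ty 0 0 -> K) : juxt_morphism g1 -> juxt_morphism g2 ->
  juxt_morphism (fun d => g1 d * g2 d).
Proof.
by move=> [g11 g1M] [g21 g2M]; split=> [|a b]; rewrite ?g11 ?g21 ?mulr1 // g1M g2M mulrACA.
Qed.

End Product.

(** * Sums *)

Section ConnectedSub.
Variables (r : nat) (ty : 'I_r -> nat * nat).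
Local Notation boxes := (boxes ty).

Definition sub_full (b : boxes) (P : bnode b -> bool) (PT : forall n, P n) : sub_boxes b P.
Proof.
refine (@SubBoxes _ _ b b P id id id _ _ _ _ _ _ _ _ _) => //.
- by move=> n; split=> // _; exists n.
- by move=> s; split=> [_|_]; [exists s|apply: PT].
- by move=> s; split=> [_|_]; [exists s|apply: PT].
- by move=> s; apply: surjective_pairing.
- by move=> s; apply: surjective_pairing.
Defined.

Definition sub_empty (b b0 : boxes) (P : bnode b -> bool) (PF : forall n, ~~ P n)
  (no : bnode b0 -> False) : sub_boxes b0 P.
Proof.
pose no_o s := no (@boutp _ _ b0 s).1; pose no_i s := no (@binp _ _ b0 s).1.
refine (@SubBoxes _ _ b0 b P (fun n => False_rect _ (no n))
  (fun s => False_rect _ (no_o s)) (fun s => False_rect _ (no_i s)) _ _ _ _ _ _ _ _ _).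
- by move=> n; case: (no n).
- by move=> s; case: (no_o s).
- by move=> s; case: (no_i s).
- by move=> n; split=> [Pn|[s _]]; [have := PF n; rewrite Pn|case: (no s)].
- by move=> n; split=> [Pn|[s _]]; [have := PF (boutp n).1; rewrite [P _]Pn|case: (no_o s)].
- by move=> n; split=> [Pn|[s _]]; [have := PF (binp n).1; rewrite [P _]Pn|case: (no_i s)].
- by move=> n; case: (no n).
- by move=> s; case: (no_o s).
- by move=> s; case: (no_i s).
Qed.

Lemma csub_full (b : boxes) (t : str b 0 0) k col l d :
  pres d t l -> (forall n, k n == col) -> csub t k col l = Some d.
Proof.
move=> pd kc; apply/csubP; exists b, (sub_full kc), t; split=> // z.
by rewrite !sum_map_id.
Qed.

Lemma csub_empty (b : boxes) (t : str b 0 0) k col :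
  (forall n, k n != col) -> csub t k col 0 = Some (id0_class ty (0, 0)%N : dclass ty 0 0).
Proof.
move=> kc; apply/csubP; have no : bnode (dboxes (did0 ty (0, 0)%N)) -> False by case.
exists (dboxes (did0 ty (0, 0)%N)), (sub_empty kc no), (dgstr (did0 ty (0, 0)%N)); split.
  exact: (pres_self (did0 ty (0, 0)%N)).
by case=> [[]|s] //; case: (no (boutp s).1).
Qed.

Lemma cnt_all n (S : 'I_n -> bool) c : (forall i, S i == c) -> cnt c S = n.
Proof. by move=> Sc; rewrite -[RHS]card_ord; apply: eq_card => i; rewrite !inE Sc. Qed.

Lemma cnt_none n (S : 'I_n -> bool) c : (forall i, S i != c) -> cnt c S = 0%N.
Proof. by move=> Sc; apply: eq_card0 => i; rewrite !inE; apply/negbTE. Qed.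

(** Adjacent boxes have the same colour, and boxes never coexist with loops in a connected
    diagram. *)
Lemma connected_mono (D : diagram ty 0 0) (k : 'I_(dgsize D) -> bool)
    (S : 'I_(dgloops D) -> bool) : connected D ->
  compat (dgstr D : str (dboxes D) 0 0) (fun=> true) (out_colour (k : bnode (dboxes D) -> bool))
    (fun=> true) (in_colour (k : bnode (dboxes D) -> bool)) ->
  exists c, (forall n, k n = c) /\ (forall i, S i = c).
Proof.
have no m (n : 'I_m) : m = 0%N -> False by case: m n => [[]|].
have one m (i j : 'I_m) : m = 1%N -> i = j by move=> e; subst m; rewrite !ord1.
rewrite /connected; case: eqP => [e0 /eqP e1|e0 /andP[/eqP e1 /forallP conn]] ct.
  have l0 : (0 < dgloops D)%N by rewrite e1.
  exists (S (Ordinal l0)); split=> n; first by case: (no _ n e0).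
  by congr S; apply: one.
have l0 : (0 < dgsize D)%N by case: (dgsize D) e0.
exists (k (Ordinal l0)); split=> n; last by case: (no _ n e1).
have adj c c' : adjacent c c' -> k c = k c'.
  move=> /existsP[x /existsP[y /and3P[/eqP <- /eqP <- /eqP e]]].
  by have := ct (inr x); rewrite e.
have /forallP /(_ n) /connectP [s] := conn (Ordinal l0).
elim: s (Ordinal l0) => [|c s IHs] a /= => [_ -> //|/andP[ac ps] ls].
rewrite (IHs c ps ls); by case/orP: ac => /adj.
Qed.

End ConnectedSub.

Section Sum.
Variables (K : fieldType) (r : nat) (ty : 'I_r -> nat * nat).
Local Notation boxes := (boxes ty).
Implicit Types g : dclass ty 0 0 -> K.

Definition opair g1 g2 (a b : option (dclass ty 0 0)) : K := oapp g1 0 a * oapp g2 0 b.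

Lemma eq_tagged (I : eqType) (T : I -> Type) i (a b : T i) : Tagged T a = Tagged T b -> a = b.
Proof. by move/(congr1 (tagged_as (Tagged T a))); rewrite !tagged_asE. Qed.

(** The convolution of [g1] and [g2] for the coproduct that splits a diagram into two parts.
    Connected diagrams are primitive for it, which is why convolution adds values there. *)
Definition gsum g1 g2 (d : dclass ty 0 0) : K :=
  closed_split (opair g1 g2) (dgstr (repr d) : str (dboxes (repr d)) 0 0) (dgloops (repr d)).

Lemma gsum_pres g1 g2 d (b : boxes) (t : str b 0 0) l :
  pres d t l -> gsum g1 g2 d = closed_split (opair g1 g2) t l.
Proof. by move=> pd; apply: closed_split_pres (pres_repr d) pd. Qed.

Lemma opair0l g1 g2 a : opair g1 g2 None a = 0. Proof. exact: mul0r. Qed.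
Lemma opair0r g1 g2 a : opair g1 g2 a None = 0. Proof. exact: mulr0. Qed.

Lemma gsum_juxt g1 g2 (a b : dclass ty 0 0) : juxt_morphism g1 -> juxt_morphism g2 ->
  gsum g1 g2 (juxt_class a b) = gsum g1 g2 a * gsum g1 g2 b.
Proof.
move=> [_ M1] [_ M2]; have pa := pres_repr a; have pb := pres_repr b.
rewrite (gsum_pres g1 g2 (pres_juxt pa pb)) closed_split_juxt; first last.
- exact: pres_bij pb.
- exact: pres_bij pa.
- exact: opair0r.
- exact: opair0l.
rewrite /gsum /closed_split mulr_suml; apply: eq_bigr => k _.
rewrite mulr_suml; apply: eq_bigr => S _; rewrite mulr_sumr; apply: eq_bigr => k' _.
rewrite mulr_sumr; apply: eq_bigr => S' _.
case: (csub _ k true _) => [a1|]; last by rewrite !opair0l mul0r.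
case: (csub _ k' true _) => [a1'|]; last by rewrite !opair0l mulr0.
case: (csub _ k false _) => [a0|]; last by rewrite !opair0r mul0r.
case: (csub _ k' false _) => [a0'|]; last by rewrite !opair0r mulr0.
by rewrite /opair /= M1 M2 mulrACA.
Qed.

Lemma juxt_morphism_gsum g1 g2 : juxt_morphism g1 -> juxt_morphism g2 ->
  juxt_morphism (gsum g1 g2).
Proof.
move=> M1 M2; split; last by move=> a b; apply: gsum_juxt.
have := pres_self (did0 ty (0, 0)%N); set D := did0 ty (0, 0)%N => pD.
rewrite (gsum_pres g1 g2 pD) /closed_split (big_pred1 [ffun=> true]) => [|k]; last first.
  by apply/esym/eqP/ffunP => -[].
rewrite (big_pred1 [ffun=> true]) => [|S]; last by apply/esym/eqP/ffunP => -[].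
by rewrite !cnt_none ?csub_empty; try (by case); rewrite /opair /= M1.1 M2.1 mulr1.
Qed.

Lemma gsum_connected g1 g2 (D : dclass ty 0 0) : juxt_morphism g1 -> juxt_morphism g2 ->
  connected (repr D) -> gsum g1 g2 D = g1 D + g2 D.
Proof.
move=> [M1 _] [M2 _] cD; have pD := pres_repr D.
rewrite /gsum /closed_split pair_bigA /=.
pose T c : {ffun 'I_(dgsize (repr D)) -> bool} * {ffun 'I_(dgloops (repr D)) -> bool} :=
  ([ffun=> c], [ffun=> c]).
(* A connected diagram has a box or a loop, so that its two trivial splittings differ. *)
have nT : T true != T false.
  apply/eqP => -[/ffunP e1 /ffunP e2]; move: cD; rewrite /connected.
  case: eqP => [e0 /eqP el|ne _].
    have l0 : (0 < dgloops (repr D))%N by rewrite el.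
    by have := e2 (Ordinal l0); rewrite !ffunE.
  have l0 : (0 < dgsize (repr D))%N by case: (dgsize (repr D)) ne.
  by have := e1 (Ordinal l0); rewrite !ffunE.
rewrite (bigD1 (T true)) //= (bigD1 (T false)) 1?eq_sym //= [X in _ + (_ + X)]big1 ?addr0.
  congr (_ + _).
    rewrite cnt_all ?cnt_none => [|i|i]; rewrite ?ffunE //.
    by rewrite (csub_full pD) ?csub_empty /opair /= ?M2 ?mulr1 // => n; rewrite ffunE.
  rewrite cnt_none ?cnt_all => [|i|i]; rewrite ?ffunE //.
  by rewrite (csub_full pD) ?csub_empty /opair /= ?M1 ?mul1r // => n; rewrite ffunE.
move=> [k S] /andP[n1 n2]; apply/eqP; apply: contraNT n2.
move=> /(Phi_neq0 (opair0l g1 g2) (opair0r g1 g2)) [h1 h0].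
have [c [kc Sc]] := connected_mono S cD (csub_compat (fun=> true) (fun=> true) h1 h0).
have e : (k, S) = T c by congr (_, _); apply/ffunP => i; rewrite ffunE ?kc ?Sc.
by move: n1; rewrite e; case: (c) => //; rewrite eqxx.
Qed.

Section Twist.
Variables (L : finType) (B : L -> nat * nat).

Definition portcol (X : nat * nat) : finType :=
  ({ffun 'I_X.1 -> bool} * {ffun 'I_X.2 -> bool})%type.
Definition pcol X (a : portcol X) : colouring X := (fun_of_fin a.1, fun_of_fin a.2).
(** Like a tensor power of a direct sum of two spaces, each object has one summand per colouring of
    its ports; [colobj c] is the tensor factor of colour [c] in it. *)
Definition colidx : finType := {i : L & portcol (B i)}.
Definition colobj (c : bool) (x : colidx) : nat * nat := obj c (pcol (tagged x)).

Definition oarr (c : bool) i j (a : portcol (B i)) (b : portcol (B j))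
    (o : option (hom0 (dclass ty) (obj c (pcol b)) (obj c (pcol a)))) : arr ty (colobj c) :=
  if o is Some d then @mkarr _ ty _ (colobj c) (Tagged (fun i => portcol (B i)) a) (Tagged (fun i
    => portcol (B i)) b) d else None.

Lemma oarr_comp c i j k (a : portcol (B i)) (b : portcol (B j)) (d : portcol (B k))
    (o : option (hom0 (dclass ty) (obj c (pcol b)) (obj c (pcol a))))
    (o' : option (hom0 (dclass ty) (obj c (pcol d)) (obj c (pcol b)))) :
  arr_comp (oarr o) (oarr o') = oarr (ocomp o o').
Proof.
case: o o' => [e|] [e'|] //=; exact: (@arr_compE _ _ _ (colobj c)).
Qed.

Lemma oarr_ne c i j j' k (a : portcol (B i)) (b : portcol (B j)) (b' : portcol (B j')) (d :
  portcol (B k))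
    (o : option (hom0 (dclass ty) (obj c (pcol b)) (obj c (pcol a))))
    (o' : option (hom0 (dclass ty) (obj c (pcol d)) (obj c (pcol b')))) :
  (Tagged (fun i => portcol (B i)) b : colidx) != (Tagged (fun i => portcol (B i)) b' : colidx) ->
  arr_comp (oarr o) (oarr o') = None.
Proof.
move=> ne; case: o o' => [e|] [e'|] //=; exact: (@arr_comp_ne _ _ _ (colobj c)).
Qed.

(* Splitting an arrow also splits its ports, hence the sum over their colourings a and b. *)
Lemma twisted_gsum g1 g2 : twisted g1 (colobj true) -> twisted g2 (colobj false) ->
  twisted (gsum g1 g2) B.
Proof.
move=> tw1 tw2.
(* Undefined arrows are made to act as 0, so that incompatible splittings contribute nothing. *)
have [n1 [R1 [W1 [RM1 RW1 tr1 R10]]]] := twisted_rep0 (z := None) erefl (@arr_compx0 _ _ _ _)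
  (fun=> erefl) tw1.
have [n2 [R2 [W2 [RM2 RW2 tr2 R20]]]] := twisted_rep0 (z := None) erefl (@arr_compx0 _ _ _ _)
  (fun=> erefl) tw2.
pose Phi i j (a : portcol (B i)) (b : portcol (B j)) o1 o0 : 'M_(n1 * n2) :=
  R1 (@oarr true i j a b o1) *t R2 (@oarr false i j a b o0).
pose P i j (d : hom0 (dclass ty) (B j) (B i)) a b :=
  @pres_split r ty _ (B j) (B i) (pcol b) (pcol a) (Phi i j a b) (dboxes (repr d)) (dgstr (repr
    d)) (dgloops (repr d)).
(* A plain sum over the colourings replaces a block matrix: [R1] and [R2] already distinguish the
   coloured objects, so products with different middle colours vanish, as [PMne] shows. *)
pose Rh i j (d : hom0 (dclass ty) (B j) (B i)) := \sum_a \sum_b P i j d a b.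
pose R (x : arr ty B) : 'M_(n1 * n2) := if x is Some s then Rh (tag s).1 (tag s).2
  (tagged s) else 0.
have tens0l m n m' n' (A : 'M[K]_(m', n')) : (0 : 'M[K]_(m, n)) *t A = 0.
  by apply/matrixP => i j; rewrite !mxE mul0r.
have tens0r m n m' n' (A : 'M[K]_(m', n')) : A *t (0 : 'M[K]_(m, n)) = 0.
  by apply/matrixP => i j; rewrite !mxE mulr0.
have Phi0l i j a b o : Phi i j a b None o = 0 by rewrite /Phi /= R10 tens0l.
have Phi0r i j a b o : Phi i j a b o None = 0 by rewrite /Phi /= R20 tens0r.
have PM i j j' k E D a b b' c : @P i j E a b *m @P j' k D b' c =
    @pres_split r ty _ (B j) (B i) (pcol b) (pcol a) (fun e1 e0 =>
     @pres_split r ty _ (B k) (B j') (pcol c) (pcol b') (fun d1 d0 =>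
      Phi i j a b e1 e0 *m Phi j' k b' c d1 d0) (dboxes (repr D)) (dgstr (repr D))
        (dgloops (repr D)))
      (dboxes (repr E)) (dgstr (repr E)) (dgloops (repr E)).
  rewrite /P /pres_split mulmx_suml; apply: eq_bigr => kE _; rewrite mulmx_suml;
    apply: eq_bigr => SE _.
  by rewrite mulmx_sumr; apply: eq_bigr => kD _; rewrite mulmx_sumr; apply: eq_bigr => SD _.
have PMne i j j' k E D a b b' c :
    (Tagged (fun i => portcol (B i)) b : colidx) != (Tagged (fun i => portcol (B i)) b' : colidx) ->
    @P i j E a b *m @P j' k D b' c = 0.
  move=> ne; rewrite PM /pres_split; apply: big1 => kE _; apply: big1 => SE _.
  apply: big1 => kD _; apply: big1 => SD _.
  by rewrite /Phi tensmx_mul -RM1 -RM2 !(oarr_ne _ _ ne) R10 tens0l.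
have RhM i j j' k E D : Rh i j E *m Rh j' k D = \sum_a \sum_c \sum_b \sum_b' @P i j E a b
  *m @P j' k D b' c.
  rewrite /Rh mulmx_suml; apply: eq_bigr => a _; rewrite mulmx_suml.
  rewrite [RHS]exchange_big; apply: eq_bigr => b _; rewrite mulmx_sumr.
  by rewrite [RHS]exchange_big; apply: eq_bigr => b' _; rewrite mulmx_sumr.
exists (n1 * n2)%N, R, (W1 *t W2); split.
- elim/arrP => [y|i j E]; first by rewrite mul0mx.
  elim/arrP => [|j' k D]; first by rewrite arr_compx0 mulmx0.
  have [e|ne] := eqVneq j j'; last first.
    rewrite arr_comp_ne // [RHS]RhM [RHS]big1 // => a _; rewrite big1 // => c _.
    rewrite big1 // => b _; rewrite big1 // => b' _; apply: PMne.
    by apply: contraNneq ne => /(congr1 tag) /= ->.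
  subst j'; rewrite arr_compE [RHS]RhM [LHS]/(Rh i k _) /Rh.
  apply: eq_bigr => a _; apply: eq_bigr => c _.
  rewrite [LHS](@hom_split_comp r ty _ (B k) (B j) (B i) (pcol c) (pcol a) E D
    (Phi i k a c)) // pair_bigA /=.
  apply: eq_bigr => b _; rewrite (bigD1 b) //= [X in _ + X]big1 ?addr0 => [|b' nb]; last first.
    apply: PMne; apply: contraNneq nb => e; apply/eqP; symmetry; exact: (eq_tagged e).
  rewrite PM; apply: eq_bigr => kE _; apply: eq_bigr => SE _.
  apply: eq_bigr => kD _; apply: eq_bigr => SD _.
  by rewrite /Phi tensmx_mul -RM1 -RM2 !oarr_comp.
- elim/arrP => [|i j E]; first by rewrite mul0mx mulmx0.
  rewrite [R _]/(Rh i j E) /Rh /P /pres_split.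
  do 4 (rewrite mulmx_suml mulmx_sumr; apply: eq_bigr => ? _).
  by rewrite /Phi !tensmx_mul RW1 RW2.
elim/arrP => [|i j E]; first by rewrite mul0mx linear0.
have trP a b : \tr (@P i j E a b *m (W1 *t W2)) =
    @pres_split r ty _ (B j) (B i) (pcol b) (pcol a)
      (fun d1 d0 => arr_trace g1 (oarr d1) * arr_trace g2
      (oarr d0))
      (dboxes (repr E)) (dgstr (repr E)) (dgloops (repr E)).
  rewrite /P /pres_split; do 2 (rewrite mulmx_suml linear_sum; apply: eq_bigr => ? _).
  by rewrite /= /Phi tensmx_mul mxtrace_tens -tr1 -tr2.
have trR : \tr (R (mkarr E) *m (W1 *t W2)) = \sum_a \sum_b \tr (@P i j E a b *m (W1 *t W2)).
  rewrite [R _]/(Rh i j E) /Rh; do 2 (rewrite mulmx_suml linear_sum; apply: eq_bigr => ? _).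
  by [].
have ne0 c a b (o : option (hom0 (dclass ty) (obj c (pcol b)) (obj c (pcol a)))) g :
    (Tagged (fun i => portcol (B i)) a : colidx) != (Tagged (fun i => portcol (B i)) b : colidx) ->
    arr_trace g (@oarr c i j a b o) = 0.
  by move=> ne; case: o => [d|] //=; apply: (@arr_trace_ne _ _ _ (colobj c)).
have trP0 a b : (Tagged (fun i => portcol (B i)) a : colidx) != (Tagged (fun i => portcol (B i))
  b : colidx) ->
    \tr (@P i j E a b *m (W1 *t W2)) = 0.
  move=> ne; rewrite trP /pres_split; apply: big1 => k _; apply: big1 => S _.
  by rewrite ne0 // mul0r.
rewrite trR; have [e|ne] := eqVneq i j; last first.
  rewrite arr_trace_ne // big1 // => a _; rewrite big1 // => b _; apply: trP0.
  by apply: contraNneq ne => /(congr1 tag) /= ->.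
subst j; rewrite arr_traceE.
have [t' [k [c [pt c_onto cP]]]] := trace0_pres (pres_repr E).
(* Closing [E] sums over equal colours at both ends; these are the terms with [a = b], the only ones
   with a nonzero trace. *)
rewrite (gsum_pres g1 g2 pt) (pres_split_trace (opair0l g1 g2) (opair0r g1 g2) _
  (pres_bij (pres_repr E)) (pres_bij pt) c_onto cP).
rewrite pair_bigA; apply: eq_bigr => a _; rewrite [RHS](bigD1 a) //= [X in _ + X]big1 ?addr0 =>
  [|b nb].
  rewrite trP; apply: eq_bigr => kE _; apply: eq_bigr => SE _; rewrite /opair.
  congr (_ * _); case: (homsub _ _ _ _ _ _) => [d|] //=; symmetry;
    exact: (@arr_traceE _ _ _ (colobj _)).
by apply: trP0; apply: contraNneq nb => e; apply/eqP; symmetry; exact: (eq_tagged e).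
Qed.

End Twist.
End Sum.

(** * Constants *)

Lemma sum_two_colours (R : comPzRingType) m (a b : R) :
  \sum_(h : {ffun 'I_m -> bool}) a ^+ cnt true h * b ^+ cnt false h = (a + b) ^+ m.
Proof.
rewrite -[m in RHS]card_ord -prodr_const.
transitivity (\prod_(i < m) \sum_(c : bool) (if c then a else b)); last first.
  by apply: eq_bigr => i _; rewrite big_bool.
rewrite bigA_distr_bigA; apply: eq_bigr => h _.
rewrite (bigID (fun i => h i == true)) /=; congr (_ * _).
  rewrite (eq_bigr (fun=> a)) => [|i /eqP ->] //; rewrite prodr_const; congr (_ ^+ _).
rewrite (eq_bigr (fun=> b)) => [|i]; last by case: (h i).
rewrite prodr_const; congr (_ ^+ _); apply: eq_card => i; rewrite ?inE [RHS]unfold_in /=;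
  by case: (h i).
Qed.

(** * Components of closed diagrams and powers of a constant *)

Section Components.
Variables (r : nat) (ty : 'I_r -> nat * nat).
Local Notation boxes := (boxes ty).

Definition node_compat (b : boxes) (t : str b 0 0) (k : bnode b -> bool) : bool :=
  compatb t (fun=> true) (out_colour k) (fun=> true) (in_colour k).

Lemma node_compatP (b : boxes) (t : str b 0 0) (k : bnode b -> bool) :
  reflect (forall s u, t (inr s) = inr u -> k (boutp s).1 = k (binp u).1) (node_compat t k).
Proof.
apply: (iffP (compatP _ _ _ _ _)) => [ct s u e|H]; first by have := ct (inr s); rewrite e.
by case=> [[]//|s]; case e: (t _) => [[]//|u] /=; rewrite /in_colour -(H _ _ e).
Qed.

Lemma node_compatE (b : boxes) (t : str b 0 0) (k : bnode b -> bool) x y :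
  compat t x (out_colour k) y (in_colour k) <-> node_compat t k.
Proof.
have e0 (x' y' : 'I_0 -> bool) : x' = y' by apply: functional_extensionality => -[].
by rewrite (e0 x (fun=> true)) (e0 y (fun=> true)); split => /compatP.
Qed.

(** [c] sends each box to its connected component; the components are characterised by the
    colourings constant on them. *)
Definition labelling (b : boxes) (t : str b 0 0) m (c : bnode b -> 'I_m) : Prop :=
  (forall i, exists n, c n = i) /\
  forall k, node_compat t k <-> exists h, forall n, k n = h (c n).

Lemma labelling_ex (b : boxes) (t : str b 0 0) : exists m (c : bnode b -> 'I_m), labelling t c.
Proof.
pose e1 n n' := [exists s, exists u, [&& t (inr s) == inr u, (boutp s).1 == n & (binp u).1 == n']].
pose e n n' := e1 n n' || e1 n' n.
have es : connect_sym e by apply: sym_connect_sym => n n'; rewrite /e orbC.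
pose c n := enum_rank_in (roots_root es n : fingraph.root e n \in roots e) (fingraph.root e n).
have cK n : enum_val (c n) = fingraph.root e n by rewrite enum_rankK_in //; apply: (roots_root es).
exists #|roots e|, c; split=> [i|k].
  exists (enum_val i); apply: enum_val_inj; rewrite cK; apply/eqP.
  exact: (enum_valP i).
split=> [/node_compatP kc|[h kh]].
  have ke n n' : e1 n n' -> k n = k n'.
    by move=> /existsP[s /existsP[u /and3P[/eqP /kc E /eqP <- /eqP <-]]].
  exists (fun i => k (enum_val i)) => n; rewrite cK.
  have /connectP [s] := connect_root e n.
  move: (fingraph.root e n) => y; elim: s n => [|n1 s IHs] n /= => [_ -> //|/andP[en ps] ls].
  by rewrite -(IHs n1 ps ls); case/orP: en => /ke.
apply/node_compatP => s u su; rewrite !kh; congr h; apply: enum_val_inj; rewrite !cK.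
apply/eqP; rewrite root_connect //; apply: connect1; apply/orP; left.
by apply/existsP; exists s; apply/existsP; exists u; rewrite su !eqxx.
Qed.

Definition ncol (b : boxes) (t : str b 0 0) : nat :=
  #|[pred k : {ffun bnode b -> bool} | node_compat t k]|.

Lemma ncol_labelling (b : boxes) (t : str b 0 0) m (c : bnode b -> 'I_m) :
  labelling t c -> ncol t = (2 ^ m)%N.
Proof.
move=> [cs cP]; rewrite -card_bool -[RHS]mul1n.
apply: (@card_cycle_colours _ bool 'I_0 m (fun n => inl (c n)) (fun=> true) _ true).
  by move=> i; have [n <-] := cs i; exists n.
by move=> w; rewrite inE cP; split=> [H|[]].
Qed.

Lemma ncol_iso (b b' : boxes) (f : box_iso b b') (t : str b 0 0) (t' : str b' 0 0) :
  (forall z, t' (sum_map id (isoo f) z) = sum_map id (isoi f) (t z)) -> ncol t = ncol t'.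
Proof.
move=> tt'; have [g [[fg gf] [fog gof] [fig gif]]] := box_inv f.
pose F (k : {ffun bnode b' -> bool}) : {ffun bnode b -> bool} := [ffun n => k (f n)].
have Fi : injective F.
  by move=> k k' /ffunP e; apply/ffunP => n; have := e (g n); rewrite !ffunE gf.
rewrite /ncol -(card_imset _ Fi); apply: eq_card => k; rewrite inE; symmetry.
have tE s u : t (inr s) = inr u <-> t' (inr (isoo f s)) = inr (isoi f u).
  have := tt' (inr s) => /= ->; case: (t (inr s)) => [[]//|u'] /=; split=> [[->] //|[e]].
  by congr inr; apply: (can_inj fig).
apply/imsetP/idP => [[k' + ->]|/node_compatP kc].
  rewrite inE => /node_compatP kc; apply/node_compatP => s u /tE /kc.
  by rewrite isoop isoip !ffunE.
exists [ffun n => k (g n)]; last by apply/ffunP => n; rewrite !ffunE fg.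
rewrite inE; apply/node_compatP => s u; rewrite -(gof s) -(gif u) => /tE /kc.
by rewrite (isoop f) (isoip f) !ffunE /= !fg.
Qed.

(* Each connected class of boxes doubles the number of 2-colourings. *)
Definition num_comps (d : dclass ty 0 0) : nat :=
  (trunc_log 2 (ncol (dgstr (repr d) : str (dboxes (repr d)) 0 0)) + dgloops (repr d))%N.

Lemma num_comps_pres d (b : boxes) (t : str b 0 0) l m (c : bnode b -> 'I_m) :
  pres d t l -> labelling t c -> num_comps d = (m + l)%N.
Proof.
move=> pd lc; have [<- [f /ncol_iso e]] := pres_unique (pres_repr d) pd.
by rewrite /num_comps e (ncol_labelling lc) trunc_expnK.
Qed.

Lemma ext_out (b1 b : boxes) (P : bnode b -> bool) (u : sub_boxes b1 P) (w : bnode b1 -> bool) :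
  ext (so u) (out_colour w) = out_colour (ext (sn u) w).
Proof.
apply: functional_extensionality => s; apply/existsP/existsP => -[].
  by move=> s1 /andP[/eqP <- ws]; exists (boutp s1).1; rewrite soP eqxx.
move=> n /andP[/eqP en wn].
have [|s1 e] := proj1 (so_onto u s); first by apply/(sn_onto u); exists n.
exists s1; rewrite e eqxx /=; move: en; rewrite -e soP /out_colour /= => /(@sn_inj _ _ _ _ _ u) <-;
  exact: wn.
Qed.

Lemma ext_in (b1 b : boxes) (P : bnode b -> bool) (u : sub_boxes b1 P) (w : bnode b1 -> bool) :
  ext (si u) (in_colour w) = in_colour (ext (sn u) w).
Proof.
apply: functional_extensionality => s; apply/existsP/existsP => -[].
  by move=> s1 /andP[/eqP <- ws]; exists (binp s1).1; rewrite siP eqxx.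
move=> n /andP[/eqP en wn].
have [|s1 e] := proj1 (si_onto u s); first by apply/(sn_onto u); exists n.
exists s1; rewrite e eqxx /=; move: en; rewrite -e siP /in_colour /= => /(@sn_inj _ _ _ _ _ u) <-;
  exact: wn.
Qed.

(** Extended by [false], the colourings of the boxes of the part become those of the whole supported
    on the components of colour [col]; there are [2 ^ cnt col h] of them. *)
Lemma num_comps_sub (b : boxes) (t : str b 0 0) m (c : bnode b -> 'I_m) (k : bnode b -> bool)
    (h : 'I_m -> bool) col l d :
  labelling t c -> (forall n, k n = h (c n)) ->
  is_sub t (fun n => k n == col) id id l d -> num_comps d = (cnt col h + l)%N.
Proof.
move=> [cs cP] kh [b1 [u [t1 [p1 tt]]]].
have [m1 [c1 l1]] := labelling_ex t1; rewrite (num_comps_pres p1 l1); congr (_ + _)%N.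
apply: (@expnI 2) => //; rewrite -(ncol_labelling l1).
have kc : node_compat t k by apply/cP; exists h.
have ct : compat t (fun=> true) (out_colour (fun n => k n == col)) (fun=> true)
    (in_colour (fun n => k n ==
  col)).
  apply/(@node_compatE _ t (fun n => k n == col)); apply/cP; exists (fun i => h i == col) => n.
  by rewrite kh.
rewrite -[RHS]mul1n; apply: (@card_sub_cycle_colours _ _ 'I_0 m (fun n => inl (c n)) (sn u) h
   (fun=> true) (fun=> true) col _ true).
- exact: (@sn_inj _ _ _ _ _ u).
- by move=> n; rewrite -(sn_onto u n) kh.
- by move=> i; have [n <-] := cs i; exists n.
- by move=> _ [].
move=> w; rewrite inE.
have -> : node_compat t1 w = node_compat t (ext (sn u) w).
  have := is_sub_weight l (@inj_id _) (@inj_id _) (@onto_ord0 _) (@onto_ord0 _) ct tt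
    (fun=> true) (out_colour w) (fun=> true) (in_colour w).
  have e0 (f : 'I_0 -> bool) : f = fun=> true by apply: functional_extensionality => -[].
  rewrite /weight !(e0 (ext _ _)) ext_out ext_in -/(node_compat _ _) -/(node_compat _ _).
  by move/eqP; rewrite eqn_pmul2r ?expn_gt0 ?card_bool //; do 2 case: (node_compat _ _).
by rewrite cP; split=> [H|[]].
Qed.

Variable K : fieldType.

(** The multiplicative function with value [c] at every connected closed diagram. *)
Definition power_char (c : K) (d : dclass ty 0 0) : K := c ^+ num_comps d.

(** Only colourings constant on components contribute, so a splitting is a choice of one of two
    colours for each component and loop, and [sum_two_colours] adds them up. *)
Lemma gsum_chi a b d : gsum (power_char a) (power_char b) d = power_char (a + b) d.
Proof.
have [b0 [t [l pd]]] : exists (b0 : boxes) (t : str b0 0 0) l, pres d t l.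
  by do 3 eexists; apply: pres_repr.
rewrite (gsum_pres _ _ pd).
have [m [c lc]] := labelling_ex t.
rewrite /power_char (num_comps_pres pd lc) exprD -!sum_two_colours mulr_suml /closed_split.
transitivity (\sum_(k : {ffun bnode b0 -> bool} | node_compat t k)
  \sum_(S : {ffun 'I_l -> bool}) opair (power_char a) (power_char b)
      (csub t k true (cnt true S)) (csub t k false (cnt false S))).
  rewrite [RHS]big_mkcond; apply: eq_bigr => k _; case: ifP => // /negbT nk.
  apply: big1 => S _; apply/eqP; apply: contraNT nk.
  move=> /(Phi_neq0 (opair0l _ _) (opair0r _ _)) [h1 h0].
  by apply/(node_compatE t k (fun=> true) (fun=> true)); exact: (csub_compat _ _ h1 h0).
rewrite (@big_cycle_colours _ _ _ _ _ 'I_0 m (fun n => inl (c n)) (fun=> true)); first last.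
- by move=> w; rewrite lc.2.
- by move=> i; have [n <-] := lc.1 i; exists n.
apply: eq_bigr => h _; rewrite mulr_sumr; apply: eq_bigr => S _.
set k := [ffun n => _].
have kh n : k n = h (c n) by rewrite ffunE.
have kc : compat t (fun=> true) (out_colour k) (fun=> true) (in_colour k).
  by apply/node_compatE; apply/lc.2; exists h.
have sub col : exists2 d1, csub t k col (cnt col S) = Some d1 & num_comps d1 =
  (cnt col h + cnt col S)%N.
  have [d1 e1] := csub_ex col (cnt col S) (pres_bij pd) kc; exists d1 => //.
  by apply: (num_comps_sub lc kh); apply/csubP.
have [d1 -> e1] := sub true; have [d0 -> e0] := sub false.
by rewrite /opair /power_char /= e1 e0 !exprD mulrACA.
Qed.

End Components.

(** * How the number of components depends on the factors of a composite *)

Section PortColours.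
Variables (r : nat) (ty : 'I_r -> nat * nat).
Local Notation boxes := (boxes ty).

Definition port_count (p q : nat) (b : boxes) (t : str b p q) (x : 'I_q -> bool)
    (y : 'I_p -> bool) : nat :=
  #|[pred k : {ffun bnode b -> bool} | compatb t x (out_colour k) y (in_colour k)]|.

Lemma compat_xor (A B A' B' : Type) (t : A + B -> A' + B') x s y u x' s' y' u' :
  compat t x s y u -> compat t x' s' y' u' -> compat t (fun i => x i (+) x' i)
    (fun i => s i (+) s' i)
    (fun i => y i (+) y' i) (fun i => u i (+) u' i).
Proof.
by move=> c c' z; have := c z; have := c' z; case: (t z) => i /= -> ->; case: z.
Qed.

(* The compatible colourings form a coset of those vanishing on the ports. *)
Lemma port_count_coset p q (b : boxes) (t : str b p q) x y :
  port_count t x y =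
  ((port_count t x y != 0) * port_count t (fun=> false) (fun=> false))%N.
Proof.
have [-> //|] := eqVneq (port_count t x y) 0%N.
rewrite -lt0n => /card_gt0P [k0 /[!inE] /compatP ck0].
rewrite mul1n.
pose F (k : {ffun bnode b -> bool}) : {ffun bnode b -> bool} := [ffun n => k n (+) k0 n].
have FF : cancel F F by move=> k; apply/ffunP => n; rewrite !ffunE addbK.
rewrite /port_count -(card_imset _ (can_inj FF)); apply: eq_card => k.
have Fo k' : out_colour (F k') = fun s => out_colour k' s (+) out_colour k0 s.
  by apply: functional_extensionality => s; rewrite /out_colour ffunE.
have Fi k' : in_colour (F k') = fun s => in_colour k' s (+) in_colour k0 s.
  by apply: functional_extensionality => s; rewrite /in_colour ffunE.
have xx (T : Type) (a : T -> bool) : (fun i => a i (+) a i) = fun=> false.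
  by apply: functional_extensionality => i; rewrite addbb.
rewrite [RHS]inE; apply/imsetP/compatP => [[k' /[!inE] /compatP ck' ->]|ck].
  by have := compat_xor ck' ck0; rewrite -Fo -Fi !xx.
exists (F k); last by rewrite FF.
by rewrite inE; apply/compatP; rewrite Fo Fi; have := compat_xor ck ck0.
Qed.

Lemma num_comps_count d (b : boxes) (t : str b 0 0) l : pres d t l ->
  (2 ^ num_comps d = \sum_(k : {ffun bnode b -> bool})
     weight t l (fun=> true) (out_colour k) (fun=> true) (in_colour k))%N.
Proof.
move=> pd; have [m [c lc]] := labelling_ex t.
rewrite (num_comps_pres pd lc) expnD -(ncol_labelling lc) /ncol -sum1_card big_mkcond /=.
rewrite big_distrl; apply: eq_bigr => k _; rewrite /weight card_bool inE.
by case: (node_compat t k) (erefl : node_compat t k = compatb _ _ _ _ _) => <-.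
Qed.

Definition pcount X Y (E : hom0 (dclass ty) X Y) (a : portcol X) (b : portcol Y) : nat :=
  port_count (dgstr (repr E) : str (dboxes (repr E)) _ _) (ord_copair b.2 a.1) (ord_copair b.1 a.2).

(** A state sum: the 2-colourings of the closed composite, grouped by the colours of the ports at
    which it is glued. *)
Lemma num_comps_glue X Y (E : hom0 (dclass ty) Y X) (D : hom0 (dclass ty) X Y)
    (bE bD : boxes) (tE : str bE _ _) (tD : str bD _ _) lE lD : pres E tE lE -> pres D tD lD ->
  (2 ^ num_comps (trace0_class (comp0_class E D)) =
   \sum_(v : portcol X) \sum_(w : portcol Y)
     (port_count tE (ord_copair v.2 w.1) (ord_copair v.1 w.2) * 2 ^ lE) *
     (port_count tD (ord_copair w.2 v.1) (ord_copair w.1 v.2) * 2 ^ lD))%N.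
Proof.
move=> pE pD; have [t [l [p v]]] := comp0_val pE pD; have [t' [l' [p' v']]] := trace0_val p.
have count_weight_eq (p1 q1 : nat) (b : boxes) (t1 : str b p1 q1) l1 x y :
    (port_count t1 x y * 2 ^ l1 =
     \sum_(k : {ffun bnode b -> bool}) weight t1 l1 x (out_colour k) y (in_colour k))%N.
  rewrite /port_count -sum1_card big_mkcond /= big_distrl; apply: eq_bigr => k _.
  by rewrite /weight card_bool inE; case: compatb.
pose WE (a : portcol X) (w : portcol Y) (k : bnode bE -> bool) :=
  weight tE lE (ord_copair a.2 w.1) (out_colour k) (ord_copair a.1 w.2) (in_colour k).
pose WD (a : portcol X) (w : portcol Y) (k : bnode bD -> bool) :=
  weight tD lD (ord_copair w.2 a.1) (out_colour k) (ord_copair w.1 a.2) (in_colour k).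
rewrite (num_comps_count p').
rewrite (eq_bigr (fun k : {ffun bnode (badd bE bD) -> bool} =>
   \sum_(a : portcol X) \sum_(w : portcol Y) (WE a w (k \o inl) * WD a w (k \o inr))%N));
     last first.
  move=> k _; rewrite v' pair_bigA; apply: eq_bigr => a _.
  rewrite -[out_colour _]copair_eta -[in_colour _]copair_eta v !ord_copair_l
    !ord_copair_r pair_bigA.
  by apply: eq_bigr => w _.
rewrite exchange_big; apply: eq_bigr => a _; rewrite exchange_big; apply: eq_bigr => w _.
rewrite (@sum_ffun_sum _ _ addn _ _ _ (fun k k' => (WE a w k * WD a w k')%N)).
by rewrite !count_weight_eq big_distrlr.
Qed.

(** The colourings of the ports that extend to the boxes: a finite record of how [E] connects its
    ports. *)
Definition support X Y (E : hom0 (dclass ty) X Y) : {set portcol X * portcol Y} :=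
  [set ab | pcount E ab.1 ab.2 != 0%N].

Lemma pcountE X Y (E : hom0 (dclass ty) X Y) a b :
  pcount E a b = (((a, b) \in support E) * pcount E ([ffun=> false], [ffun=> false])
    ([ffun=> false], [ffun=> false]))%N.
Proof.
rewrite inE /=; rewrite {1}/pcount port_count_coset; congr (_ * _)%N.
have e (T : finType) : fun_of_fin [ffun=> false] = (fun _ : T => false).
  by apply: functional_extensionality => i; rewrite ffunE.
by rewrite /pcount /= !e; congr port_count; apply: functional_extensionality => i;
  rewrite /ord_copair; case: (split i).
Qed.

(* 2 ^ num_comps is a factor depending on E times a factor depending on D and the support of E. *)
Lemma num_comps_support X Y (E E' : hom0 (dclass ty) Y X) : support E = support E' ->
  exists m m', forall D : hom0 (dclass ty) X Y,
    (num_comps (trace0_class (comp0_class E D)) + m =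
      num_comps (trace0_class (comp0_class E' D)) + m')%N.
Proof.
move=> es; case: (classic (exists D0 : hom0 (dclass ty) X Y, true)) => [[D0 _]|no]; last first.
  by exists 0%N, 0%N => D; case: no; exists D.
exists (num_comps (trace0_class (comp0_class E' D0))),
    (num_comps (trace0_class (comp0_class E D0))) => D.
pose ma (F : hom0 (dclass ty) Y X) := (pcount F ([ffun=> false], [ffun=> false])
    ([ffun=> false], [ffun=> false]) *
  2 ^ dgloops (repr F))%N.
pose q D := (\sum_(v : portcol X) \sum_(w : portcol Y) ((w,
  v) \in support E) * (pcount D v w * 2 ^ dgloops (repr D)))%N.
have H F D1 : support F = support E ->
  (2 ^ num_comps (trace0_class (comp0_class F D1)) = ma F * q D1)%N.
  move=> sF; rewrite (num_comps_glue (pres_repr F) (pres_repr D1)) big_distrr;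
    apply: eq_bigr => v _.
  rewrite big_distrr; apply: eq_bigr => w _; rewrite -/(pcount F w v) -/(pcount D1 v w)
    pcountE sF /ma /=.
  by rewrite -!mulnA; case: (_ \in _); rewrite ?mul0n ?muln0 // !mul1n.
apply: (@expnI 2) => //; rewrite (expnD _ (num_comps _)) [RHS](expnD _ (num_comps _)) !H //.
by rewrite mulnACA [RHS]mulnACA [(ma E' * _)%N]mulnC.

Qed.
End PortColours.

Lemma det_proportional_rows (R : idomainType) n (A : 'M[R]_n) i i' (a a' : R) :
  i != i' -> a != 0 -> (forall j, A i j * a = A i' j * a') -> \det A = 0.
Proof.
move=> ne a0 AA; apply/eqP/det0P.
exists (a *: delta_mx 0 i - a' *: delta_mx 0 i').
  apply: contraNneq a0 => /matrixP /(_ 0 i); rewrite !mxE !eqxx (negPf ne) /=.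
  by rewrite mulr1 mulr0 subr0 => ->.
apply/rowP => j; rewrite mulmxBl -!scalemxAl -!rowE !mxE mulrC AA mulrC subrr //.
Qed.

(** * Bounded rank and generic constants *)

Section RankBound.
Variables (K : fieldType) (r : nat) (ty : 'I_r -> nat * nat).
Variables (L : finType) (B : L -> nat * nat).
Local Notation arr := (arr ty B).

(** [power_char] at an indeterminate constant, so that one maximal minor serves almost all [c]. *)
Definition pchi (d : dclass ty 0 0) : {poly K} := 'X^(num_comps d).
Definition pgram (x y : arr) : {poly K} := arr_trace pchi (arr_comp x y).

Lemma arr_trace_pchi c (x : arr) : arr_trace (power_char c) x = (arr_trace pchi x).[c].
Proof.
elim/arrP: x => [|i j E]; first by rewrite horner0.
have [e|ne] := eqVneq i j; last by rewrite !arr_trace_ne ?horner0.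
by subst j; rewrite !arr_traceE /pchi hornerXn.
Qed.

Definition arr_type : finType := option {ij : L * L & {set portcol (B ij.2) * portcol (B ij.1)}}.

Definition arr_support (x : arr) : arr_type :=
  match x with
  | Some (existT ij E) => Some (existT (fun ij : L * L => {set portcol (B ij.2) * portcol (B
    ij.1)}) ij (support E))
  | None => None
  end.

Lemma pgram_support x x' : arr_support x = arr_support x' ->
  exists m m', forall y, pgram x y * 'X^m = pgram x' y * 'X^m'.
Proof.
elim/arrP: x => [|i j E]; elim/arrP: x' => [|i' j' E'] //= e.
  by exists 0%N, 0%N => y; rewrite /pgram.
have [ei ej] : i = i' /\ j = j' by case: e => -[-> ->].
subst i' j'; have {}e : support E = support E'.
  pose T (ij : L * L) := {set portcol (B ij.2) * portcol (B ij.1)}.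
  apply: (@eq_tagged _ T (i, j)).
  exact: (congr1 (fun o : arr_type =>
    if o is Some s then s else Tagged T (support E : T (i, j))) e).
have [m [m' H]] := num_comps_support e; exists m, m'; elim/arrP => [|j' k D].
  by rewrite /pgram !arr_compx0 !mul0r.
have [e1|ne1] := eqVneq j j'; last by rewrite /pgram !arr_comp_ne // !mul0r.
subst j'; rewrite /pgram !arr_compE; have [e2|ne2] := eqVneq i k;
  last by rewrite !arr_trace_ne // !mul0r.
by subst k; rewrite !arr_traceE /pchi -!exprD H.
Qed.

(** Among more arrows than there are supports, two have the same one; by [pgram_support] their rows
    are proportional, with powers of ['X] as factors. *)
Lemma pgram_rank (e : 'I_#|arr_type|.+1 -> arr) d : \det (gram pgram e d) = 0.
Proof.
have [i [i' [ne es]]] : exists i i', i != i' /\ arr_support (e i) = arr_support (e i').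
  have : ~~ injectiveb (arr_support \o e).
    by apply/negP => /injectiveP /leq_card; rewrite card_ord ltnn.
  by case/injectivePn => i [i' ne es]; exists i, i'.
have [m [m' H]] := pgram_support es.
apply: (det_proportional_rows (a := 'X^m) (a' := 'X^m') ne) => [|j]; last by rewrite !mxE H.
by rewrite monic_neq0 ?monicXn.
Qed.

End RankBound.

(** Supplies the nilpotency hypothesis of [casimir_unit]: once a power is orthogonal to every [x],
    all higher powers have trace 0. *)
Lemma twisted_eventually (K : fieldType) (A : Type) (mul : A -> A -> A) (tr : A -> K)
    (s : comb K A) k :
  twisted_rep mul tr -> (forall x, comb_eval (fun y => tr (mul y x) : K^o) (cpow mul s k) = 0) ->
  comb_eval (tr : A -> K^o) s = 0.
Proof.
move=> tw nil; apply: (@twisted_nilpotent _ _ mul _ _ k.+1 tw) => m km.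
have [n [R [W [RM RW trR]]]] := tw.
have trE u : comb_eval (tr : A -> K^o) u = \tr (comb_eval R u *m W).
  rewrite /comb_eval mulmx_suml linear_sum; apply: eq_bigr => p _.
  by rewrite -scalemxAl linearZ /= -trR.
rewrite trE (comb_eval_cpow _ _ RM).
have -> : m.+1 = (k.+1 + (m - k.+1).+1)%N by rewrite addnS subnKC.
rewrite exprD -!(comb_eval_cpow _ _ RM) -[_ * _]/(_ *m _) {2}/comb_eval.
rewrite mulmx_sumr mulmx_suml linear_sum; apply: big1 => p _ /=.
rewrite -scalemxAr -scalemxAl linearZ /= -[X in _ * X = _]/(\tr _).
suff -> : \tr (comb_eval R (cpow mul s k) *m R p.2 *m W) = 0 by rewrite mulr0.
rewrite -[RHS](nil p.2) /comb_eval !mulmx_suml linear_sum; apply: eq_bigr => p' _.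
by rewrite -!scalemxAl linearZ /= trR RM.
Qed.

Lemma nonroot (K : fieldType) (p : {poly K}) (f : nat -> K) : injective f -> p != 0 ->
  exists n, p.[f n] != 0.
Proof.
move=> fi p0; apply: NNPP => no.
have rP : all (root p) (map f (iota 0 (size p))).
  by apply/allP => _ /mapP [n _ ->]; apply/rootP/eqP/negPn/negP => pn; apply: no; exists n.
have := max_poly_roots p0 rP; rewrite size_map size_iota ltnn.
by rewrite map_inj_uniq ?iota_uniq // => /(_ isT).
Qed.

Section Generic.
Variables (K : fieldType) (charK : [pchar K] =i pred0).
Variables (r : nat) (ty : 'I_r -> nat * nat) (L : finType) (B : L -> nat * nat).

Lemma natr_inj : injective (fun n => n%:R : K).
Proof.
have key m n : (m%:R : K) = (m + n)%:R -> n = 0%N.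
  by rewrite natrD -{1}[m%:R]addr0 => /addrI /esym/eqP; have /pcharf0P -> := charK => /eqP.
move=> m n; case: (leqP m n) => [/subnKC <- /key ->|/ltnW/subnKC <- /esym/key ->];
  by rewrite addn0.
Qed.

(* The determinant of the Casimir element is polynomial in c, and nonzero at some positive integer. *)
Lemma chi_generic : (forall n, twisted (@power_char r ty K n.+1%:R) B) ->
  exists2 q : {poly K}, q != 0 & forall c, q.[c] != 0 -> twisted (@power_char r ty K c) B.
Proof.
move=> tw; have [n [e [d [ed bord]]]] := maximal_minor (@pgram_rank K r ty L B).
pose G := gram (@pgram K r ty L B) e d.
pose M x : 'M[{poly K}]_n := \matrix_(i, j) arr_trace (@pchi K r ty)
    (arr_comp (arr_comp (e i) x) (d j)).
(* The Casimir element with adjugates in place of inverses, to keep its entries polynomial; three of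
   them occur, whence the factor [(\det G).[c] ^+ 3] in [ZE]. *)
pose Zp := \sum_i \sum_j \adj G j i *: ((M (d j) *m \adj G) *m (M (e i) *m \adj G)).
pose at_ c : forall m, 'M[{poly K}]_m -> 'M[K]_m := fun m => map_mx (horner_eval c).
have detE c m (A : 'M_m) : \det (at_ c m A) = (\det A).[c] by rewrite /at_ det_map_mx.
have gE c m (e' : 'I_m -> _) d' : gram (fun x y => arr_trace (@power_char r ty K c)
    (@arr_comp r ty L B x
  y)) e' d' =
    at_ c m (gram (@pgram K r ty L B) e' d').
  by apply/matrixP => i j; rewrite !mxE arr_trace_pchi.
have fr c : (\det G).[c] != 0 -> gram (fun x y => arr_trace (@power_char r ty K c)
    (@arr_comp r ty L B x
  y)) e d \in unitmx.
  by move=> Gc; rewrite gE unitmxE unitfE detE.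
have bo c (e' : 'I_n.+1 -> _) d' : \det (gram
    (fun x y => arr_trace (@power_char r ty K c) (@arr_comp r ty
  L B x y)) e' d') = 0.
  by rewrite gE detE bord horner0.
have ZE c : (\det G).[c] != 0 -> at_ c _ Zp = (\det G).[c] ^+ 3 *:
    frame_casimir (@arr_comp r ty L B) (arr_trace (@power_char r ty K c)) e d.
  move=> Gc; have adjE : at_ c _ (\adj G) = (\det G).[c] *: invmx (at_ c _ G).
    have Gu : at_ c _ G \in unitmx by rewrite -gE fr.
    by rewrite -[LHS]/(map_mx _ _) map_mx_adj -/(at_ c _ G) /invmx Gu detE scalerA divff ?scale1r.
  have ME x : at_ c _ (M x) = frame_gram (@arr_comp r ty L B)
    (arr_trace (@power_char r ty K c)) e d x.
    by apply/matrixP => i j; rewrite !mxE arr_trace_pchi.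
  rewrite /at_ /Zp raddf_sum scaler_sumr; apply: eq_bigr => i _.
  rewrite raddf_sum scaler_sumr; apply: eq_bigr => j _.
  rewrite /= map_mxZ !map_mxM -!/(at_ c _ _) adjE !ME.
  have adjE1 : (\adj G j i).[c] = (\det G).[c] * invmx (at_ c _ G) j i.
    by have /matrixP /(_ j i) := adjE; rewrite [LHS]mxE [RHS]mxE.
  have Gm : \matrix_(i, j) arr_trace (@power_char r ty K c)
    (@arr_comp r ty L B (e i) (d j)) = at_ c _ G :=
    gE c _ e d.
  rewrite -[X in X *: _ = _]/((\adj G j i).[c]) adjE1 /frame_rep Gm.
  by rewrite -!scalemxAr -!scalemxAl !scalerA; congr (_ *: _); rewrite 3!exprS expr0 mulr1; ring.
have frm c (Gc : (\det G).[c] != 0) x y := bordered_minor x y (fr c Gc) (bo c).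
exists (\det G * \det Zp) => [|c]; last first.
  rewrite hornerM mulf_eq0 negb_or => /andP[Gc Zc].
  apply: (frame_twisted (@arr_compA r ty L B) (arr_traceC (@power_char r ty K c)) (arr_trace1 _)
    (fr c Gc) (frm c
    Gc)).
  move: Zc; rewrite -detE ZE // detZ mulf_eq0 negb_or => /andP[_].
  by rewrite unitmxE unitfE.
(* At a positive integer that is not a root of [\det G] the character is already known to be
   twisted, so its Casimir element is invertible; hence [\det Zp] is not the zero polynomial. *)
have [m Gm] : exists m, (\det G).[m.+1%:R] != 0.
  by apply: (nonroot (f := fun m => m.+1%:R)) => // m m' /natr_inj [].
rewrite mulf_neq0 //; apply: contraTneq (Gm) => Z0.
have := casimir_unit (@arr_compA r ty L B) (arr_traceC (@power_char r ty K m.+1%:R))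
    (arr_trace1 _) (fr _ Gm)
  (frm _ Gm) charK
  (fun s k => twisted_eventually (tw m)).
have := detE m.+1%:R n Zp; rewrite Z0 horner0 ZE // detZ => /eqP.
rewrite mulf_eq0 !expf_eq0 (negPf Gm) !andbF /= => Z1.
by rewrite unitmxE unitfE Z1.
Qed.

End Generic.

Section Constants.
Variables (K : fieldType) (charK : [pchar K] =i pred0).
Variables (r : nat) (ty : 'I_r -> nat * nat).
Local Notation chi := (@power_char r ty K).

Lemma mxtrace_delta n (i j : 'I_n) : \tr (delta_mx i j : 'M[K]_n) = (i == j)%:R.
Proof.
rewrite /mxtrace (bigD1 i) //= mxE eqxx big1 ?addr0 // => k nk.
by rewrite mxE (negPf nk).
Qed.

(** At [c = 1] all diagrams between two given objects behave alike, and arrows act as matrix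
    units. *)
Lemma twisted_chi1 (L : finType) (B : L -> nat * nat) : twisted (chi 1) B.
Proof.
pose R (x : arr ty B) : 'M[K]_#|L| :=
  if x is Some s then delta_mx (enum_rank (tag s).1) (enum_rank (tag s).2) else 0.
exists #|L|, R, 1%:M; split=> [x y|x|x]; rewrite ?mulmx1 ?mul1mx //.
  elim/arrP: x => [|i j E]; first by rewrite mul0mx.
  elim/arrP: y => [|j' k D]; first by rewrite arr_compx0 mulmx0.
  have [e|ne] := eqVneq j j'; last first.
    by rewrite arr_comp_ne // [RHS]mul_delta_mx_0 // (inj_eq enum_rank_inj).
  by subst j'; rewrite arr_compE [RHS]mul_delta_mx.
elim/arrP: x => [|i j E]; first by rewrite linear0.
rewrite [RHS]mxtrace_delta (inj_eq enum_rank_inj).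
have [e|ne] := eqVneq i j; last by rewrite arr_trace_ne.
by subst j; rewrite arr_traceE /power_char expr1n.
Qed.

Lemma chiD a b : gsum (chi a) (chi b) = chi (a + b).
Proof. by apply: functional_extensionality => d; apply: gsum_chi. Qed.

Lemma twisted_chi_nat n (L : finType) (B : L -> nat * nat) : twisted (chi n.+1%:R) B.
Proof.
elim: n L B => [|n IHn] L B; first exact: twisted_chi1.
by rewrite -[n.+2]addn1 natrD -chiD; apply: twisted_gsum => //; apply: twisted_chi1.
Qed.

(* c - n.+1 avoids the finitely many exceptional constants for a suitable n. *)
Lemma twisted_chi c (L : finType) (B : L -> nat * nat) : twisted (chi c) B.
Proof.
(* The exceptions are those of the family of coloured objects, which does not depend on [n]; so [n]
   may be chosen afterwards. *)
have [q q0 qP] := chi_generic charK (fun n => twisted_chi_nat n (@colobj L B false)).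
have [|n qn] := nonroot (f := fun n => c - n.+1%:R) _ q0.
  by move=> m m' /addrI /oppr_inj /(natr_inj charK) [].
rewrite -[c](subrK n.+1%:R) addrC -chiD.
by apply: twisted_gsum; [apply: twisted_chi_nat|apply: qP].
Qed.

Lemma two_exp_inj : injective (fun n => 2 ^+ n : K).
Proof. by move=> m n; rewrite -!natrX => /(natr_inj charK) /expnI ->. Qed.

Lemma juxt_morphism_chi1 : juxt_morphism (chi 1).
Proof. by split=> [|a b]; rewrite /power_char !expr1n ?mulr1. Qed.

(** Additivity of [num_comps] is read off at [c = 2]: there the function is the [gsum] of the
    constant 1 with itself, known to be multiplicative, and powers of 2 are distinct in
    characteristic 0. *)
Lemma juxt_morphism_chi c : juxt_morphism (chi c).
Proof.
have [one juxt] := juxt_morphism_gsum juxt_morphism_chi1 juxt_morphism_chi1.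
split=> [|a b]; rewrite /power_char.
  have -> // : num_comps (id0_class ty (0, 0)%N) = 0%N.
  by apply: two_exp_inj; have := one; rewrite chiD.
rewrite -exprD; congr (_ ^+ _); apply: two_exp_inj; rewrite exprD.
by have := juxt a b; rewrite chiD.
Qed.

(** Again read off at [c = 2], where [gsum_connected] gives the value [1 + 1]. *)
Lemma chi_connected c (D : dclass ty 0 0) : connected (repr D) -> chi c D = c.
Proof.
move=> cD; suff e : num_comps D = 1%N by rewrite /power_char e.
apply: two_exp_inj; have := gsum_connected juxt_morphism_chi1 juxt_morphism_chi1 cD.
by rewrite chiD {2 3}/power_char !expr1n.
Qed.

Lemma good_character_const c : good_character (fun _ : closed_connected ty => c : K).
Proof.
apply: (@good_character_intro _ _ _ (chi c)); first exact: juxt_morphism_chi.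
  by move=> L B; apply: twisted_chi.
by move=> [D cD]; apply: chi_connected.
Qed.

End Constants.

Lemma good_character_mul (K : fieldType) r (ty : 'I_r -> nat * nat)
    (f f' : closed_connected ty -> K) :
  [pchar K] =i pred0 -> good_character f -> good_character f' ->
    good_character (fun D => f D * f' D).
Proof.
move=> charK /good_character_elim [//|g [gM gt gf]] /good_character_elim [//|g' [gM' gt' gf']].
apply: (@good_character_intro _ _ _ (fun d => g d * g' d)).
- exact: juxt_morphism_mul.
- by move=> L B; apply: twisted_mul.
- by move=> D; rewrite gf gf'.
Qed.

Lemma good_character_add (K : fieldType) r (ty : 'I_r -> nat * nat)
    (f f' : closed_connected ty -> K) :
  [pchar K] =i pred0 -> good_character f -> good_character f' ->
    good_character (fun D => f D + f' D).
Proof.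
move=> charK /good_character_elim [//|g [gM gt gf]] /good_character_elim [//|g' [gM' gt' gf']].
apply: (@good_character_intro _ _ _ (gsum g g')).
- exact: juxt_morphism_gsum.
- by move=> L B; apply: twisted_gsum.
- by move=> [D cD]; rewrite -gf -gf'; apply: gsum_connected.
Qed.

Theorem theorem1p4 (K : closedFieldType) (charK : [pchar K] =i pred0)
    (r : nat) (ty : 'I_r -> nat * nat) :
  is_subalgebra (@good_character K r ty).
Proof.
split=> [|f f'|f f'|c f].
- exact: good_character_const.
- exact: good_character_add.
- exact: good_character_mul.
by move=> gf; apply: good_character_mul => //; apply: good_character_const.
Qed.
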